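(* Let $d\ge 2$, let $\mathbf{x}\in\mathbb{R}^{n_1\times\cdots\times n_d}$, let $r\ge 1$ and $p\ge 4$ be integers and set $s=r+p$. Run the following randomized TT-SVD on $\mathbf{x}$ with target rank $s$: Set $\mathbf{b}_{d+1}:=\mathbf{x}$. For $j=d,d-1,\dots,2$: (i) draw a tensor $\mathbf{g}\in\mathbb{R}^{s\times n_1\times\cdots\times n_{j-1}}$ with i.i.d. standard Gaussian entries, independently of all previous steps; (ii) form $\mathbf{a}_j:=\mathbf{g}\circ_{(2,\dots,j),(1,\dots,j-1)}\mathbf{b}_{j+1}$ (contracting modes $2,\dots,j$ of $\mathbf{g}$ with modes $1,\dots,j-1$ of $\mathbf{b}_{j+1}$), so $\mathbf{a}_d\in\mathbb{R}^{s\times n_d}$ and, for $j<d$, $\mathbf{a}_j\in\mathbb{R}^{s\times n_j\times q_j}$; (iii) compute a factorization $\mathbf{R}_j\mathbf{Q}_j=\hat M_{\{1\}}(\mathbf{a}_j)$ in which $\mathbf{Q}_j$ has orthonormal rows spanning the row space of $\hat M_{\{1\}}(\mathbf{a}_j)$; let $q_{j-1}$ be the number of rows of $\mathbf{Q}_j$, and let $\mathbf{W}_j:=\hat M^{-1}(\mathbf{Q}_j)$, so $\mathbf{W}_d\in\mathbb{R}^{q_{d-1}\times n_d}$ and $\mathbf{W}_j\in\mathbb{R}^{q_{j-1}\times n_j\times q_j}$ for $j<d$; (iv) if $j=d$ set $\mathbf{b}_d:=\mathbf{b}_{d+1}\circ_{(d),(2)}\mathbf{W}_d$, otherwise set $\mathbf{b}_j:=\mathbf{b}_{j+1}\circ_{(j,j+1),(2,3)}\mathbf{W}_j$,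 so that $\mathbf{b}_j\in\mathbb{R}^{n_1\times\cdots\times n_{j-1}\times q_{j-1}}$. Finally set $\mathbf{W}_1:=\mathbf{b}_2\in\mathbb{R}^{n_1\times q_1}$ and $P_{2..d}(\mathbf{x}):=\mathbf{W}_1\circ\mathbf{W}_2\circ\cdots\circ\mathbf{W}_d$. Then for every $u,t\ge 1$, $$\|\mathbf{x}-P_{2..d}(\mathbf{x})\|\le\sqrt{d-1}\;\eta\;\min_{\mathbf{y}:\ \text{TT-rank}(\mathbf{y})\preceq(r,\dots,r)}\|\mathbf{x}-\mathbf{y}\|,\qquad \eta=1+t\sqrt{\frac{12r}{p}}+ut\,\frac{e\sqrt{r+p}}{p+1},$$ with probability at least $\left(1-5t^{-p}-2e^{-u^2/2}\right)^{d-1}$.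
   Context: $\|\cdot\|$ is the Euclidean (Frobenius) norm of the entries. For a tensor $\mathbf{x}$ and a set of modes $\alpha$, $\hat M_\alpha(\mathbf{x})$ is the matricization whose row index combines the modes in $\alpha$ and whose column index combines the remaining modes (with a fixed consistent bijection of multi-indices); $\hat M^{-1}$ is the inverse reshaping (here $\hat M^{-1}(\mathbf{Q}_j)$ reshapes the $q_{j-1}\times(n_jq_j)$ matrix into a $q_{j-1}\times n_j\times q_j$ tensor, and is the identity for $j=d$). For tensors $\mathbf{x},\mathbf{y}$, $\mathbf{x}\circ_{k,l}\mathbf{y}$ denotes summation over a common index placed in mode $k$ of $\mathbf{x}$ and mode $l$ of $\mathbf{y}$, the result carrying the remaining modes of $\mathbf{x}$ followed by the remaining modes of $\mathbf{y}$; tuples of index pairs mean contracting each pair; plain $\circ$ contracts the last mode of the left factor with the first mode of the right factor. A TT representation of $\mathbf{y}$ is $\mathbf{y}=\mathbf{V}_1\circ\cdots\circ\mathbf{V}_d$ with $\mathbf{V}_1\in\mathbb{R}^{n_1\times r_1}$, $\mathbf{V}_i\in\mathbb{R}^{r_{i-1}\times n_i\times r_i}$, $\mathbf{V}_d\in\mathbb{R}^{r_{d-1}\times n_d}$; the TT-rank of $\mathbf{y}$ is the entrywise minimal such $(r_1,\dots,r_{d-1})$, equivalently $r_i=\operatorname{rank}\hat M_{\{1,\dots,i\}}(\mathbf{y})$. $\preceq$ denotes entrywise $\le$.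
   Formalization: The base 1-5t^{-p}-2e^{-u^2/2} of the probability bound is replaced by its maximum with 0, since for a negative base and even d-1 (e.g. d=3, u=t=1) the stated power exceeds 1 and the claim is false. *)

(* Defs.v *)
From HB Require Import structures.
From mathcomp Require Import all_boot all_order all_algebra.
From mathcomp Require Import all_classical all_reals.
From mathcomp Require Import ereal topology normedtype sequences exp measure
  lebesgue_measure lebesgue_integral probability normal_distribution.

Set Implicit Arguments.
Unset Strict Implicit.
Unset Printing Implicit Defensive.

Import Order.TTheory GRing.Theory Num.Theory.
Local Open Scope ring_scope.

(* Tensors.  A real tensor of shape [:: m_1; ...; m_k] is represented by its *)
(* entry function  seq nat -> R  (multi-index [:: i_1; ...; i_k], 0-based);  *)
(* only the entries at valid multi-indices (i_l < m_l) are ever used.        *)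

Fixpoint indices (sh : seq nat) : seq (seq nat) :=
  match sh with
  | [::] => [:: [::]]
  | m :: sh' => [seq i :: t | i <- iota 0 m, t <- indices sh']
  end.

Definition dims (n : nat -> nat) (a k : nat) : seq nat := map n (iota a k).

Definition tnorm (R : realType) (sh : seq nat) (x : seq nat -> R) : R :=
  Num.sqrt (\sum_(i <- indices sh) x i ^+ 2).

Definition matz (R : realType) (sh1 sh2 : seq nat) (y : seq nat -> R)
  : 'M[R]_(size (indices sh1), size (indices sh2)) :=
  \matrix_(a, b) y (nth [::] (indices sh1) a ++ nth [::] (indices sh2) b).

Definition ttrank_le (R : realType) (n : nat -> nat) (d r : nat)
  (y : seq nat -> R) : Prop :=
  forall i, (1 <= i)%N -> (i <= d.-1)%N ->
    (\rank (matz (dims n 1 i) (dims n i.+1 (d - i)) y) <= r)%N.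

Definition mxget (R : realType) (m k : nat) (A : 'M[R]_(m, k)) (i j : nat) : R :=
  match insub i, insub j with
  | Some i', Some j' => A i' j'
  | _, _ => 0
  end.

(* The randomized TT-SVD.                                                   *)
(*  x : input tensor of shape n_1 x ... x n_d                               *)
(*  g j : the Gaussian tensor drawn at step j (j = d,...,2), of shape        *)
(*        s x n_1 x ... x n_(j-1); entry g j k alpha                         *)
(*  q j : the ranks q_j (j = 1..d-1); convention q_d = 1 (a trailing mode    *)
(*        of size 1 is adjoined to x, b_(d+1) and W_d)                       *)
(*  Q j : the orthonormal factor Q_j, a q_(j-1) x (n_j q_j) matrix          *)
(* The column index of \hat M_{1}(a_j) combines (i_j, c) as i_j * q_j + c.  *)
Section TTSVD.
Variables (R : realType) (n : nat -> nat) (d s : nat).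
Variables (x : seq nat -> R) (g : nat -> nat -> seq nat -> R) (q : nat -> nat).
Variable (Q : forall j : nat, 'M[R]_(q j.-1, n j * q j)).

Definition Wcore (j a ij c : nat) : R := mxget (Q j) a (ij * q j + c).

(* bt m = b_(d+1-m) : entry b(alpha, c), alpha = (i_1..i_(d-m)), c < q_(d-m) *)
Fixpoint bt (m : nat) : seq nat -> nat -> R :=
  match m with
  | 0 => fun i c => if c == 0%N then x i else 0
  | m'.+1 => let j := (d - m')%N in
      fun alpha a => \sum_(ij < n j) \sum_(c < q j)
                       bt m' (rcons alpha ij) c * Wcore j a ij c
  end.

Definition bten (j : nat) : seq nat -> nat -> R := bt (d.+1 - j).

Definition aten (j k ij c : nat) : R :=
  \sum_(alpha <- indices (dims n 1 j.-1)) g j k alpha * bten j.+1 (rcons alpha ij) c.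

Definition Mhat1 (j : nat) : 'M[R]_(s, n j * q j) :=
  \matrix_(k, col) aten j k (col %/ q j) (col %% q j).

Definition valid_run : Prop :=
  q d = 1%N /\
  forall j, (2 <= j)%N -> (j <= d)%N ->
    Q j *m (Q j)^T = 1%:M /\ (Q j == Mhat1 j)%MS.

Definition ttsvd_out (i : seq nat) : R :=
  \sum_(a <- indices (dims q 1 d.-1))
    bten 2 [:: nth 0%N i 0] (nth 0%N a 0) *
    \prod_(j <- iota 2 d.-1) Wcore j (nth 0%N a (j - 2)) (nth 0%N i j.-1) (nth 0%N a j.-1).

End TTSVD.

Definition iid_std_gaussian (R : realType) (dT : measure_display)
  (T : measurableType dT) (P : probability T R) (I : eqType) (S : seq I)
  (X : I -> T -> R) : Prop :=
  uniq S /\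
  (forall i, i \in S -> measurable_fun setT (X i)) /\
  (forall B : I -> set R, (forall i, measurable (B i)) ->
     P (\bigcap_(i in [set i | i \in S]) (X i @^-1` B i))%classic
     = ((\prod_(i <- S) fine (normal_prob 0 1 (B i)))%:E)).

Definition gauss_index (n : nat -> nat) (d s : nat) : seq (nat * nat * seq nat) :=
  flatten [seq [seq (j, k, alpha) | k <- iota 0 s, alpha <- indices (dims n 1 j.-1)]
           | j <- iota 2 d.-1].

(* Main.v *)
(* One step.  Let M be the unfolding of the current tensor and U an orthonormal
   basis of the column space of the corresponding unfolding of a competitor y,
   with k <= r columns; U does not depend on the randomness.  Put
   E = M - U U^T M.  Since Q spans the row space of G M, the error of
   the step is at most |M - U (G U)^+ G M|, whose square is
   sum_l |E_l|^2 (1 + |(G U)^+ G w_l|^2) with w_l = E_l / |E_l| orthogonal to U.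
   By convexity its p-th power has expectation at most |E|^p times
   c_k = E sqrt(1 + |A^+ g|^2)^p for independent Gaussian A (s x k) and g (s x 1).
   Stripping off the first column of A, rotated onto the first axis, gives
   c_k = prod_i J_i / J_(p+i), J_m being the integral of (1 + x^2)^(-(m+1)/2),
   and (m + 1) J_(m+2) = m J_m yields c_r^2 <= 2 p binom(r+p, p).  Markov's
   inequality and an elementary estimate then bound the failure probability by
   5 t^-p + 2 exp(-u^2/2).

   All steps.  The Gram matrices K_j = M_j M_j^T of the successive unfoldings
   are functions of the Gaussian tensors alone: multiplying by the projector
   Q^T Q turns K into K G^T (G K G^T)^+ G K, and passing to the next mode is a
   partial trace.  Both operations are monotone for the Loewner order, so every
   K_j is dominated by the Gram matrix of the unfolding of x, and |E| <= |x - y|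
   at every step.  The squared errors of the steps add up to
   |x - P(x)|^2 = tr K_d - tr K'_2.  Conditioning on the previous draws gives
   the power d - 1, and the minimum over y is reached through a minimizing
   sequence and continuity of the measure from above. *)

(* The exponent p is the last integer that works: with s = r + p rows and k <= r columns the
   smallest index met is J_1, and J_0 diverges. One exact moment of order p takes the place of
   separate concentration bounds for the norms of (GU)^+.

   A valid run may choose any q and Q, with no measurability in the draw, and the claim concerns all
   runs and all y at once, so the set of good outcomes need not be measurable. This is why
   everything passes through Gram matrices: M Q^T Q M^T does not depend on the choice of Q, so one
   measurable function of the draws, [tttotal], is the squared error of every valid run, and a
   sublevel set of it is the event exhibited.

   Constants: put c = sqrt(12 r / p) + u e sqrt(r + p) / (p + 1). If c >= 2, a weighted mean of 4
   and 12 r / p gives c^2 >= 3 (r + p) / p, and 3 exceeds e by enough to beat the factor 2 p. If c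
   <= 2, (1 + c)^(2p) >= exp(c p) is a budget that pays for 2 p, for the binomial and for
   exp(u^2). *)
Require Import Defs.
From HB Require Import structures.
From mathcomp Require Import all_boot all_order all_algebra.
From mathcomp Require Import all_classical all_reals all_analysis measurable_realfun normal_distribution.
From mathcomp Require Import ring lra.
Set Implicit Arguments.
Unset Strict Implicit.
Unset Printing Implicit Defensive.
Import Order.TTheory GRing.Theory Num.Theory.
Import numFieldTopology.Exports numFieldNormedType.Exports.
Local Open Scope classical_set_scope.
Local Open Scope ring_scope.

(** * Gaussian matrices *)

Section matrix_measurable.
Context (R : realType).
Notation RR := (measurableTypeR R).
Variables m n : nat.

Definition mx_gen : set (set 'M[R]_(m, n)) :=
  [set A | exists i j (B : set RR), measurable B /\
     A = (fun M : 'M[R]_(m, n) => M i j) @^-1` B].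

HB.instance Definition _ := isPointed.Build 'M[R]_(m, n) 0.

Definition mx_display : measure_display.
Proof. exact. Qed.

HB.instance Definition _ := @isMeasurable.Build mx_display 'M[R]_(m, n)
  <<s mx_gen >> (@sigma_algebra0 _ _ _) (@sigma_algebraC _ _)
  (@sigma_algebra_bigcup _ _ _).

Lemma measurable_coef i j :
  measurable_fun [set: 'M[R]_(m, n)] (fun M => M i j : RR).
Proof.
move=> _ B mB; rewrite setTI; apply: sub_sigma_algebra.
by exists i, j, B.
Qed.

Lemma measurable_fun_mxP d (T : measurableType d) (f : T -> 'M[R]_(m, n)) :
  (forall i j, measurable_fun [set: T] (fun t => f t i j : RR)) ->
  measurable_fun [set: T] f.
Proof.
move=> mf; apply: (measurability mx_gen) => //.
move=> _ [_ [i [j [B [mB ->]]]] <-].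
exact: (mf i j measurableT B mB).
Qed.

Definition mx_box (B : 'I_m -> 'I_n -> set RR) : set 'M[R]_(m, n) :=
  [set M | forall i j, B i j (M i j)].

Lemma measurable_mx_box B : (forall i j, measurable (B i j)) ->
  measurable (mx_box B).
Proof.
move=> mB.
rewrite (_ : mx_box B = \bigcap_(i in [set: 'I_m]) \bigcap_(j in [set: 'I_n])
    ((fun M : 'M[R]_(m, n) => M i j) @^-1` B i j)).
  apply: fin_bigcap_measurable => // i _; apply: fin_bigcap_measurable => // j _.
  by rewrite -[X in measurable X]setTI; exact: measurable_coef.
by apply/seteqP; split => M MB; [move=> i _ j _; exact: MB
  |move=> i j; exact: (MB i I j I)].
Qed.

(** Boxes are stable under intersection and generate the sigma-algebra of the entries. *)
Lemma mx_measure_unique (m1 m2 : probability 'M[R]_(m, n) R) :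
  (forall B, (forall i j, measurable (B i j)) ->
     m1 (mx_box B) = m2 (mx_box B)) ->
  forall A, measurable A -> m1 A = m2 A.
Proof.
move=> m12.
pose G := [set A | exists B : 'I_m -> 'I_n -> set RR,
  (forall i j, measurable (B i j)) /\ A = mx_box B].
have GT : G setT.
  exists (fun _ _ => setT); split => //.
  by apply/seteqP; split.
apply: (measure_unique G (fun=> setT)) => //.
- apply/seteqP; split.
    apply: smallest_sub; first exact: smallest_sigma_algebra.
    move=> _ [i [j [B [mB ->]]]]; apply: sub_sigma_algebra.
    exists (fun i' j' => if (i' == i) && (j' == j) then B else setT).
    split=> [i' j'|]; first by case: ifP.
    apply/seteqP; split=> M /=.
      by move=> BM i' j'; case: ifPn => // /andP[/eqP -> /eqP ->].
    by move=> /(_ i j); rewrite !eqxx.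
  apply: smallest_sub; first exact: smallest_sigma_algebra.
  by move=> _ [B [mB ->]]; exact: measurable_mx_box.
- move=> _ _ [B1 [mB1 ->]] [B2 [mB2 ->]].
  exists (fun i j => B1 i j `&` B2 i j); split.
    by move=> i j; exact: measurableI.
  apply/seteqP; split=> M /=.
    by move=> [H1 H2] i j; split; [exact: H1|exact: H2].
  by move=> H; split => i j; case: (H i j).
- by apply/seteqP; split => // x _; exists 0%N.
- by move=> _ [B [mB ->]]; exact: m12.
- by move=> _; rewrite [X in (X < _)%E](_ : _ = 1%E) ?ltry//; exact: probability_setT.
Qed.

End matrix_measurable.

Section mx_ops_measurable.
Context (R : realType).
Notation RR := (measurableTypeR R).

Lemma measurable_trmx m n :
  measurable_fun setT (@trmx R m n).
Proof.
apply: measurable_fun_mxP => i j.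
by under eq_fun do rewrite mxE; exact: measurable_coef.
Qed.

Lemma measurable_vec_mx m n : measurable_fun setT (@vec_mx R m n).
Proof.
apply: measurable_fun_mxP => i j.
by under eq_fun do rewrite mxE; exact: measurable_coef.
Qed.

Lemma measurable_row_mx d (T : measurableType d) m n1 n2 (f : T -> 'M[R]_(m, n1))
  (g : T -> 'M[R]_(m, n2)) : measurable_fun setT f -> measurable_fun setT g ->
  measurable_fun setT (fun t => row_mx (f t) (g t)).
Proof.
move=> mf mg; apply: measurable_fun_mxP => i j.
under eq_fun do rewrite mxE.
by case: (fintype.split j) => k; apply: (measurableT_comp (measurable_coef _ _)).
Qed.

Lemma measurable_col_mx d (T : measurableType d) m1 m2 n (f : T -> 'M[R]_(m1, n))
  (g : T -> 'M[R]_(m2, n)) : measurable_fun setT f -> measurable_fun setT g ->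
  measurable_fun setT (fun t => col_mx (f t) (g t)).
Proof.
move=> mf mg; apply: measurable_fun_mxP => i j.
under eq_fun do rewrite mxE.
by case: (fintype.split i) => k; apply: (measurableT_comp (measurable_coef _ _)).
Qed.

Lemma measurable_mulmx d (T : measurableType d) m n p (f : T -> 'M[R]_(m, n))
  (g : T -> 'M[R]_(n, p)) : measurable_fun setT f -> measurable_fun setT g ->
  measurable_fun setT (fun t => f t *m g t).
Proof.
move=> mf mg; apply: measurable_fun_mxP => i j.
under eq_fun do rewrite mxE.
apply: measurable_sum => k.
by apply: measurable_funM; apply: (measurableT_comp (measurable_coef _ _)).
Qed.

Lemma measurable_scalar_mx n :
  measurable_fun setT (fun z : RR => z%:M : 'M[R]_n).
Proof.
apply: measurable_fun_mxP => i j.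
under eq_fun do rewrite mxE.
by case: (i == j) => /=; rewrite ?mulr1n ?mulr0n; [exact: measurable_id|exact: measurable_cst].
Qed.

End mx_ops_measurable.

Section gaussian_matrix.
Context (R : realType).
Notation RR := (measurableTypeR R).

Definition stdnormal : probability RR R := normal_prob 0 1.

Definition gauss_cons n (zv : RR * 'rV[R]_n) : 'rV[R]_n.+1 :=
  row_mx (zv.1%:M : 'M[R]_1) zv.2.

Lemma gauss_cons0 n (zv : RR * 'rV[R]_n) i : gauss_cons zv i ord0 = zv.1.
Proof.
rewrite /gauss_cons (_ : ord0 = @lshift 1 n ord0); last exact: val_inj.
by rewrite (@row_mxEl _ 1 1 n) mxE (ord1 i) eqxx mulr1n.
Qed.

Lemma gauss_cons_lift n (zv : RR * 'rV[R]_n) i j :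
  gauss_cons zv i (lift ord0 j) = zv.2 i j.
Proof.
rewrite /gauss_cons (_ : lift ord0 j = @rshift 1 n j); last exact: val_inj.
by rewrite (@row_mxEr _ 1 1 n).
Qed.

Lemma measurable_gauss_cons n : measurable_fun setT (@gauss_cons n).
Proof.
apply: (@measurable_row_mx _ _ _ 1 1 n); last exact: measurable_snd.
by apply: (measurableT_comp (@measurable_scalar_mx _ 1)); exact: measurable_fst.
Qed.

HB.instance Definition _ n := isMeasurableFun.Build _ _ _ _ (@gauss_cons n)
  (@measurable_gauss_cons n).
HB.instance Definition _ m n := isMeasurableFun.Build _ _ _ _ (@vec_mx R m n)
  (@measurable_vec_mx _ m n).

Fixpoint gauss_rv n : probability 'rV[R]_n R :=
  match n with
  | 0 => \d_(0 : 'rV[R]_0)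
  | n'.+1 => distribution (stdnormal \x gauss_rv n')%E (@gauss_cons n')
  end.

(** Defined by reshaping a row vector because the draws of the algorithm are stored as one;
    [gauss_vec] passes between the two forms. *)
Definition gauss m n : probability 'M[R]_(m, n) R :=
  distribution (gauss_rv (m * n)) (@vec_mx R m n).

Definition N01r (B : set RR) : R := fine (normal_prob 0 1 B).

Lemma stdnormalE B : measurable B -> stdnormal B = (N01r B)%:E.
Proof. by move=> mB; rewrite [RHS]fineK//; exact: (fin_num_measure stdnormal). Qed.

Lemma gauss_rv_box n (B : 'I_1 -> 'I_n -> set RR) :
  (forall i j, measurable (B i j)) ->
  gauss_rv n (mx_box B) = (\prod_j N01r (B ord0 j))%:E.
Proof.
elim: n B => [|n IH] B mB.
  rewrite /= diracE big_ord0 mem_set//.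
  by move=> i [].
rewrite /= /distribution /pushforward.
rewrite (_ : _ @^-1` _ = B ord0 ord0 `*`
   (mx_box (fun i j => B i (lift ord0 j)))); last first.
  apply/seteqP; split=> -[z v] /=.
    move=> H; split=> /= [|i j].
      by have := H ord0 ord0; rewrite gauss_cons0.
    by have := H i (lift ord0 j); rewrite gauss_cons_lift.
  move=> [H1 H2] i j; rewrite (ord1 i).
  case: (unliftP ord0 j) => [k ->|->]; last by rewrite gauss_cons0.
  by rewrite gauss_cons_lift; exact: H2.
rewrite product_measure1E//; last exact: measurable_mx_box.
rewrite [X in (_ * X)%E]IH// big_ord_recl EFinM; congr (_ * _)%E; exact: stdnormalE.
Qed.

Lemma gauss_box m n (B : 'I_m -> 'I_n -> set RR) :
  (forall i j, measurable (B i j)) ->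
  gauss m n (mx_box B) = (\prod_i \prod_j N01r (B i j))%:E.
Proof.
move=> mB; rewrite /gauss /= /distribution /pushforward.
pose B' (i : 'I_1) (k : 'I_(m * n)) := let p := enum_val (cast_ord (esym (mxvec_cast m n)) k) in B p.1 p.2.
rewrite (_ : _ @^-1` _ = mx_box B'); last first.
  apply/seteqP; split=> v /=.
    move=> H i k; rewrite (ord1 i) /B'; case/mxvec_indexP: k => a b.
    rewrite /mxvec_index cast_ordK enum_rankK /=.
    by have := H a b; rewrite mxE.
  move=> H a b; rewrite mxE; have := H ord0 (mxvec_index a b).
  by rewrite /B' /mxvec_index cast_ordK enum_rankK.
rewrite gauss_rv_box; last by move=> i j; exact: mB.
congr EFin; rewrite pair_big /=.
rewrite (reindex (fun p : 'I_m * 'I_n => mxvec_index p.1 p.2)) /=; last first.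
  exists (fun k => enum_val (cast_ord (esym (mxvec_cast m n)) k)).
    by move=> [a b] _; rewrite /mxvec_index cast_ordK enum_rankK.
  by move=> k _; case/mxvec_indexP: k => a b; rewrite /mxvec_index cast_ordK enum_rankK.
by apply: eq_bigr => -[a b] _; rewrite /B' /mxvec_index cast_ordK enum_rankK.
Qed.

Lemma gauss_vec m n (A : set 'M[R]_(m, n)) : measurable A ->
  gauss 1 (m * n) (@vec_mx R m n @^-1` A) = gauss m n A.
Proof.
move=> mA; have mV : measurable (@vec_mx R m n @^-1` A).
  by rewrite -[X in measurable X]setTI; exact: measurable_vec_mx.
apply: (mx_measure_unique (m1 := gauss 1 (m * n)) (m2 := gauss_rv (m * n))) => // B mB.
by rewrite gauss_box// gauss_rv_box// big_ord1.
Qed.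

(** The tool for recognising a Gaussian matrix: block rows, transposes, scalars and the given family
    are all checked on boxes. *)
Lemma gauss_law d (T : measurableType d) (mu : probability T R) m n
  (X : T -> 'M[R]_(m, n)) : measurable_fun setT X ->
  (forall B, (forall i j, measurable (B i j)) ->
    mu (X @^-1` mx_box B) = (\prod_i \prod_j N01r (B i j))%:E) ->
  forall A, measurable A -> mu (X @^-1` A) = gauss m n A.
Proof.
move=> mX XB A mA.
pose X' : {mfun T >-> 'M[R]_(m, n)} := HB.pack X (isMeasurableFun.Build _ _ _ _ X mX).
apply: (mx_measure_unique (m1 := distribution mu X') (m2 := gauss m n)) => //.
by move=> B mB; rewrite gauss_box//; exact: XB.
Qed.

Lemma ge0_integral_law d (T : measurableType d) (mu : probability T R) m n
  (X : T -> 'M[R]_(m, n)) (f : 'M[R]_(m, n) -> \bar R) : measurable_fun setT X ->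
  (forall A, measurable A -> mu (X @^-1` A) = gauss m n A) ->
  measurable_fun setT f -> (forall x, 0 <= f x)%E ->
  (\int[gauss m n]_x f x = \int[mu]_t f (X t))%E.
Proof.
move=> mX XE mf f0.
pose X' : {mfun T >-> 'M[R]_(m, n)} := HB.pack X (isMeasurableFun.Build _ _ _ _ X mX).
transitivity (\int[distribution mu X']_x f x)%E.
  by apply: eq_measure_integral => A mA _; exact: (esym (XE A mA)).
by rewrite ge0_integral_distribution.
Qed.

Lemma gauss_row_mx m n1 n2 (f : 'M[R]_(m, n1 + n2) -> \bar R) :
  measurable_fun setT f -> (forall x, 0 <= f x)%E ->
  (\int[gauss m (n1 + n2)]_x f x =
   \int[gauss m n1]_x \int[gauss m n2]_y f (row_mx x y))%E.
Proof.
move=> mf f0.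
have mr : measurable_fun setT
  (fun p : 'M[R]_(m, n1) * 'M[R]_(m, n2) => row_mx p.1 p.2).
  by apply: measurable_row_mx; [exact: measurable_fst|exact: measurable_snd].
rewrite (ge0_integral_law (mu := (gauss m n1 \x gauss m n2)%E) mr)//; last first.
  apply: gauss_law => // B mB.
  rewrite (_ : _ @^-1` _ = mx_box (fun i j => B i (lshift n2 j)) `*`
     mx_box (fun i j => B i (rshift n1 j))); last first.
    apply/seteqP; split=> -[x y] /=.
      by move=> H; split=> i j /=; [have := H i (lshift n2 j); rewrite row_mxEl
        |have := H i (rshift n1 j); rewrite row_mxEr].
    move=> [H1 H2] i j; case: (splitP j) => k jk.
      by rewrite (_ : j = lshift n2 k) ?row_mxEl; [exact: H1|exact: val_inj].
    by rewrite (_ : j = rshift n1 k) ?row_mxEr; [exact: H2|exact: val_inj].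
  transitivity (gauss m n1 (mx_box (fun i j => B i (lshift n2 j))) *
    gauss m n2 (mx_box (fun i j => B i (rshift n1 j))))%E.
    by apply: product_measure1E; exact: measurable_mx_box.
  rewrite !gauss_box// -EFinM -big_split /=.
  by congr EFin; apply: eq_bigr => i _; rewrite big_split_ord.
rewrite fubini_tonelli1//.
exact: measurableT_comp.
Qed.

Lemma gauss_tr m n (f : 'M[R]_(m, n) -> \bar R) :
  measurable_fun setT f -> (forall x, 0 <= f x)%E ->
  (\int[gauss m n]_x f x = \int[gauss n m]_x f (x^T)%R)%E.
Proof.
move=> mf f0.
rewrite (ge0_integral_law (mu := gauss n m) (@measurable_trmx _ _ _))//.
apply: gauss_law => [|B mB]; first exact: measurable_trmx.
rewrite (_ : _ @^-1` _ = mx_box (fun i j => B j i)); last first.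
  by apply/seteqP; split => M H i j; have := H j i; rewrite mxE.
by rewrite gauss_box// exchange_big.
Qed.

Lemma gauss_col_mx m1 m2 n (f : 'M[R]_(m1 + m2, n) -> \bar R) :
  measurable_fun setT f -> (forall x, 0 <= f x)%E ->
  (\int[gauss (m1 + m2) n]_x f x =
   \int[gauss m1 n]_x \int[gauss m2 n]_y f (col_mx x y))%E.
Proof.
move=> mf f0; rewrite gauss_tr// gauss_row_mx//; last first.
  by apply: (measurableT_comp mf); exact: measurable_trmx.
have mc : measurable_fun setT (fun p : 'M[R]_(m1, n) * 'M[R]_(m2, n) => f (col_mx p.1 p.2)).
  apply: (measurableT_comp mf).
  by apply: measurable_col_mx; [exact: measurable_fst|exact: measurable_snd].
rewrite [RHS]gauss_tr//; last 2 first.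
- exact: (measurable_fun_fubini_tonelli_F _ mc).
- by move=> x; exact: integral_ge0.
apply: eq_integral => x _; rewrite [RHS]gauss_tr//; last first.
  exact: (measurable_fun_pair2 x^T mc).
by apply: eq_integral => y _; rewrite tr_row_mx.
Qed.

Lemma gauss_11 (f : 'M[R]_(1, 1) -> \bar R) :
  measurable_fun setT f -> (forall x, 0 <= f x)%E ->
  (\int[gauss 1 1]_x f x = \int[stdnormal]_z f z%:M)%E.
Proof.
move=> mf f0; rewrite (ge0_integral_law (mu := stdnormal) (@measurable_scalar_mx _ 1))//.
apply: gauss_law => [|B mB]; first exact: measurable_scalar_mx.
rewrite !big_ord1 -stdnormalE; last exact: mB.
congr (stdnormal _); apply/seteqP; split => z.
  by move=> /(_ ord0 ord0); rewrite mxE.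
by move=> H i j; rewrite (ord1 i) (ord1 j) mxE.
Qed.

Lemma gauss_m0 m (f : 'M[R]_(m, 0) -> \bar R) :
  (\int[gauss m 0]_x f x = f (0%R : 'M[R]_(m, 0)))%E.
Proof.
rewrite (eq_integral (cst (f (0%R : 'M[R]_(m, 0))))); last first.
  by move=> x _; rewrite (thinmx0 x).
by rewrite integral_cst// [X in (_ * X)%E](_ : _ = 1%E) ?mule1//; exact: probability_setT.
Qed.

Lemma gauss_0n n (f : 'M[R]_(0, n) -> \bar R) :
  (\int[gauss 0 n]_x f x = f (0%R : 'M[R]_(0, n)))%E.
Proof.
rewrite (eq_integral (cst (f (0%R : 'M[R]_(0, n))))); last first.
  by move=> x _; rewrite (flatmx0 x).
by rewrite integral_cst// [X in (_ * X)%E](_ : _ = 1%E) ?mule1//; exact: probability_setT.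
Qed.

End gaussian_matrix.

#[global] Opaque gauss.

(** * The standard normal law on the line and in the plane *)

Section normal_1d.
Context (R : realType).
Notation RR := (measurableTypeR R).
Notation mu := (@lebesgue_measure R).
Local Notation pdf := (@normal_pdf R 0 1).

(** The function [pdf] and the Radon-Nikodym derivative have the same integral over every measurable
    set, hence agree almost everywhere. *)
Lemma integral_stdnormal (f : RR -> \bar R) : measurable_fun setT f ->
  (forall x, 0 <= f x)%E ->
  (\int[stdnormal R]_x f x = \int[mu]_x (f x * (pdf x)%:E))%E.
Proof.
move=> mf f0.
have dom : stdnormal R `<< mu by exact: normal_prob_dominates.
pose g := Radon_Nikodym_SigmaFinite.f (stdnormal R) mu.
rewrite -(Radon_Nikodym_SigmaFinite.change_of_variables dom)//.
have ig := Radon_Nikodym_SigmaFinite.f_integrable dom.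
apply: ae_eq_integral => //.
- apply: emeasurable_funM => //; exact: (measurable_int mu).
- apply: emeasurable_funM => //; apply/measurable_EFinP; exact: measurable_normal_pdf.
- apply: ae_eqe_mul2l => /=.
  apply: integral_ae_eq => //.
  + by apply/measurable_EFinP; exact: measurable_normal_pdf.
  + move=> E _ mE.
    by rewrite -(Radon_Nikodym_SigmaFinite.f_integral dom)//.
Qed.


Let affine (a b : R) : RR -> RR := fun x => (a * x + b)%R.

Let measurable_affine a b : measurable_fun setT (affine a b).
Proof.
by apply: measurable_funD => //; apply: measurable_funM.
Qed.

Let mpush a b : {measure set RR -> \bar R} :=
  measure_function_pushforward__canonical__measure_function_Measure mu
    (measurable_affine a b).

(** The right side is a measure that gives half-open intervals their length. For a < 0 the preimage
    is closed at the other end, with the same length. *)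
Lemma lebesgue_measure_affine (a b : R) (A : set RR) : a != 0 -> measurable A ->
  mu A = (`|a|%:E * mu (affine a b @^-1` A))%E.
Proof.
move=> a0 mA.
pose m' := mscale (NngNum (normr_ge0 a)) (mpush a b).
transitivity (m' A); last by [].
apply: lebesgue_measure_unique => // _ [[c d]] _ <-.
transitivity (`|a|%:E * mu (affine a b @^-1` `]c, d]%classic))%E; last by [].
rewrite /=.
have [ap|an] : {0 < a} + {a < 0} by case: (ltgtP a 0) a0 => // ?; [right|left].
- rewrite (_ : affine a b @^-1` _ = `](c - b) / a, (d - b) / a]%classic); last first.
    apply/seteqP; split => x; rewrite /affine /= !in_itv /= ltr_pdivrMr// ler_pdivlMr//; lra.
  rewrite !lebesgue_measure_itv /= !lte_fin ltr_pM2r ?invr_gt0// ltrD2r.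
  case: ifP => _; last by rewrite mule0.
  rewrite -!EFinB -EFinM gtr0_norm//; congr EFin; field; exact: lt0r_neq0.
- rewrite (_ : affine a b @^-1` _ = `[(d - b) / a, (c - b) / a[%classic); last first.
    apply/seteqP; split => x; rewrite /affine /= !in_itv /= ltr_ndivlMr// ler_ndivrMr//; lra.
  rewrite !lebesgue_measure_itv /= !lte_fin ltr_nM2r ?invr_lt0// ltrD2r.
  case: ifP => _; last by rewrite mule0.
  rewrite -!EFinB -EFinM ltr0_norm//; congr EFin; field; exact: ltr0_neq0.
Qed.

Lemma integral_affine (a b : R) (f : RR -> \bar R) : a != 0 ->
  measurable_fun setT f -> (forall x, 0 <= f x)%E ->
  (\int[mu]_x f x = `|a|%:E * \int[mu]_x f (a * x + b)%R)%E.
Proof.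
move=> a0 mf f0.
pose m' := mscale (NngNum (normr_ge0 a)) (mpush a b).
transitivity (\int[m']_x f x)%E.
  by apply: eq_measure_integral => A mA _; exact: lebesgue_measure_affine.
rewrite ge0_integral_mscale//=; congr (_ * _)%E.
by rewrite ge0_integral_pushforward.
Qed.

(** A rotation with a <> 0 splits into one-dimensional substitutions. For fixed y put x' = a x - b
    y; as a^2 + b^2 = 1, the other coordinate becomes y / a + (b / a) x'. After exchanging the
    integrals, a substitution in y absorbs the factor 1 / |a|. *)
Lemma integral2_rot (a b : R) (f : RR * RR -> \bar R) : a ^+ 2 + b ^+ 2 = 1 ->
  a != 0 -> measurable_fun setT f -> (forall x, 0 <= f x)%E ->
  (\int[mu]_x \int[mu]_y f (a * x - b * y, b * x + a * y)%R =
   \int[mu]_x \int[mu]_y f (x, y))%E.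
Proof.
move=> ab a0 mf f0.
have mrot : measurable_fun setT (fun p : RR * RR => f (a * p.1 - b * p.2, b * p.1 + a * p.2)%R).
  apply: (measurableT_comp mf); apply/measurable_fun_pairP; split; rewrite /comp /=.
    by apply: measurable_funB; apply: measurable_funM.
  by apply: measurable_funD; apply: measurable_funM.
have msh : measurable_fun setT (fun p : RR * RR => f (p.1, p.2 / a + b / a * p.1)%R).
  apply: (measurableT_comp mf); apply/measurable_fun_pairP.
  split; first exact: measurable_fst.
  by rewrite /comp /=; apply: measurable_funD; apply: measurable_funM.
rewrite [LHS](_ : _ = \int[mu]_y \int[mu]_x f (a * x - b * y, b * x + a * y)%R)%E; last first.
  by apply: (fubini_tonelli _ mrot) => p; exact: f0.
transitivity (\int[mu]_y \int[mu]_x (`|a|^-1%:E * f (x, y / a + b / a * x)%R))%E.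
  apply: eq_integral => y _.
  rewrite ge0_integralZl//; last exact: (measurable_fun_pair1 y msh).
  rewrite (@integral_affine a (- b * y) (fun x => f (x, y / a + b / a * x)%R))//; last first.
    exact: (measurable_fun_pair1 y msh).
  rewrite muleA -EFinM mulVf ?normr_eq0// mul1e.
  apply: eq_integral => x _; congr (f (_, _)); first by rewrite mulNr.
  rewrite /= (_ : y / a = (a ^+ 2 + b ^+ 2) * y / a); last by rewrite ab mul1r.
  by field.
transitivity (\int[mu]_x \int[mu]_y (`|a|^-1%:E * f (x, y / a + b / a * x)%R))%E.
  apply: (fubini_tonelli (fun p : RR * RR => `|a|^-1%:E * f (p.2, p.1 / a + b / a * p.2)%R)%E); last first.
    by move=> x; rewrite mule_ge0// lee_fin invr_ge0.
  apply: emeasurable_funM => //.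
  apply: (measurableT_comp mf); apply/measurable_fun_pairP.
  split; first exact: measurable_snd.
  by rewrite /comp /=; apply: measurable_funD; apply: measurable_funM.
apply: eq_integral => x _.
rewrite (@integral_affine a^-1 (b / a * x) (fun y => f (x, y)))//; last 2 first.
- by rewrite invr_eq0.
- exact: (measurable_fun_pair2 x mf).
rewrite ge0_integralZl//; last exact: (measurable_fun_pair2 x msh).
rewrite normfV; congr (_ * _)%E.
by apply: eq_integral => y _; congr (f (_, _)); rewrite mulrC.
Qed.

Lemma pdf_rot (a b x y : R) : a ^+ 2 + b ^+ 2 = 1 ->
  pdf (a * x - b * y) * pdf (b * x + a * y) = pdf x * pdf y.
Proof.
move=> ab; rewrite !normal_pdfE ?oner_neq0// /normal_fun !subr0.
rewrite mulrACA -expRD [RHS]mulrACA -expRD; congr (_ * expR _).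
rewrite -mulrDl -[RHS]mulrDl -!opprD; congr (- _ / _).
by rewrite -[RHS]mul1r -ab; ring.
Qed.

Lemma stdnormal2 (f : RR * RR -> \bar R) : measurable_fun setT f ->
  (forall x, 0 <= f x)%E ->
  (\int[stdnormal R]_x \int[stdnormal R]_y f (x, y) =
   \int[mu]_x \int[mu]_y (f (x, y) * (pdf x * pdf y)%:E))%E.
Proof.
move=> mf f0.
have mp : measurable_fun setT (fun x : RR => (pdf x)%:E).
  by apply/measurable_EFinP; exact: measurable_normal_pdf.
rewrite integral_stdnormal; last 2 first.
- exact: measurable_fun_fubini_tonelli_F.
- by move=> x; exact: integral_ge0.
apply: eq_integral => x _.
have mfx : measurable_fun setT (fun y => f (x, y)) by exact: measurable_fun_pair2.
rewrite integral_stdnormal// -ge0_integralZr//; last 3 first.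
- exact: emeasurable_funM.
- by move=> y _; rewrite mule_ge0// lee_fin normal_pdf_ge0.
- by rewrite lee_fin normal_pdf_ge0.
by apply: eq_integral => y _; rewrite -muleA -EFinM [X in _ = (_ * X%:E)%E]mulrC.
Qed.

Lemma stdnormalN (f : RR -> \bar R) : measurable_fun setT f ->
  (forall x, 0 <= f x)%E ->
  (\int[stdnormal R]_x f (- x)%R = \int[stdnormal R]_x f x)%E.
Proof.
move=> mf f0; rewrite !integral_stdnormal//; last exact: measurableT_comp.
rewrite [RHS](@integral_affine (-1) 0) ?oppr_eq0 ?oner_neq0//; last 2 first.
- by apply: emeasurable_funM => //; apply/measurable_EFinP; exact: measurable_normal_pdf.
- by move=> y; rewrite mule_ge0// lee_fin normal_pdf_ge0.
rewrite normrN1 mul1e; apply: eq_integral => x _.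
by rewrite addr0 mulN1r !normal_pdfE ?oner_neq0// /normal_fun !subr0 sqrrN.
Qed.

Lemma stdnormal2_rot (a b : R) (f : RR * RR -> \bar R) : a ^+ 2 + b ^+ 2 = 1 ->
  measurable_fun setT f -> (forall x, 0 <= f x)%E ->
  (\int[stdnormal R]_x \int[stdnormal R]_y f (a * x - b * y, b * x + a * y)%R =
   \int[stdnormal R]_x \int[stdnormal R]_y f (x, y))%E.
Proof.
move=> ab mf f0.
have mrot : measurable_fun setT (fun p : RR * RR => f (a * p.1 - b * p.2, b * p.1 + a * p.2)%R).
  apply: (measurableT_comp mf); apply/measurable_fun_pairP; split; rewrite /comp /=.
    by apply: measurable_funB; apply: measurable_funM.
  by apply: measurable_funD; apply: measurable_funM.
have [a0|a0] := eqVneq a 0; last first.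
  rewrite [LHS](_ : _ = \int[mu]_x \int[mu]_y (f (a * x - b * y, b * x + a * y)%R * (pdf x * pdf y)%:E))%E; last first.
    by apply: (stdnormal2 mrot) => p; exact: f0.
  rewrite [RHS](stdnormal2 mf f0).
  pose F p := (f p * (pdf p.1 * pdf p.2)%:E)%E.
  transitivity (\int[mu]_x \int[mu]_y F (a * x - b * y, b * x + a * y)%R)%E.
    by apply: eq_integral => x _; apply: eq_integral => y _; rewrite /F /= pdf_rot.
  apply: integral2_rot => //.
    apply: emeasurable_funM => //; apply/measurable_EFinP; apply: measurable_funM;
    by apply: measurableT_comp => //; exact: measurable_normal_pdf.
  by move=> p; rewrite mule_ge0// lee_fin mulr_ge0 ?normal_pdf_ge0.
(* For a = 0 the substitutions break down; the rotation is an exchange of coordinates with one sign,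
   settled by Fubini and the evenness of the density. *)
rewrite [LHS](_ : _ = \int[stdnormal R]_y \int[stdnormal R]_x f (a * x - b * y, b * x + a * y)%R)%E; last first.
  by apply: (fubini_tonelli _ mrot) => p; exact: f0.
have mfx x : measurable_fun setT (fun y => f (x, y)) by exact: measurable_fun_pair2.
have /orP[/eqP b1|/eqP b1] : (b == 1) || (b == -1).
  by rewrite -eqf_sqr expr1n -ab a0 expr0n add0r.
- transitivity (\int[stdnormal R]_y (fun z => \int[stdnormal R]_x f (z, x)) (- y)%R)%E.
    apply: eq_integral => x _; apply: eq_integral => y _.
    by rewrite a0 b1 !mul0r !mul1r sub0r addr0.
  apply: stdnormalN; last by move=> x; exact: integral_ge0.
  exact: measurable_fun_fubini_tonelli_F.
- apply: eq_integral => y _; rewrite -[RHS]stdnormalN//.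
  by apply: eq_integral => x _; rewrite a0 b1 !mul0r !mulN1r sub0r opprK addr0.
Qed.

(** The weight times the density at x is the density at l x, where l = sqrt(1 + c), so substituting
    x / l leaves only the factor 1 / l. In [kapE0] c is a square x^2 and 1 / l is [jw x]. *)
Lemma stdnormal_scale (c : R) (f : RR -> \bar R) : 0 <= c -> measurable_fun setT f ->
  (forall x, 0 <= f x)%E ->
  (\int[stdnormal R]_x (f x * (expR (- (c * x ^+ 2) / 2))%:E) =
   (Num.sqrt (1 + c))^-1%:E * \int[stdnormal R]_x f (x / Num.sqrt (1 + c))%R)%E.
Proof.
move=> c0 mf f0; set l := Num.sqrt (1 + c).
have l0 : 0 < l by rewrite sqrtr_gt0; lra.
have l2 : l ^+ 2 = 1 + c by rewrite sqr_sqrtr//; lra.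
have me : measurable_fun setT (fun x : RR => (expR (- (c * x ^+ 2) / 2))%:E).
  apply/measurable_EFinP; apply: (measurableT_comp (@measurable_expR R)).
  apply: measurable_funM => //; apply: measurableT_comp => //.
  by apply: measurable_funM => //; exact: measurable_funX.
have mp : measurable_fun setT (fun x : RR => (pdf x)%:E).
  by apply/measurable_EFinP; exact: measurable_normal_pdf.
have ml : measurable_fun setT (fun x : RR => f (x / l)).
  by apply: measurableT_comp => //; exact: measurable_funM.
rewrite integral_stdnormal; last 2 first.
- exact: emeasurable_funM.
- by move=> x; rewrite mule_ge0// lee_fin expR_ge0.
rewrite (@integral_affine l^-1 0); last 3 first.
- by rewrite invr_eq0 gt_eqF.
- by apply: emeasurable_funM => //; exact: emeasurable_funM.
- by move=> x; rewrite !mule_ge0// lee_fin ?expR_ge0 ?normal_pdf_ge0.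
have -> : `|l^-1| = l^-1 by rewrite gtr0_norm ?invr_gt0.
congr (_ * _)%E; rewrite [RHS](integral_stdnormal ml); last by move=> x; exact: f0.
apply: eq_integral => x _; rewrite addr0 [l^-1 * x]mulrC -muleA -EFinM; congr (_ * _%:E)%E.
rewrite !normal_pdfE ?oner_neq0// /normal_fun !subr0 mulrCA -expRD; congr (_ * expR _).
rewrite expr1n -mulrDl -opprD; congr (- _ / _).
rewrite -[X in _ + X]mul1r -mulrDl addrC -l2 expr_div_n mulrC divfK//.
by rewrite expf_neq0// gt_eqF.
Qed.

Lemma stdnormal_div (r : R) (f : RR -> \bar R) : 0 < r -> measurable_fun setT f ->
  (forall x, 0 <= f x)%E ->
  (\int[stdnormal R]_x f (x / r)%R = \int[mu]_x (f x * (r * pdf (r * x))%:E))%E.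
Proof.
move=> r0 mf f0.
have mp : measurable_fun setT (fun x : RR => (pdf x)%:E).
  by apply/measurable_EFinP; exact: measurable_normal_pdf.
have mr : measurable_fun setT (fun x : RR => f (x / r)).
  by apply: measurableT_comp => //; exact: measurable_funM.
have mpr : measurable_fun setT (fun x : RR => (pdf (r * x))%:E).
  apply: (measurableT_comp mp); exact: measurable_funM.
rewrite integral_stdnormal// (@integral_affine r 0); last 3 first.
- by rewrite gt_eqF.
- exact: emeasurable_funM.
- by move=> x; rewrite mule_ge0// lee_fin normal_pdf_ge0.
rewrite gtr0_norm// -ge0_integralZl//; last 3 first.
- under eq_fun do rewrite addr0 mulrAC divff ?gt_eqF// mul1r.
  exact: emeasurable_funM.
- by move=> x _; rewrite mule_ge0// lee_fin normal_pdf_ge0.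
- by rewrite lee_fin ltW.
apply: eq_integral => x _; rewrite addr0 [r * x / r]mulrAC divff ?gt_eqF// mul1r.
by rewrite muleCA EFinM.
Qed.

End normal_1d.

#[global] Opaque stdnormal.

(** * Orthogonal invariance of Gaussian matrices *)

Section gauss_invariance.
Context (R : realType).
Notation RR := (measurableTypeR R).
Local Open Scope ereal_scope.

(* Invariance under right multiplication by O is only established for the products
   of plane rotations and reflections provided by [align]; general orthogonal
   matrices follow in [gauss_orth]. *)
Definition gauss_inv n (O : 'M[R]_n) := forall m (f : 'M[R]_(m, n) -> \bar R),
  measurable_fun setT f -> (forall x, 0 <= f x) ->
  \int[gauss R m n]_x f (x *m O)%R = \int[gauss R m n]_x f x.

Lemma measurable_mulmxr m n p (O : 'M[R]_(n, p)) :
  measurable_fun setT (fun x : 'M[R]_(m, n) => x *m O)%R.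
Proof. exact: measurable_mulmx. Qed.

Lemma measurable_mulmxl m n p (O : 'M[R]_(m, n)) :
  measurable_fun setT (fun x : 'M[R]_(n, p) => O *m x)%R.
Proof. exact: measurable_mulmx. Qed.

Lemma measurable_row_mx_pair m n1 n2 :
  measurable_fun setT (fun p : 'M[R]_(m, n1) * 'M[R]_(m, n2) => row_mx p.1 p.2).
Proof. by apply: measurable_row_mx; [exact: measurable_fst|exact: measurable_snd]. Qed.

Lemma measurable_col_mx_pair m1 m2 n :
  measurable_fun setT (fun p : 'M[R]_(m1, n) * 'M[R]_(m2, n) => col_mx p.1 p.2).
Proof. by apply: measurable_col_mx; [exact: measurable_fst|exact: measurable_snd]. Qed.

Lemma measurable_comp_row m n1 n2 (f : 'M[R]_(m, n1 + n2) -> \bar R) :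
  measurable_fun setT f -> measurable_fun setT
    (fun p : 'M[R]_(m, n1) * 'M[R]_(m, n2) => f (row_mx p.1 p.2)).
Proof. by move=> mf; exact: (measurableT_comp mf (@measurable_row_mx_pair _ _ _)). Qed.

Lemma measurable_comp_col m1 m2 n (f : 'M[R]_(m1 + m2, n) -> \bar R) :
  measurable_fun setT f -> measurable_fun setT
    (fun p : 'M[R]_(m1, n) * 'M[R]_(m2, n) => f (col_mx p.1 p.2)).
Proof. by move=> mf; exact: (measurableT_comp mf (@measurable_col_mx_pair _ _ _)). Qed.

(** O acts on each row separately and the rows are independent, so one row decides. *)
Lemma gauss_invP n (O : 'M[R]_n) :
  (forall f : 'M[R]_(1, n) -> \bar R,
    measurable_fun setT f -> (forall x, 0 <= f x) ->
    \int[gauss R 1 n]_x f (x *m O)%R = \int[gauss R 1 n]_x f x) -> gauss_inv O.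
Proof.
move=> H; elim=> [|m IH] f mf f0; first by rewrite !gauss_0n mul0mx.
have mfc := @measurable_comp_col 1 m n _ mf.
rewrite (@gauss_col_mx _ 1 m n)//; last exact: measurableT_comp (@measurable_mulmxr _ _ _ O).
rewrite [RHS](@gauss_col_mx _ 1 m n); [|exact: mf|exact: f0].
rewrite -(H (fun x => \int[gauss R m n]_y f (col_mx x y))); last 2 first.
- exact: (measurable_fun_fubini_tonelli_F _ mfc).
- by move=> x; exact: integral_ge0.
apply: eq_integral => x _.
rewrite -(IH (fun y => f (col_mx (x *m O) y)%R))//; last first.
  exact: (measurable_fun_pair2 (x *m O)%R mfc).
by apply: eq_integral => y _; rewrite (@mul_col_mx _ 1 m).
Qed.

Lemma gauss_inv_mul n (O1 O2 : 'M[R]_n) :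
  gauss_inv O1 -> gauss_inv O2 -> gauss_inv (O1 *m O2)%R.
Proof.
move=> H1 H2 m f mf f0; rewrite -(H2 m f)// -(H1 m (fun x => f (x *m O2)%R))//.
  by apply: eq_integral => x _; rewrite mulmxA.
exact: (measurableT_comp mf (measurable_mulmxr _)).
Qed.

Lemma gauss_inv1 n : gauss_inv (1%:M : 'M[R]_n)%R.
Proof. by move=> m f mf f0; apply: eq_integral => x _; rewrite mulmx1. Qed.

Lemma gauss_inv_block n (O : 'M[R]_n) : gauss_inv O ->
  gauss_inv (block_mx 1%:M 0 0 O : 'M[R]_(1 + n))%R.
Proof.
move=> H m f mf f0.
have mfr := @measurable_comp_row m 1 n _ mf.
rewrite gauss_row_mx//; last exact: (measurableT_comp mf (measurable_mulmxr _)).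
rewrite [RHS]gauss_row_mx; [|exact: mf|exact: f0]; apply: eq_integral => x _.
rewrite -(H m (fun y => f (row_mx x y)))//; last exact: (measurable_fun_pair2 x mfr).
by apply: eq_integral => y _; rewrite mul_row_block !mulmx0 mulmx1 addr0 add0r.
Qed.

Lemma gauss_invN1 : gauss_inv ((- 1)%:M : 'M[R]_1)%R.
Proof.
apply: gauss_invP => f mf f0.
have mfs := measurableT_comp mf (@measurable_scalar_mx R 1).
rewrite gauss_11//; last exact: (measurableT_comp mf (measurable_mulmxr _)).
rewrite [RHS]gauss_11// -[RHS](stdnormalN mfs); last by move=> x; exact: f0.
apply: eq_integral => x _.
by rewrite -scalar_mxM mulrN1.
Qed.

Definition rot_mx n (a b : R) : 'M[R]_(1 + (1 + n)) :=
  block_mx a%:M (row_mx b%:M 0) (col_mx (- b)%:M 0) (block_mx a%:M 0 0 1%:M).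

Lemma mul_rot_mx n (a b : R) m (x y : 'M[R]_(m, 1)) (z : 'M[R]_(m, n)) :
  (row_mx x (row_mx y z) *m rot_mx n a b =
  row_mx (a *: x - b *: y) (row_mx (b *: x + a *: y) z))%R.
Proof.
rewrite /rot_mx mul_row_block mul_row_col mulmx0 addr0 !mul_mx_scalar scaleNr.
congr row_mx; rewrite mul_mx_row mul_row_block !mulmx0 mulmx1 add0r addr0.
by rewrite !mul_mx_scalar add_row_mx add0r.
Qed.

Lemma rot_mx_orth n (a b : R) : (a ^+ 2 + b ^+ 2 = 1)%R ->
  (rot_mx n a b *m (rot_mx n a b)^T = 1%:M)%R.
Proof.
move=> ab.
have -> : (rot_mx n a b)^T = rot_mx n a (- b).
  rewrite /rot_mx tr_block_mx tr_scalar_mx tr_col_mx tr_row_mx tr_block_mx !trmx0.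
  by rewrite !tr_scalar_mx opprK.
have rotK (x y : 'M[R]_(1 + (1 + n), 1)) z :
    (row_mx x (row_mx y z) *m rot_mx n a b *m rot_mx n a (- b) = row_mx x (row_mx y z))%R.
  rewrite !mul_rot_mx; congr row_mx.
    apply/matrixP => i j; rewrite !mxE /=; transitivity ((a ^+ 2 + b ^+ 2) * x i j)%R.
      by ring.
    by rewrite ab mul1r.
  congr row_mx.
  apply/matrixP => i j; rewrite !mxE /=; transitivity ((a ^+ 2 + b ^+ 2) * y i j)%R.
    by ring.
  by rewrite ab mul1r.
by rewrite -[LHS]mul1mx mulmxA -[1%:M%R]hsubmxK -[rsubmx 1%:M%R]hsubmxK rotK.
Qed.

Lemma gauss_inv_rot n (a b : R) : (a ^+ 2 + b ^+ 2 = 1)%R ->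
  gauss_inv (rot_mx n a b).
Proof.
move=> ab; apply: gauss_invP => f mf f0.
have mf3 : measurable_fun setT (fun p : (RR * RR) * 'M[R]_(1, n) =>
    f (row_mx p.1.1%:M (row_mx p.1.2%:M p.2))%R).
  apply: (measurableT_comp mf).
  apply: (@measurable_row_mx _ _ _ 1 1 (1 + n)).
    apply: (measurableT_comp (@measurable_scalar_mx R 1)).
    exact: (measurableT_comp measurable_fst measurable_fst).
  apply: (@measurable_row_mx _ _ _ 1 1 n); last exact: measurable_snd.
  apply: (measurableT_comp (@measurable_scalar_mx R 1)).
  exact: (measurableT_comp measurable_snd measurable_fst).
pose g (p : RR * RR) := \int[gauss R 1 n]_v f (row_mx p.1%:M (row_mx p.2%:M v))%R.
have mg : measurable_fun setT g by exact: (measurable_fun_fubini_tonelli_F _ mf3).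
have g0 p : 0 <= g p by exact: integral_ge0.
have split3 (h : 'M[R]_(1, 1 + (1 + n)) -> \bar R) : measurable_fun setT h ->
    (forall x, 0 <= h x) -> \int[gauss R 1 (1 + (1 + n))]_x h x =
    \int[stdnormal R]_x \int[stdnormal R]_y \int[gauss R 1 n]_v
      h (row_mx x%:M (row_mx y%:M v))%R.
  move=> mh h0; rewrite gauss_row_mx//.
  have mhr := @measurable_comp_row 1 1 (1 + n) _ mh.
  rewrite gauss_11//; last 2 first.
  - exact: (measurable_fun_fubini_tonelli_F _ mhr).
  - by move=> x; exact: integral_ge0.
  apply: eq_integral => x _.
  have mhx : measurable_fun setT (fun y => h (row_mx x%:M y)%R).
    exact: (measurable_fun_pair2 (x%:M)%R mhr).
  rewrite gauss_row_mx; [|exact: mhx|by move=> y; exact: h0].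
  rewrite gauss_11; first by [].
    exact: (measurable_fun_fubini_tonelli_F _ (@measurable_comp_row 1 1 n _ mhx)).
  by move=> y; exact: integral_ge0.
rewrite [RHS](split3 f mf f0) [LHS]split3; last 2 first.
- exact: (measurableT_comp mf (measurable_mulmxr _)).
- by move=> x; exact: f0.
transitivity (\int[stdnormal R]_x \int[stdnormal R]_y g (a * x - b * y, b * x + a * y)%R);
  last exact: stdnormal2_rot.
apply: eq_integral => x _; apply: eq_integral => y _; apply: eq_integral => v _.
rewrite mul_rot_mx !scale_scalar_mx.
by rewrite raddfB raddfD.
Qed.

Definition sqn m n (A : 'M[R]_(m, n)) : R := (\sum_i \sum_j A i j ^+ 2)%R.

Lemma sqn_ge0 m n (A : 'M[R]_(m, n)) : (0 <= sqn A)%R.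
Proof. by apply: sumr_ge0 => i _; apply: sumr_ge0 => j _; exact: sqr_ge0. Qed.

Lemma sqn_trmul m n (A : 'M[R]_(m, n)) : (sqn A = \tr (A *m A^T))%R.
Proof.
apply: eq_bigr => i _; rewrite mxE; apply: eq_bigr => j _.
by rewrite mxE expr2.
Qed.

Lemma sqn_tr m n (A : 'M[R]_(m, n)) : sqn A^T = sqn A.
Proof.
rewrite /sqn exchange_big; apply: eq_bigr => i _; apply: eq_bigr => j _.
by rewrite mxE.
Qed.

Lemma sqn_mulTmx m n (A : 'M[R]_(m, n)) : (sqn A = \tr (A^T *m A))%R.
Proof. by rewrite -sqn_tr sqn_trmul trmxK. Qed.

Lemma sqn_eq0 m n (A : 'M[R]_(m, n)) : (sqn A == 0)%R = (A == 0)%R.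
Proof.
apply/idP/eqP => [|->]; last first.
  by apply/eqP; rewrite /sqn big1// => i _; rewrite big1// => j _; rewrite mxE expr0n.
rewrite psumr_eq0; last by move=> i _; apply: sumr_ge0 => j _; exact: sqr_ge0.
move=> /allP H; apply/matrixP => i j; rewrite mxE.
have := H i; rewrite mem_index_enum => /(_ isT) /=.
rewrite psumr_eq0; last by move=> k _; exact: sqr_ge0.
by move=> /allP /(_ j); rewrite mem_index_enum sqrf_eq0 => /(_ isT) /eqP.
Qed.

Lemma sqn_orthl m n p (O : 'M[R]_(p, m)) (A : 'M[R]_(m, n)) :
  (O^T *m O = 1%:M)%R -> sqn (O *m A)%R = sqn A.
Proof.
by move=> OO; rewrite !sqn_mulTmx trmx_mul mulmxA -[(_ *m _ *m O)%R]mulmxA OO mulmx1.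
Qed.

Lemma sqn_row m n1 n2 (A : 'M[R]_(m, n1)) (B : 'M[R]_(m, n2)) :
  (sqn (row_mx A B) = sqn A + sqn B)%R.
Proof.
rewrite /sqn -big_split; apply: eq_bigr => i _; rewrite big_split_ord /=.
by congr (_ + _)%R; apply: eq_bigr => j _; rewrite (row_mxEl, row_mxEr).
Qed.

Lemma sqn_col m1 m2 n (A : 'M[R]_(m1, n)) (B : 'M[R]_(m2, n)) :
  (sqn (col_mx A B) = sqn A + sqn B)%R.
Proof. by rewrite -sqn_tr tr_col_mx sqn_row !sqn_tr. Qed.

Lemma sqn_scalar (a : R) : sqn (a%:M : 'M[R]_1)%R = (a ^+ 2)%R.
Proof. by rewrite /sqn !big_ord1 mxE eqxx mulr1n. Qed.

Lemma sqn0 m n : sqn (0 : 'M[R]_(m, n))%R = 0%R.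
Proof. by apply/eqP; rewrite sqn_eq0. Qed.

(** Givens elimination: the induction hypothesis aligns the tail of v, then a plane rotation merges
    it with the first entry. A reflection occurs only in dimension one, to make r nonnegative. *)
Lemma align n (v : 'cV[R]_(1 + n)) : exists (O : 'M[R]_(1 + n)) (r : R),
  [/\ gauss_inv O, O *m O^T = 1%:M, O^T *m v = col_mx r%:M 0 & 0 <= r]%R.
Proof.
elim: n v => [|n IH] v.
  have vE : v = (v ord0 ord0)%:M :> 'M[R]_(1 + 0, 1).
    by apply/matrixP => i j; rewrite (ord1 i) (ord1 j) mxE.
  have cE (r : R) : col_mx (r%:M : 'M[R]_1) (0 : 'M[R]_(0, 1))%R = r%:M :> 'cV_(1 + 0).
    apply/matrixP => i j; rewrite (ord1 j) (_ : i = lshift 0 (ord0 : 'I_1)).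
      by rewrite col_mxEu !mxE.
    exact: val_inj (ord1 i) || by rewrite (ord1 i); exact: val_inj.
  have [v0|v0] := leP 0%R (v ord0 ord0).
    exists 1%:M%R, (v ord0 ord0); split => //.
    - exact: gauss_inv1.
    - by rewrite trmx1 mulmx1.
    - by rewrite trmx1 mul1mx cE.
  exists (- 1)%:M%R, (- v ord0 ord0)%R; split.
  - exact: gauss_invN1.
  - by rewrite tr_scalar_mx -scalar_mxM mulrNN mulr1.
  - by rewrite tr_scalar_mx [in LHS]vE cE -scalar_mxM mulN1r.
  - by rewrite oppr_ge0 ltW.
pose v1 := usubmx v; pose v2 := dsubmx v.
have [U [rr [invU orthU Ov rr0]]] := IH v2.
pose Pm : 'M[R]_(1 + (1 + n)) := block_mx 1%:M 0 0 U.
have invPm : gauss_inv Pm by exact: gauss_inv_block.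
have orthPm : (Pm *m Pm^T = 1%:M)%R.
  rewrite /Pm tr_block_mx !trmx0 trmx1 mulmx_block !mulmx0 !mul0mx !addr0 mul1mx add0r.
  by rewrite orthU -scalar_mx_block.
pose v0 := v1 ord0 ord0.
have PvE : (Pm^T *m v = col_mx v0%:M (col_mx rr%:M 0))%R.
  rewrite /Pm tr_block_mx !trmx0 trmx1 -[v]vsubmxK mul_block_col !mul0mx addr0 add0r mul1mx.
  rewrite Ov; congr col_mx.
  by apply/matrixP => i j; rewrite (ord1 i) (ord1 j) [RHS]mxE eqxx mulr1n.
(* If this vanishes, no angle is defined; but then v = 0 and [Pm] works with r = 0. *)
have [r0|r0] := eqVneq (v0 ^+ 2 + rr ^+ 2)%R 0%R.
  have [v00 rr00] : v0 = 0%R /\ rr = 0%R.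
    move/eqP : r0; rewrite paddr_eq0 ?sqr_ge0// !sqrf_eq0 => /andP[/eqP ? /eqP ?].
    by split.
  exists Pm, 0%R; split => //.
  by rewrite PvE v00 rr00 raddf0 col_mx0.
set r := Num.sqrt (v0 ^+ 2 + rr ^+ 2).
have r2 : (r ^+ 2 = v0 ^+ 2 + rr ^+ 2)%R by rewrite sqr_sqrtr// addr_ge0// sqr_ge0.
have rn0 : r != 0%R.
  by apply: contra_neq r0 => rE; rewrite -r2 rE expr0n.
(* The angle is chosen so that the second coordinate b v0 + a rr of [mul_rot_mx] vanishes. *)
have ab : ((v0 / r) ^+ 2 + (- rr / r) ^+ 2 = 1)%R.
  by rewrite !expr_div_n sqrrN -mulrDl -r2 divff// expf_neq0.
exists (Pm *m rot_mx n (v0 / r) (- rr / r))%R, r; split.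
- by apply: gauss_inv_mul => //; exact: gauss_inv_rot.
- rewrite trmx_mul mulmxA -[(Pm *m _ *m _)%R]mulmxA rot_mx_orth// mulmx1.
  exact: orthPm.
- rewrite trmx_mul -mulmxA PvE -[col_mx v0%:M%R _]trmxK -trmx_mul.
  rewrite tr_col_mx tr_col_mx !tr_scalar_mx trmx0 mul_rot_mx !scale_scalar_mx.
  rewrite [X in row_mx X _](_ : _ = r%:M%R); last first.
    rewrite -raddfB; congr (_%:M)%R.
    rewrite (_ : (_ - _ = (v0 ^+ 2 + rr ^+ 2) / r)%R); last by field.
    by rewrite -r2 expr2 mulfK.
  rewrite [X in row_mx _ (row_mx X _)](_ : _ = 0%R); last first.
    by rewrite -raddfD (_ : (_ + _ = 0)%R) ?raddf0//; field.
  by rewrite row_mx0 tr_row_mx trmx0 tr_scalar_mx.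
- exact: sqrtr_ge0.
Qed.

Lemma align_sqn n (v : 'cV[R]_(1 + n)) (O : 'M[R]_(1 + n)) r :
  (O *m O^T = 1%:M -> O^T *m v = col_mx r%:M 0 -> sqn v = r ^+ 2)%R.
Proof.
move=> OO Ov; rewrite -(@sqn_orthl _ _ _ O^T) ?trmxK//.
by rewrite Ov sqn_col sqn_scalar sqn0 addr0.
Qed.

Lemma gauss_left n m (O : 'M[R]_n) (f : 'M[R]_(n, m) -> \bar R) : gauss_inv O ->
  measurable_fun setT f -> (forall x, 0 <= f x) ->
  \int[gauss R n m]_x f (O^T *m x)%R = \int[gauss R n m]_x f x.
Proof.
move=> H mf f0.
rewrite [LHS]gauss_tr; last 2 first.
- exact: (measurableT_comp mf (@measurable_mulmxl _ _ _ _)).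
- by move=> x; exact: f0.
rewrite [RHS]gauss_tr; [|exact: mf|exact: f0].
rewrite -[RHS](H m (fun x => f x^T)%R); last 2 first.
- exact: (measurableT_comp mf (@measurable_trmx _ _ _)).
- by move=> x; exact: f0.
by apply: eq_integral => x _; rewrite trmx_mul.
Qed.

(** Align the first column of V with the first axis. It has norm 1, so r = 1, and orthogonality to
    it forces the rest of the first row to vanish. What remains is block diagonal, with a smaller
    block that again has orthonormal columns. *)
Lemma gauss_orth s N m (V : 'M[R]_(N, m)) (f : 'M[R]_(s, m) -> \bar R) :
  (V^T *m V = 1%:M)%R -> measurable_fun setT f -> (forall x, 0 <= f x) ->
  \int[gauss R s N]_x f (x *m V)%R = \int[gauss R s m]_x f x.
Proof.
elim: N m V f => [|N IH] m V f VV mf f0.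
  case: m V f VV mf f0 => [|m] V f VV mf f0.
    by rewrite !gauss_m0 (thinmx0 (_ *m V)%R).
  move/matrixP: VV => /(_ ord0 ord0); rewrite mxE big_ord0 mxE => /eqP.
  by rewrite eq_sym oner_eq0.
case: m V f VV mf f0 => [|m] V f VV mf f0.
  rewrite gauss_m0 (eq_integral (cst (f (0%R : 'M[R]_(s, 0))))); last first.
    by move=> x _; rewrite (thinmx0 (_ *m V)%R).
  by rewrite integral_cst// [X in (_ * X)%E](_ : _ = 1%E) ?mule1//; exact: probability_setT.
move: V f VV mf f0; rewrite -[m.+1]/(1 + m)%N -[N.+1]/(1 + N)%N => V f VV mf f0.
have [U [r [invU OO Ov r0]]] := align (lsubmx (V : 'M[R]_(1 + N, 1 + m))).
pose W : 'M[R]_(1 + N, 1 + m) := (U^T *m V)%R.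
have WW : (W^T *m W = 1%:M)%R.
  by rewrite /W trmx_mul trmxK mulmxA -[(_ *m U *m _)%R]mulmxA OO mulmx1.
have WE : W = block_mx r%:M%R (usubmx (rsubmx W)) 0%R (dsubmx (rsubmx W)).
  rewrite block_mxEh vsubmxK -[LHS]hsubmxK; congr row_mx.
  by rewrite /W -mulmx_lsub Ov.
move: WW; rewrite WE tr_block_mx mulmx_block tr_scalar_mx !trmx0 !mul0mx !mulmx0 !addr0.
rewrite -scalar_mxM scalar_mx_block => /eq_block_mx[r1 u0 _ W22].
have {}r1 : r = 1%R.
  move/matrixP : r1 => /(_ ord0 ord0); rewrite !mxE eqxx !mulr1n => /eqP.
  by rewrite -expr2 sqrf_eq1 => /orP[/eqP //|/eqP rN]; move: r0; rewrite rN ler0N1.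
have {}u0 : usubmx (rsubmx W) = 0%R by rewrite -u0 r1 mul1mx.
rewrite u0 trmx0 mul0mx add0r in W22.
rewrite u0 r1 in WE.
have mfr := @measurable_comp_row s 1 m _ mf.
transitivity (\int[gauss R s (1 + N)]_x f (x *m W)%R).
  rewrite -[RHS]invU; last 2 first.
  - exact: (measurableT_comp mf (@measurable_mulmxr _ _ _ W)).
  - by move=> x; exact: f0.
  by apply: eq_integral => x _; rewrite /W mulmxA -[(x *m _ *m _)%R]mulmxA OO mulmx1.
rewrite [LHS]gauss_row_mx; last 2 first.
- exact: (measurableT_comp mf (@measurable_mulmxr _ _ _ W)).
- by move=> x; exact: f0.
rewrite [RHS](@gauss_row_mx _ s 1 m); [|exact: mf|exact: f0].
apply: eq_integral => x _.
rewrite -(IH _ _ (fun y => f (row_mx x y)) W22); last 2 first.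
- exact: (measurable_fun_pair2 x mfr).
- by move=> y; exact: f0.
apply: eq_integral => y _; rewrite WE mul_row_block mulmx1 !mulmx0 addr0 add0r.
by rewrite -WE.
Qed.

Lemma gauss_lin n (v : 'cV[R]_n) (f : RR -> \bar R) :
  measurable_fun setT f -> (forall x, 0 <= f x) ->
  \int[gauss R 1 n]_x f ((x *m v) ord0 ord0)%R =
  \int[stdnormal R]_z f (Num.sqrt (sqn v) * z)%R.
Proof.
move=> mf f0; case: n v => [|n] v.
  rewrite gauss_m0 mul0mx mxE (_ : sqn v = 0%R); last by rewrite /sqn big_ord0.
  under eq_integral do rewrite sqrtr0 mul0r.
  by rewrite integral_cst// [X in (_ * X)%E](_ : _ = 1%E) ?mule1//; exact: probability_setT.
have [U [r [invU OO Ov r0]]] := align v.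
rewrite (align_sqn OO Ov) sqrtr_sqr ger0_norm//.
have mfm p (w : 'cV[R]_p) : measurable_fun setT (fun x : 'M[R]_(1, p) => f ((x *m w) ord0 ord0)%R).
  apply: (measurableT_comp mf).
  exact: (measurableT_comp (measurable_coef _ _) (@measurable_mulmxr 1 _ _ w)).
transitivity (\int[gauss R 1 n.+1]_x f ((x *m (U^T *m v)) ord0 ord0)%R).
  rewrite -[RHS]invU; [|exact: mfm|by move=> x; exact: f0].
  apply: eq_integral => x _.
  by rewrite mulmxA -[(x *m _ *m _)%R]mulmxA OO mulmx1.
rewrite Ov (@gauss_row_mx _ 1 1 n); [|exact: mfm|by move=> x; exact: f0].
rewrite gauss_11; last 2 first.
- exact: (measurable_fun_fubini_tonelli_F _ (@measurable_comp_row 1 1 n _ (mfm _ _))).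
- by move=> x; exact: integral_ge0.
apply: eq_integral => z _.
rewrite (eq_integral (cst (f (r * z)%R))); last first.
  by move=> y _; rewrite (@mul_row_col _ 1 1 n 1) mulmx0 addr0 -scalar_mxM mxE eqxx mulr1n mulrC.
by rewrite integral_cst// [X in (_ * X)%E](_ : _ = 1%E) ?mule1//; exact: probability_setT.
Qed.

Lemma measurable_sqn m n : measurable_fun setT (fun x : 'M[R]_(m, n) => sqn x : RR).
Proof.
apply: measurable_sum => i; apply: measurable_sum => j.
by apply: measurable_funX; exact: measurable_coef.
Qed.

Lemma measurable_scalemx m n (c : R) :
  measurable_fun setT (fun x : 'M[R]_(m, n) => c *: x)%R.
Proof.
apply: measurable_fun_mxP => i j; under eq_fun do rewrite mxE.
by apply: measurable_funM => //; exact: measurable_coef.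
Qed.

(** This is [stdnormal_scale] once per entry; the power m becomes a power of [jw]. *)
Lemma gauss_scale m (c : R) (f : 'cV[R]_m -> \bar R) : (0 <= c)%R ->
  measurable_fun setT f -> (forall x, 0 <= f x) ->
  \int[gauss R m 1]_x (f x * (expR (- (c * sqn x) / 2))%:E) =
  ((Num.sqrt (1 + c))^-1 ^+ m)%:E * \int[gauss R m 1]_x f ((Num.sqrt (1 + c))^-1 *: x)%R.
Proof.
move=> c0; set l := ((Num.sqrt (1 + c))^-1)%R.
have me k : measurable_fun setT (fun x : 'M[R]_(k, 1) => (expR (- (c * sqn x) / 2))%:E).
  apply/measurable_EFinP; apply: (measurableT_comp (@measurable_expR R)).
  apply: measurable_funM => //; apply: measurableT_comp => //.
  by apply: measurable_funM => //; exact: measurable_sqn.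
have e0 (x : R) : 0 <= (expR x)%:E by rewrite lee_fin expR_ge0.
elim: m f => [|m IH] f mf f0.
  rewrite !gauss_0n expr0 mul1e scaler0 (_ : sqn _ = 0%R); last by rewrite /sqn big_ord0.
  by rewrite mulr0 oppr0 mul0r expR0 mule1.
have mfc := @measurable_comp_col 1 m 1 _ mf.
rewrite [LHS](@gauss_col_mx _ 1 m 1); last 2 first.
- by apply: emeasurable_funM; [exact: mf|exact: (me m.+1)].
- by move=> x; exact: mule_ge0.
rewrite (@gauss_col_mx _ 1 m 1); last 2 first.
- exact: (measurableT_comp mf (@measurable_scalemx _ _ _)).
- by move=> x; exact: f0.
have mfcl : measurable_fun setT (fun p : 'M[R]_(1,1) * 'M[R]_(m,1) => f (col_mx p.1 (l *: p.2))%R).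
  apply: (measurableT_comp mf); apply: (@measurable_col_mx _ _ _ 1 m 1); first exact: measurable_fst.
  by apply: (measurableT_comp (@measurable_scalemx _ _ _)); exact: measurable_snd.
pose g (x : 'M[R]_(1, 1)) := \int[gauss R m 1]_y f (col_mx x (l *: y))%R.
have mg : measurable_fun setT g by exact: (measurable_fun_fubini_tonelli_F _ mfcl).
have g0 x : 0 <= g x by exact: integral_ge0.
have lm0 k : (0 <= l ^+ k)%R by rewrite exprn_ge0// invr_ge0 sqrtr_ge0.
transitivity (\int[gauss R 1 1]_x ((l ^+ m)%:E * (g x * (expR (- (c * sqn x) / 2))%:E))).
  apply: eq_integral => x _.
  transitivity (\int[gauss R m 1]_y ((expR (- (c * sqn x) / 2))%:E *
      (f (col_mx x y) * (expR (- (c * sqn y) / 2))%:E))).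
    apply: eq_integral => y _; rewrite (@sqn_col 1 m 1) muleCA -EFinM -expRD.
    by congr (_ * (expR _)%:E); ring.
  have mfx : measurable_fun setT (fun y => f (col_mx x y)).
    exact: (measurable_fun_pair2 x mfc).
  rewrite ge0_integralZl; [|exact: measurableT|by apply: emeasurable_funM; [exact: mfx|exact: (me m)]|
    by move=> y _; exact: mule_ge0|exact: e0].
  rewrite (IH (fun y => f (col_mx x y))); [|exact: mfx|by move=> y; exact: f0].
  by rewrite muleCA; congr (_ * _); rewrite muleC.
rewrite ge0_integralZl; [|exact: measurableT|by apply: emeasurable_funM; [exact: mg|exact: (me 1%N)]|
  by move=> y _; exact: mule_ge0|by rewrite lee_fin; exact: lm0].
have mgs : measurable_fun setT (fun z : RR => g z%:M%R).
  exact: (measurableT_comp mg (@measurable_scalar_mx R 1)).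
rewrite [in LHS]gauss_11; last 2 first.
- by apply: emeasurable_funM; [exact: mg|exact: (me 1%N)].
- by move=> x; exact: mule_ge0.
under eq_integral do rewrite sqn_scalar.
rewrite (stdnormal_scale c0 mgs); last by move=> z; exact: g0.
rewrite muleA -EFinM -exprSr; congr (_ * _).
have mfl : measurable_fun setT (fun p : 'M[R]_(1, 1) * 'M[R]_(m, 1) =>
    f (l *: (col_mx p.1 p.2 : 'cV[R]_(1 + m)))%R).
  apply: (measurableT_comp mf); apply: (measurableT_comp (@measurable_scalemx _ _ _)).
  exact: (@measurable_col_mx_pair 1 m 1).
rewrite [RHS]gauss_11; last 2 first.
- exact: (measurable_fun_fubini_tonelli_F _ mfl).
- by move=> x; exact: integral_ge0.
apply: eq_integral => z _; apply: eq_integral => y _.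
by rewrite (@scale_col_mx _ 1 m 1) scale_scalar_mx mulrC.
Qed.

End gauss_invariance.

(** * The moments of the least-squares cost *)

Section cauchy_integrals.
Context (R : realType).
Notation RR := (measurableTypeR R).
Notation mu := (@lebesgue_measure R).

Implicit Types x : R.

(* [jw x ^+ m.+1] is the integrand of J_m; the cosine avoids differentiating a
   square root. *)
Definition jw (x : R) : R := cos (atan x).

Lemma jwE x : jw x = (Num.sqrt (1 + x ^+ 2))^-1.
Proof. exact: cos_atan. Qed.

Lemma jw2 x : jw x ^+ 2 = (1 + x ^+ 2)^-1.
Proof. by rewrite jwE exprVn sqr_sqrtr// addr_ge0// sqr_ge0. Qed.

Lemma jw_gt0 x : 0 < jw x.
Proof. by rewrite jwE invr_gt0 sqrtr_gt0 ltr_wpDr// sqr_ge0. Qed.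

Lemma jw_le1 x : jw x <= 1.
Proof. exact: cos_le1. Qed.

Lemma jw_continuous : continuous jw.
Proof.
move=> x; apply: continuous_comp; first exact: continuous_atan.
exact: continuous_cos.
Qed.

Lemma is_derive_jw x : is_derive x 1 jw (- (x * jw x ^+ 3)).
Proof.
have := @is_derive1_comp R (@cos R) (@atan R) x _ _ (is_derive_cos (atan x)) (is_derive1_atan x).
move=> H; apply: (is_derive_eq H).
have sE : sin (atan x) = x * jw x.
  by rewrite -[X in _ = X * _](atanK x) /tan -/(jw x) divfK// gt_eqF// jw_gt0.
by rewrite sE -jw2; ring.
Qed.

Definition jw_int m := (\int[mu]_x (jw x ^+ m.+1)%:E)%E.
Let H m := (\int[mu]_(x in `[0%R, +oo[) (jw x ^+ m.+1)%:E)%E.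

Lemma measurable_jwX n (D : set RR) : measurable_fun D (fun x : RR => (jw x ^+ n)%:E).
Proof.
apply/measurable_EFinP; apply: measurable_funX.
by apply: measurable_funTS; apply: continuous_measurable_fun; exact: jw_continuous.
Qed.

Lemma jwX_ge0 n x : (0 <= (jw x ^+ n)%:E)%E.
Proof. by rewrite lee_fin exprn_ge0// ltW// jw_gt0. Qed.

Let jw_intH m : jw_int m = (2%:E * H m)%E.
Proof.
rewrite /jw_int ge0_symfun_integralT//; last 3 first.
- by move=> x; rewrite exprn_ge0// ltW// jw_gt0.
- by move=> x; apply: (@continuous_comp _ _ _ jw (fun y => y ^+ m.+1));
    [exact: jw_continuous|exact: exprn_continuous].
- by move=> x /=; rewrite !jwE sqrrN.
by rewrite -set_itvcy.
Qed.

Let H1 : H 1 = (pi / 2)%:E.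
Proof. by rewrite -integral0y_oneDsqr /H; apply: eq_integral => x _; rewrite jw2. Qed.

Let cvg_F m : (0 < m)%N -> x * jw x ^+ m.+1 @[x --> +oo] --> (0 : R).
Proof.
case: m => // m _.
apply: (@squeeze_cvgr _ _ _ _ (cst 0) (fun x => x^-1)).
- near=> x.
  have x0 : 0 < x by near: x; exact: nbhs_pinfty_gt.
  apply/andP; split.
    by rewrite mulr_ge0 ?(ltW x0)// exprn_ge0// ltW// jw_gt0.
  rewrite -[X in _ <= X]mul1r ler_pdivlMr//.
  apply: (@le_trans _ _ (x ^+ 2 * jw x ^+ 2)).
    rewrite mulrAC -expr2 ler_wpM2l ?sqr_ge0//.
    rewrite -[leRHS]mulr1 -[m.+2]/(2 + m)%N exprD ler_wpM2l ?sqr_ge0//.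
    by rewrite exprn_ile1 ?jw_le1// ltW// jw_gt0.
  by rewrite jw2 ler_pdivrMr ?mul1r ?lerDr// ltr_wpDr// sqr_ge0.
- exact: cvg_cst.
- apply: gtr0_cvgV0 || apply/gtr0_cvgV0 => //.
    by near=> x; near: x; exact: nbhs_pinfty_gt.
Unshelve. all: by end_near. Qed.

(** Let w = [jw]. The primitive F(x) = x w^(m+1) + m atan x has derivative (m+1) w^(m+3) + m (w^2 -
    w^(m+1)). The arctangent is added to make this nonnegative, so that the fundamental theorem on
    the half-line applies before any integrability is known. Its contribution m pi / 2 cancels
    against the integral of m w^2. *)
Let H_rec m : (0 < m)%N -> ((m.+1)%:R%:E * H m.+2 = m%:R%:E * H m)%E.
Proof.
move=> m0.
pose f x := (m.+1)%:R * jw x ^+ m.+3 + m%:R * (jw x ^+ 2 - jw x ^+ m.+1).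
pose F x := x * jw x ^+ m.+1 + m%:R * atan x.
have d0 x : 0 <= jw x ^+ 2 - jw x ^+ m.+1.
  case: m m0 {f F} => // m _; rewrite subr_ge0 -[m.+2]/(2 + m)%N exprD -[leRHS]mulr1.
  rewrite ler_wpM2l ?sqr_ge0//.
  by rewrite exprn_ile1 ?jw_le1// ltW// jw_gt0.
have e0 n x : 0 <= jw x ^+ n by rewrite exprn_ge0// ltW// jw_gt0.
have dF x : is_derive x 1 F (f x).
  have dj := is_derive_jw x.
  have := @is_deriveD _ _ _ _ _ x 1 _ _
    (is_deriveM (is_derive_id x 1) (@is_deriveX _ _ jw m.+1 x 1 _ dj))
    (@is_deriveM _ _ _ _ x 1 _ _ (@is_derive_cst R R R m%:R x 1) (is_derive1_atan x)).
  have -> : F = id * jw ^+ m.+1 + cst m%:R * (@atan R) :> (R -> R).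
    by apply/funext => y; rewrite /F /= !fctE.
  move=> D; apply: (is_derive_eq D).
  rewrite /f /= -jw2 /GRing.scale /= exprfctE !mulr1 mulr0 addr0.
  have xw : x ^+ 2 * jw x ^+ 2 = 1 - jw x ^+ 2.
    rewrite jw2; have : 1 + x ^+ 2 != 0 by rewrite gt_eqF// ltr_wpDr// sqr_ge0.
    by move=> ?; field.
  transitivity (jw x ^+ m.+1 - m.+1%:R * jw x ^+ m.+1 * (x ^+ 2 * jw x ^+ 2) +
     m%:R * jw x ^+ 2).
    by rewrite [jw x ^+ m.+1]exprS; ring.
  by rewrite xw !exprS -[m.+1]addn1 natrD; ring.
have cf : continuous f.
  have cw : continuous jw := jw_continuous.
  have cX n : continuous (fun x => jw x ^+ n).
    by move=> x; apply: (@continuous_comp _ _ _ jw (fun y => y ^+ n));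
      [exact: jw_continuous|exact: exprn_continuous].
  move=> x; apply: (@cvgD _ R^o).
    by apply: cvgM; [exact: cvg_cst|exact: cX].
  by apply: cvgM; [exact: cvg_cst|apply: (@cvgB _ R^o); exact: cX].
have cF : continuous F.
  by move=> x; apply/differentiable_continuous/derivable1_diffP; apply: ex_derive.
have f_ge0 x : 0 <= f x by rewrite /f addr_ge0// mulr_ge0.
have := @ge0_continuous_FTC2y R f F 0 (m%:R * (pi / 2)).
have F0 : F 0 = 0 by rewrite /F mul0r atan0 mulr0 addr0.
rewrite F0 sube0 => FTC.
have {}FTC : (\int[mu]_(x in `[0%R, +oo[) (f x)%:E = (m%:R * (pi / 2))%:E)%E.
  apply: FTC.
  - by move=> x _.
  - exact: continuous_subspaceT.
  - rewrite -[X in _ --> X]add0r; apply: (@cvgD _ R^o); first exact: cvg_F.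
    by apply: cvgM; [exact: cvg_cst|exact: cvgy_atan].
  - by move=> x _; apply: ex_derive.
  - by rewrite -[X in _ --> X]F0; apply: cvg_at_right_filter; exact: cF.
  - by move=> x _; rewrite derive1E; exact: derive_val.
pose D := (\int[mu]_(x in `[0%R, +oo[) (jw x ^+ 2 - jw x ^+ m.+1)%:E)%E.
have mD : measurable_fun (`[0%R, +oo[%classic : set RR) (fun x : RR => (jw x ^+ 2 - jw x ^+ m.+1)%:E).
  by apply/measurable_EFinP; apply: measurable_funB;
    apply/measurable_EFinP; exact: measurable_jwX.
have DH : (D + H m = (pi / 2)%:E)%E.
  rewrite -H1 /D /H -ge0_integralD//.
  - by apply: eq_integral => x _; rewrite -EFinD subrK.
  - by move=> x _; rewrite lee_fin.
  - by move=> x _; rewrite lee_fin.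
  - exact: measurable_jwX.
move: FTC; rewrite /f.
under eq_integral do rewrite EFinD.
have mW n (E : set RR) : measurable_fun E (fun x : RR => jw x ^+ n).
  by apply/measurable_EFinP; exact: measurable_jwX.
rewrite ge0_integralD; [|by []|by move=> x _; rewrite lee_fin mulr_ge0|
  by apply/measurable_EFinP; apply: measurable_funM|
  by move=> x _; rewrite lee_fin mulr_ge0|
  by apply/measurable_EFinP; apply: measurable_funM => //; apply: measurable_funB].
under eq_integral do rewrite EFinM.
rewrite ge0_integralZl; [|by []|exact: measurable_jwX|by move=> x _; rewrite lee_fin|by rewrite lee_fin].
under [X in (_ + X)%E]eq_integral do rewrite EFinM.
rewrite ge0_integralZl; [|by []|exact: mD|by move=> x _; rewrite lee_fin|by rewrite lee_fin].
rewrite -/(H m.+2) -/D.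
have Dfin : D \is a fin_num.
  rewrite ge0_fin_numE; last by apply: integral_ge0 => x _; rewrite lee_fin.
  rewrite (@le_lt_trans _ _ (pi / 2)%:E) ?ltry// -DH leeDl//.
  by apply: integral_ge0 => x _; rewrite lee_fin.
have Hfin : H m \is a fin_num.
  rewrite ge0_fin_numE; last by apply: integral_ge0 => x _; rewrite lee_fin.
  rewrite (@le_lt_trans _ _ (pi / 2)%:E) ?ltry// -DH leeDr//.
  by apply: integral_ge0 => x _; rewrite lee_fin.
have DHr : fine D + fine (H m) = pi / 2.
  by apply/EFin_inj; rewrite EFinD !fineK.
rewrite -(fineK Dfin) -(fineK Hfin) -DHr => /(congr1 (fun z => z - m%:R%:E * (fine D)%:E)%E).
rewrite /= addeK; last by rewrite -EFinM.
rewrite -!EFinM -EFinB => E; rewrite E.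
by congr EFin; ring.
Qed.

Let H_fin m : H m.+1 \is a fin_num.
Proof.
rewrite ge0_fin_numE; last by apply: integral_ge0 => x _; rewrite lee_fin exprn_ge0// ltW// jw_gt0.
apply: (@le_lt_trans _ _ (H 1)); last by rewrite H1 ltry.
apply: ge0_le_integral => //; [by move=> x _; exact: jwX_ge0|
  exact: measurable_jwX|exact: measurable_jwX|].
- move=> x _; rewrite lee_fin -[m.+2]/(2 + m)%N exprD -[leRHS]mulr1.
  rewrite ler_wpM2l ?sqr_ge0//.
  by rewrite exprn_ile1 ?jw_le1// ltW// jw_gt0.
Qed.

(** The integral diverges for m = 0, whence the condition 0 < m in the evaluation and the recursion
    below. *)
Definition jwr m : R := fine (jw_int m).

Lemma jw_intE m : (0 < m)%N -> jw_int m = (jwr m)%:E.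
Proof.
by case: m => // m _; rewrite /jwr fineK// jw_intH fin_numM// H_fin.
Qed.

Lemma jwr_rec m : (0 < m)%N -> m.+1%:R * jwr m.+2 = m%:R * jwr m.
Proof.
move=> m0; apply/EFin_inj; rewrite !EFinM -!jw_intE// !jw_intH.
by rewrite muleCA H_rec// muleCA.
Qed.

Lemma jwr_ge0 m : 0 <= jwr m.
Proof. by apply: fine_ge0; apply: integral_ge0 => x _; exact: jwX_ge0. Qed.

Lemma jwr_le m : (0 < m)%N -> jwr m.+1 <= jwr m.
Proof.
move=> m0; rewrite -lee_fin -!jw_intE//.
apply: ge0_le_integral => //; [by move=> x _; exact: jwX_ge0|
  exact: measurable_jwX|exact: measurable_jwX|].
- move=> x _; rewrite lee_fin [jw x ^+ m.+2]exprS ler_piMl ?jw_le1//.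
  by rewrite exprn_ge0// ltW// jw_gt0.
Qed.

End cauchy_integrals.

(** * The moment contributed by one column *)

Section kappa.
Context (R : realType).
Notation RR := (measurableTypeR R).
Notation mu := (@lebesgue_measure R).

Lemma measurable_invr : measurable_fun setT (fun x : RR => x^-1 : RR).
Proof.
have -> : (fun x : RR => x^-1 : RR) = (fun x => x * powR (x ^+ 2) (-1)).
  apply/funext => x; rewrite powR_inv1 ?sqr_ge0// expr2 invfM mulrA.
  by have [->|x0] := eqVneq x 0; rewrite ?invr0 ?mulr0// divff// mul1r.
apply: measurable_funM => //.
by apply: (measurableT_comp (@measurable_powR R (-1))); exact: measurable_funX.
Qed.

Lemma measurable_sqrt : measurable_fun setT (fun x : RR => Num.sqrt x : RR).
Proof. by apply: continuous_measurable_fun; exact: sqrt_continuous. Qed.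

(** The factor by which a column h multiplies the moment: in a frame where h lies on the first axis,
    the coefficient of h is a Gaussian divided by |h|. For h = 0 the quotient is 0 by convention, on
    a null set when s > 0. *)
Definition kap p s : \bar R :=
  (\int[gauss R s 1]_h \int[stdnormal R]_z
     ((Num.sqrt (1 + z ^+ 2 / sqn h)) ^+ p)%:E)%E.

Lemma gauss_sqn_eq0 s : gauss R s.+1 1 [set h | sqn h = 0] = 0%E.
Proof.
pose B (i : 'I_s.+1) (j : 'I_1) : set RR := [set 0].
have -> : [set h : 'M[R]_(s.+1, 1) | sqn h = 0] = mx_box B.
  apply/seteqP; split => h /=.
    by move/eqP; rewrite sqn_eq0 => /eqP -> i j; rewrite /B /= mxE.
  by move=> H; apply/eqP; rewrite sqn_eq0; apply/eqP/matrixP => i j; rewrite mxE; exact: H.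
rewrite gauss_box => [|i j]; last exact: measurable_set1.
rewrite big_ord_recl big_ord1 [N01r _](_ : _ = 0) ?mul0r//.
rewrite /N01r [normal_prob _ _ _](_ : _ = 0%E)//.
have /null_content_dominatesP := @normal_prob_dominates R 0 1.
by apply; [exact: measurable_set1|exact: lebesgue_measure_set1].
Qed.

Let phi p (x : R) : R := (Num.sqrt (1 + x ^+ 2)) ^+ p.

Let phi_ge0 p x : 0 <= phi p x.
Proof. by rewrite exprn_ge0// sqrtr_ge0. Qed.

Let measurable_phi p : measurable_fun setT (phi p : RR -> RR).
Proof.
apply: measurable_funX; apply: (measurableT_comp measurable_sqrt).
by apply: measurable_funD => //; exact: measurable_funX.
Qed.

Definition gauss_norm s : \bar R := (\int[gauss R s 1]_h (Num.sqrt (sqn h))%:E)%E.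

Let K : R := normal_peak 1.

(** Substitute x = z / |h|, which is legitimate off the null set h = 0, and integrate over h first.
    Rescaling h by [jw x] gives one power of [jw x] per row, the factor |h| gives one more, and the
    p-th power of sqrt(1 + x^2) removes p of them. *)
Lemma kapE0 p s : (p <= s.+1)%N ->
  kap p s.+1 = (K%:E * gauss_norm s.+1 * jw_int R (s.+1 - p))%E.
Proof.
move=> ps.
have msqn := @measurable_sqn R s.+1 1.
have mrho : measurable_fun setT (fun h : 'M[R]_(s.+1, 1) => Num.sqrt (sqn h) : RR).
  exact: (measurableT_comp measurable_sqrt msqn).
have mpdf : measurable_fun setT (@normal_pdf R 0 1 : RR -> RR) by exact: measurable_normal_pdf.
pose f1 (q : 'M[R]_(s.+1, 1) * RR) : \bar R := ((Num.sqrt (1 + q.2 ^+ 2 / sqn q.1)) ^+ p)%:E.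
have mf1 : measurable_fun setT f1.
  apply/measurable_EFinP; apply: measurable_funX; apply: (measurableT_comp measurable_sqrt).
  apply: measurable_funD => //; apply: measurable_funM; first by apply: measurable_funX; exact: measurable_snd.
  apply: (measurableT_comp measurable_invr); exact: (measurableT_comp msqn measurable_fst).
pose f2 (q : 'M[R]_(s.+1, 1) * RR) : \bar R :=
  ((phi p q.2)%:E * (Num.sqrt (sqn q.1) * normal_pdf 0 1 (Num.sqrt (sqn q.1) * q.2))%:E)%E.
have mrho1 : measurable_fun setT (fun q : 'M[R]_(s.+1, 1) * RR => Num.sqrt (sqn q.1) : RR).
  exact: (measurableT_comp mrho measurable_fst).
have mf2 : measurable_fun setT f2.
  apply: emeasurable_funM; apply/measurable_EFinP.
    exact: (measurableT_comp (measurable_phi p) measurable_snd).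
  apply: measurable_funM => //; apply: (measurableT_comp mpdf).
  by apply: measurable_funM => //; exact: measurable_snd.
have f10 q : (0 <= f1 q)%E by rewrite lee_fin exprn_ge0// sqrtr_ge0.
have f20 q : (0 <= f2 q)%E.
  by rewrite mule_ge0// lee_fin ?phi_ge0// mulr_ge0 ?sqrtr_ge0// normal_pdf_ge0.
transitivity (\int[gauss R s.+1 1]_h \int[mu]_x f2 (h, x))%E.
  apply: ge0_ae_eq_integral.
  - by [].
  - exact: (measurable_fun_fubini_tonelli_F f1).
  - exact: (measurable_fun_fubini_tonelli_F f2).
  - by move=> h _; apply: integral_ge0 => z _; exact: (f10 (h, z)).
  - by move=> h _; apply: integral_ge0 => z _; exact: (f20 (h, z)).
  - exists [set h | sqn h = 0]; split.
    + rewrite -[X in measurable X]setTI; exact: (msqn measurableT [set 0] (measurable_set1 0)).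
    + exact: gauss_sqn_eq0.
    + move=> h /= /not_implyP[_]; apply: contra_notP => /eqP h0.
      have r0 : 0 < Num.sqrt (sqn h) by rewrite sqrtr_gt0 lt_def h0 sqn_ge0.
      have mp : measurable_fun setT (fun x : RR => (phi p x)%:E).
        by apply/measurable_EFinP; exact: measurable_phi.
      have p0 x : (0 <= (phi p x)%:E)%E by rewrite lee_fin phi_ge0.
      rewrite /f2 /= -(stdnormal_div r0 mp p0).
      apply: eq_integral => z _; rewrite /phi expr_div_n sqr_sqrtr//.
      exact: sqn_ge0.
rewrite (fubini_tonelli f2 mf2 f20).
transitivity (\int[mu]_x ((K%:E * gauss_norm s.+1) * (jw x ^+ (s.+1 - p).+1)%:E))%E.
  apply: eq_integral => x _.
  transitivity (\int[gauss R s.+1 1]_h ((phi p x * K)%:E *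
     ((Num.sqrt (sqn h))%:E * (expR (- (x ^+ 2 * sqn h) / 2))%:E)))%E.
    apply: eq_integral => h _; rewrite /f2 /= -!EFinM; congr EFin.
    rewrite normal_pdfE ?oner_neq0// /normal_fun subr0 exprMn sqr_sqrtr ?sqn_ge0// expr1n.
    by rewrite [x ^+ 2 * _]mulrC /K; ring.
  have mr2 : measurable_fun setT (fun h : 'M[R]_(s.+1, 1) => (Num.sqrt (sqn h))%:E).
    exact/measurable_EFinP.
  rewrite ge0_integralZl; last 4 first.
  - by [].
  - apply: emeasurable_funM => //; apply/measurable_EFinP.
    apply: (measurableT_comp (@measurable_expR R)).
    apply: measurable_funM => //; apply: measurableT_comp => //.
    exact: measurable_funM.
  - by move=> h _; rewrite mule_ge0// lee_fin ?sqrtr_ge0 ?expR_ge0.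
  - by rewrite lee_fin mulr_ge0// normal_peak_ge0.
  have r20 (h : 'M[R]_(s.+1, 1)) : (0 <= (Num.sqrt (sqn h))%:E)%E by rewrite lee_fin sqrtr_ge0.
  rewrite (gauss_scale (sqr_ge0 x) mr2 r20).
  rewrite -jwE.
  transitivity ((phi p x * K)%:E * ((jw x ^+ s.+1)%:E * ((jw x)%:E * gauss_norm s.+1)))%E.
    congr (_ * (_ * _))%E; rewrite -ge0_integralZl; last 4 first.
    - by [].
    - exact: mr2.
    - by move=> h _; rewrite lee_fin sqrtr_ge0.
    - by rewrite lee_fin ltW// jw_gt0.
    apply: eq_integral => h _; rewrite -EFinM; congr EFin.
    rewrite (_ : sqn (jw x *: h) = jw x ^+ 2 * sqn h); last first.
      rewrite /sqn mulr_sumr; apply: eq_bigr => i _; rewrite mulr_sumr; apply: eq_bigr => j _.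
      by rewrite mxE exprMn.
    by rewrite sqrtrM ?sqr_ge0// sqrtr_sqr gtr0_norm ?jw_gt0.
  rewrite muleCA !muleA -!EFinM [RHS]muleC muleA -EFinM; congr (_%:E * _)%E.
  rewrite /phi -[Num.sqrt (1 + _)]invrK -jwE exprVn.
  have -> : jw x ^+ (s.+1 - p).+1 = (jw x ^+ p)^-1 * jw x ^+ s.+2.
    have := jw_gt0 x => j0; apply: (mulfI (lt0r_neq0 (exprn_gt0 p j0))).
    rewrite mulrA divff ?gt_eqF ?exprn_gt0// mul1r -exprD; congr (_ ^+ _).
    by rewrite addnS subnKC.
  rewrite [jw x ^+ s.+2]exprSr; ring.
rewrite ge0_integralZl; last 4 first.
- by [].
- exact: measurable_jwX.
- by move=> x _; exact: jwX_ge0.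
- apply: mule_ge0; first by rewrite lee_fin normal_peak_ge0.
  by apply: integral_ge0 => h _; rewrite lee_fin sqrtr_ge0.
by [].
Qed.

(** The constant [K * gauss_norm] is never computed: the moment of order 0 is 1, which shows that
    the constant is 1 / J_s and that J_s > 0. *)
Lemma kapE p s : (p < s)%N -> kap p s = (jwr R (s - p) / jwr R s)%:E /\ 0 < jwr R s.
Proof.
case: s => // s ps.
have k0 : (1 = K%:E * gauss_norm s.+1 * jw_int R s.+1)%E.
  rewrite -[X in jw_int _ X]subn0 -kapE0//.
  rewrite /kap (eq_integral (cst 1%E)).
    by rewrite integral_cst// [X in (_ * X)%E](_ : _ = 1%E) ?mule1//; exact: probability_setT.
  move=> h _; under eq_integral do rewrite expr0.
  by rewrite integral_cst// [X in (_ * X)%E](_ : _ = 1%E) ?mule1//; exact: probability_setT.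
have j0 : 0 < jwr R s.+1.
  rewrite lt_def jwr_ge0 andbT; apply/eqP => j0.
  by move: k0; rewrite jw_intE// j0 mule0 => /eqP; rewrite onee_eq0.
split => //.
rewrite kapE0 ?(ltnW ps)// jw_intE ?subn_gt0//.
have -> : (K%:E * gauss_norm s.+1 = (jwr R s.+1)^-1%:E)%E.
  rewrite -[LHS]mule1 (_ : 1%E = (jwr R s.+1)%:E * (jwr R s.+1)^-1%:E)%E; last first.
    by rewrite -EFinM divff// gt_eqF.
  by rewrite muleA -jw_intE// -k0 mul1e.
by rewrite -EFinM mulrC.
Qed.

End kappa.

(** * Stripping columns from a least-squares problem *)

Section least_squares.
Context (R : realType).
Notation RR := (measurableTypeR R).

Lemma measurable_det d (T : measurableType d) n (f : T -> 'M[R]_n) :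
  measurable_fun setT f -> measurable_fun setT (fun t => \det (f t) : RR).
Proof.
move=> mf; apply: measurable_sum => s; apply: measurable_funM => //.
by apply: measurable_prod => i _; exact: (measurableT_comp (measurable_coef _ _) mf).
Qed.

Lemma measurable_adj d (T : measurableType d) n (f : T -> 'M[R]_n) :
  measurable_fun setT f -> measurable_fun setT (fun t => \adj (f t)).
Proof.
move=> mf; apply: measurable_fun_mxP => i j; under eq_fun do rewrite mxE.
apply: measurable_funM => //; apply: measurable_det.
apply: measurable_fun_mxP => k l; under eq_fun do rewrite !mxE.
exact: (measurableT_comp (measurable_coef _ _) mf).
Qed.

Lemma measurable_scale d (T : measurableType d) m n (c : T -> RR) (f : T -> 'M[R]_(m, n)) :
  measurable_fun setT c -> measurable_fun setT f ->
  measurable_fun setT (fun t => c t *: f t).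
Proof.
move=> mc mf; apply: measurable_fun_mxP => i j; under eq_fun do rewrite mxE.
by apply: measurable_funM => //; exact: (measurableT_comp (measurable_coef _ _) mf).
Qed.

Definition gram m n (A : 'M[R]_(m, n)) : 'M[R]_n := A^T *m A.

(* Cramer's rule for the normal equations, junk if [gram A] is singular. *)
Definition lsq m n (A : 'M[R]_(m, n)) : 'M[R]_(n, m) :=
  (\det (gram A))^-1 *: (\adj (gram A) *m A^T).

Lemma lsqK m n (A : 'M[R]_(m, n)) : \det (gram A) != 0 -> lsq A *m A = 1%:M.
Proof.
move=> d0; rewrite /lsq -scalemxAl -mulmxA mul_adj_mx scale_scalar_mx mulVf//.
Qed.

Lemma lsq_unique m n (A : 'M[R]_(m, n)) (g : 'cV[R]_m) (y : 'cV[R]_n) :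
  \det (gram A) != 0 -> gram A *m y = A^T *m g -> lsq A *m g = y.
Proof.
move=> d0 Ay; rewrite /lsq -scalemxAl -mulmxA -Ay mulmxA mul_adj_mx.
by rewrite mul_scalar_mx scalerA mulVf// scale1r.
Qed.

Lemma gram_lsq m n (A : 'M[R]_(m, n)) (g : 'cV[R]_m) :
  \det (gram A) != 0 -> gram A *m (lsq A *m g) = A^T *m g.
Proof.
move=> d0; rewrite /lsq -scalemxAl -[_ *m A^T *m g]mulmxA -scalemxAr.
rewrite [gram A *m (_ *m _)]mulmxA mul_mx_adj.
by rewrite mul_scalar_mx scalerA mulVf// scale1r.
Qed.

Variable p : nat.

(** The value +oo on a singular Gram matrix lets a finite mean imply full column rank almost surely
    ([det_gram_null]). *)
Definition lsq_cost s k (A : 'M[R]_(s, k)) (g : 'cV[R]_s) : \bar R :=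
  if \det (gram A) == 0 then +oo%E
  else ((Num.sqrt (1 + sqn (lsq A *m g))) ^+ p)%:E.

Lemma lsq_cost_ge0 s k (A : 'M[R]_(s, k)) g : (0 <= lsq_cost A g)%E.
Proof.
by rewrite /lsq_cost; case: ifP => // _; rewrite lee_fin exprn_ge0// sqrtr_ge0.
Qed.

Lemma measurable_lsq_cost d (T : measurableType d) s k (A : T -> 'M[R]_(s, k))
  (g : T -> 'M[R]_(s, 1)) : measurable_fun setT A -> measurable_fun setT g ->
  measurable_fun setT (fun t => lsq_cost (A t) (g t)).
Proof.
move=> mA mg.
have mAT : measurable_fun setT (fun t => (A t)^T).
  exact: (measurableT_comp (@measurable_trmx _ _ _) mA).
have mG : measurable_fun setT (fun t => gram (A t)) by exact: measurable_mulmx.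
have md := measurable_det mG.
apply: measurable_fun_ifT => //.
  by apply: (@measurable_fun_eqr _ _ R) => //; exact: measurable_cst.
apply/measurable_EFinP; apply: measurable_funX; apply: (measurableT_comp (@measurable_sqrt R)).
apply: measurable_funD => //; apply: (measurableT_comp (@measurable_sqn _ _ _)).
apply: measurable_mulmx => //; apply: measurable_scale.
  exact: (measurableT_comp (@measurable_invr R) md).
by apply: measurable_mulmx => //; exact: measurable_adj.
Qed.

Lemma lsq_cost_orth s k (U : 'M[R]_s) (A : 'M[R]_(s, k)) g :
  U *m U^T = 1%:M -> lsq_cost (U^T *m A) (U^T *m g) = lsq_cost A g.
Proof.
move=> UU; rewrite /lsq_cost.
have gE : gram (U^T *m A) = gram A.
  by rewrite /gram trmx_mul trmxK mulmxA -[_ *m U *m _]mulmxA UU mulmx1.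
rewrite gE; suff -> : lsq (U^T *m A) *m (U^T *m g) = lsq A *m g by [].
rewrite /lsq gE trmx_mul trmxK -!scalemxAl -!mulmxA.
by rewrite [U *m (U^T *m _)]mulmxA UU mul1mx.
Qed.

(** Back substitution: the lower block is solved by y = [lsq A *m g], and the first equation is then
    met exactly by the first unknown (al - a y) / r. The Gram matrix factors as T^T diag(1, gram A)
    T. *)
Lemma lsq_cost_block s k (r : R) (a : 'rV[R]_k) (al : 'M[R]_1) (A : 'M[R]_(s, k)) (g : 'cV[R]_s) :
  r != 0 ->
  lsq_cost (block_mx r%:M a 0 A : 'M[R]_(1 + s, 1 + k)) (col_mx al g) =
  if \det (gram A) == 0 then +oo%E else
  ((Num.sqrt (1 + sqn (lsq A *m g) +
     ((row_mx al a *m col_mx 1%:M (- (lsq A *m g))) ord0 ord0 / r) ^+ 2)) ^+ p)%:E.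
Proof.
move=> r0; set A1 := block_mx _ _ _ _; set g1 := col_mx _ _.
pose T : 'M[R]_(1 + k) := block_mx r%:M a 0 1%:M.
have gE : gram A1 = T^T *m block_mx 1%:M 0 0 (gram A) *m T.
  rewrite /gram /A1 /T !tr_block_mx !mulmx_block !tr_scalar_mx !trmx0.
  by rewrite !mulmx0 !mul0mx !mulmx1 !mul1mx !addr0 !add0r.
have dT : \det T = r by rewrite det_ublock det1 mulr1 det_scalar expr1.
have dE : \det (gram A1) = r ^+ 2 * \det (gram A).
  by rewrite gE !det_mulmx det_tr dT det_ublock det1 mul1r mulrAC expr2.
rewrite /lsq_cost dE mulf_eq0 expf_eq0/= (negbTE r0) /=.
case: ifPn => // d0.
set y := lsq A *m g.
set w := (row_mx al a *m _) ord0 ord0.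
have wE : al - a *m y = w%:M.
  rewrite [LHS]mx11_scalar; congr _%:M.
  by rewrite /w mul_row_col mulmx1 mulmxN.
have -> : lsq A1 *m g1 = col_mx (w / r)%:M y.
  apply: lsq_unique; first by rewrite dE mulf_neq0// expf_neq0.
  rewrite gE -!mulmxA /T mul_block_col mul0mx mul1mx add0r -scalar_mxM.
  rewrite mulrC divfK// -wE subrK mul_block_col !mul0mx !mul1mx addr0 add0r.
  by rewrite gram_lsq// /A1 /g1 !tr_block_mx !mul_block_col !trmx0 ?tr_scalar_mx !mul0mx !addr0 mul1mx.
by rewrite (@sqn_col R 1 k 1) sqn_scalar [_ + sqn y]addrC addrA.
Qed.


Lemma measurable_submx d (T : measurableType d) m n1 n2 (f : T -> 'M[R]_(m, n1 + n2)) :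
  measurable_fun setT f ->
  measurable_fun setT (fun t => lsubmx (f t)) /\ measurable_fun setT (fun t => rsubmx (f t)).
Proof.
move=> mf; split; apply: measurable_fun_mxP => i j; under eq_fun do rewrite mxE;
exact: (measurableT_comp (measurable_coef _ _) mf).
Qed.

Lemma integral_cst_gauss m n (c : \bar R) : (\int[gauss R m n]_x c = c)%E.
Proof.
rewrite -/(\int[gauss R m n]_x cst c x)%E integral_cst//.
by rewrite [X in (_ * X)%E](_ : _ = 1%E) ?mule1//; exact: probability_setT.
Qed.

Local Open Scope ereal_scope.

(** This is c_k for s rows. The vector g is the first column, matching the order of the orthonormal
    family (w, U) in [step_mean]. *)
Definition lsq_mean s k : \bar R :=
  \int[gauss R s (1 + k)]_B lsq_cost (rsubmx B) (lsubmx B).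

Let colfac (c : R) : \bar R := \int[stdnormal R]_z ((Num.sqrt (1 + z ^+ 2 / c)) ^+ p)%:E.

(** Strict, because in the singular case this factor multiplies +oo. *)
Let colfac_gt0 c : (0 <= c)%R -> 0 < colfac c.
Proof.
move=> c0; apply: (@lt_le_trans _ _ 1) => //.
have <- : \int[stdnormal R]_z 1 = 1.
  rewrite -/(\int[stdnormal R]_x cst 1 x) integral_cst//.
  by rewrite [X in (_ * X)%E](_ : _ = 1%E) ?mule1//; exact: probability_setT.
apply: ge0_le_integral => //.
- apply/measurable_EFinP; apply: measurable_funX; apply: (measurableT_comp (@measurable_sqrt R)).
  by apply: measurable_funD => //; apply: measurable_funM => //; exact: measurable_funX.
- move=> z _; rewrite lee_fin exprn_ege1// -[leLHS]sqrtr1 ler_wsqrtr// lerDl.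
  by rewrite divr_ge0// sqr_ge0.
Qed.

(** Rotating h onto the first axis produces the shape of [lsq_cost_block]. The first row is
    independent of the others, so al - a y is Gaussian of variance 1 + |y|^2, and 1 + |y|^2 + (1 +
    |y|^2) z^2 / r^2 splits into the cost of the smaller problem and the factor of h. *)
Let lsq_col s k (h : 'cV[R]_(1 + s)) : sqn h != 0%R ->
  \int[gauss R (1 + s) (1 + k)]_B
     lsq_cost (row_mx h (rsubmx B)) (lsubmx B) =
  lsq_mean s k * colfac (sqn h).
Proof.
move=> h0.
have [U [r [invU UU Uh r0]]] := align h.
have hr := align_sqn UU Uh.
have rn0 : r != 0%R by apply: contra_neq h0 => r00; rewrite hr r00 expr0n.
pose h1 : 'cV[R]_(1 + s) := col_mx r%:M 0%R.
have mcost (h' : 'cV[R]_(1 + s)) : measurable_fun setT (fun B : 'M[R]_(1 + s, 1 + k) =>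
    lsq_cost (row_mx h' (rsubmx B)) (lsubmx B)).
  have [ml mr] := @measurable_submx _ _ (1 + s) 1 k _ (@measurable_id _ 'M[R]_(1 + s, 1 + k) setT).
  apply: measurable_lsq_cost; last exact: ml.
  have mh : measurable_fun setT (fun _ : 'M[R]_(1 + s, 1 + k) => h') by exact: measurable_cst.
  exact: (measurable_row_mx mh mr).
transitivity (\int[gauss R (1 + s) (1 + k)]_B
    lsq_cost (row_mx h1 (rsubmx B)) (lsubmx B)).
  rewrite -[RHS](gauss_left invU (mcost h1)); last by move=> B; exact: lsq_cost_ge0.
  apply: eq_integral => B _; rewrite -(lsq_cost_orth _ _ UU) mul_mx_row Uh.
  by rewrite -mulmx_lsub -mulmx_rsub.
rewrite gauss_col_mx; last 2 first.
- exact: mcost.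
- by move=> B; exact: lsq_cost_ge0.
rewrite (fubini_tonelli (fun q : 'M[R]_(1, 1 + k) * 'M[R]_(s, 1 + k) =>
   lsq_cost (row_mx h1 (rsubmx (col_mx q.1 q.2))) (lsubmx (col_mx q.1 q.2)))); last 2 first.
- exact: (measurable_comp_col (mcost h1)).
- by move=> q; exact: lsq_cost_ge0.
rewrite muleC -ge0_integralZl; last 4 first.
- by [].
- have [ml mr] := @measurable_submx _ _ s 1 k _ (@measurable_id _ 'M[R]_(s, 1 + k) setT).
  by apply: measurable_lsq_cost; [exact: mr|exact: ml].
- by move=> B _; exact: lsq_cost_ge0.
- by apply/ltW/colfac_gt0; exact: sqn_ge0.
apply: eq_integral => B _ /=.
set A := rsubmx B; set g := lsubmx B.
transitivity (\int[gauss R 1 (1 + k)]_b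
   (if \det (gram A) == 0%R then +oo%E else
   ((Num.sqrt (1 + sqn (lsq A *m g) +
     ((b *m col_mx 1%:M (- (lsq A *m g))) ord0 ord0 / r) ^+ 2)) ^+ p)%:E)).
  apply: eq_integral => b _.
  have -> : row_mx h1 (rsubmx (col_mx b B)) = block_mx r%:M%R (rsubmx b) 0%R A.
    rewrite /h1 block_mxEh; congr row_mx.
    apply/matrixP => i j; rewrite !mxE; case: fintype.splitP => i' _; by rewrite !mxE.
  have -> : lsubmx (col_mx b B) = col_mx (lsubmx b) g.
    apply/matrixP => i j; rewrite !mxE; case: fintype.splitP => i' _; by rewrite !mxE.
  by rewrite lsq_cost_block// hsubmxK.
rewrite /lsq_cost.
case: ifPn => [_|d0].
  by rewrite integral_cst_gauss gt0_muley// colfac_gt0// sqn_ge0.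
set y := lsq A *m g.
pose v : 'cV[R]_(1 + k) := col_mx 1%:M (- y)%R.
have sv : sqn v = (1 + sqn y)%R.
  rewrite /v (@sqn_col R 1 k 1) sqn_scalar expr1n; congr (_ + _)%R.
  by rewrite /sqn; apply: eq_bigr => i _; apply: eq_bigr => j _; rewrite mxE sqrrN.
have sy0 : (0 <= 1 + sqn y)%R by rewrite addr_ge0// sqn_ge0.
have mF : measurable_fun setT (fun z : RR =>
    (Num.sqrt (1 + sqn y + (z / r) ^+ 2) ^+ p)%:E)%R.
  apply/measurable_EFinP; apply: measurable_funX; apply: (measurableT_comp (@measurable_sqrt R)).
  by apply: measurable_funD => //; apply: measurable_funX; exact: measurable_funM.
have F0 (z : RR) : 0 <= (Num.sqrt (1 + sqn y + (z / r) ^+ 2) ^+ p)%:E.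
  by rewrite lee_fin exprn_ge0// sqrtr_ge0.
rewrite [LHS](gauss_lin v mF F0) sv muleC.
rewrite -ge0_integralZl; last 4 first.
- by [].
- apply/measurable_EFinP; apply: measurable_funX; apply: (measurableT_comp (@measurable_sqrt R)).
  by apply: measurable_funD => //; apply: measurable_funM => //; exact: measurable_funX.
- by move=> z _; rewrite lee_fin exprn_ge0// sqrtr_ge0.
- by rewrite lee_fin exprn_ge0// sqrtr_ge0.
apply: eq_integral => z _; rewrite -EFinM -exprMn -sqrtrM//; congr (Num.sqrt _ ^+ p)%:E.
by rewrite !exprMn sqr_sqrtr// exprVn hr; ring.
Qed.

Lemma lsq_meanS s k : (p <= s.+1)%N ->
  lsq_mean (1 + s) (1 + k) = lsq_mean s k * kap R p s.+1.
Proof.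
move=> ps.
have mrow : measurable_fun setT (fun q : 'M[R]_(1 + s, 1) * 'M[R]_(1 + s, 1) * 'M[R]_(1 + s, k) =>
    lsq_cost (row_mx q.1.2 q.2) q.1.1).
  apply: measurable_lsq_cost.
    apply: measurable_row_mx; last exact: measurable_snd.
    exact: (measurableT_comp measurable_snd measurable_fst).
  exact: (measurableT_comp measurable_fst measurable_fst).
have mfull n : measurable_fun setT (fun B : 'M[R]_(1 + s, 1 + n) => lsq_cost (rsubmx B) (lsubmx B)).
  have [ml mr] := @measurable_submx _ _ (1 + s) 1 n _ (@measurable_id _ 'M[R]_(1 + s, 1 + n) setT).
  by apply: measurable_lsq_cost; [exact: mr|exact: ml].
have mcol : measurable_fun setT (fun q : 'M[R]_(1 + s, 1) * 'M[R]_(1 + s, 1 + k) =>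
    lsq_cost (row_mx q.1 (rsubmx q.2)) (lsubmx q.2)).
  have [ml mr] := @measurable_submx _ _ (1 + s) 1 k _
    (@measurable_snd _ _ 'M[R]_(1 + s, 1) 'M[R]_(1 + s, 1 + k)).
  apply: measurable_lsq_cost; last exact: ml.
  exact: (measurable_row_mx measurable_fst mr).
rewrite /lsq_mean gauss_row_mx; last 2 first.
- exact: mfull.
- by move=> B; exact: lsq_cost_ge0.
transitivity (\int[gauss R (1 + s) 1]_g \int[gauss R (1 + s) 1]_h \int[gauss R (1 + s) k]_A
   lsq_cost (row_mx h A) g).
  apply: eq_integral => g _.
  under eq_integral do rewrite row_mxKl row_mxKr.
  rewrite (@gauss_row_mx _ (1 + s) 1 k); [by []| |by move=> A; exact: lsq_cost_ge0].
  by apply: measurable_lsq_cost; [exact: measurable_id|exact: measurable_cst].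
rewrite (fubini_tonelli (fun q => \int[gauss R (1 + s) k]_A lsq_cost (row_mx q.2 A) q.1)); last 2 first.
- by apply: (measurable_fun_fubini_tonelli_F _ mrow) => q; exact: lsq_cost_ge0.
- by move=> q; apply: integral_ge0 => A _; exact: lsq_cost_ge0.
rewrite /= muleC /kap -ge0_integralZr; last 4 first.
- by [].
- apply: (measurable_fun_fubini_tonelli_F (fun q : 'M[R]_(s.+1, 1) * RR =>
    ((Num.sqrt (1 + q.2 ^+ 2 / sqn q.1)) ^+ p)%:E)).
    apply/measurable_EFinP; apply: measurable_funX; apply: (measurableT_comp (@measurable_sqrt R)).
    apply: measurable_funD => //; apply: measurable_funM; first by apply: measurable_funX; exact: measurable_snd.
    apply: (measurableT_comp (@measurable_invr R)).
    exact: (measurableT_comp (@measurable_sqn R _ _) measurable_fst).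
  by move=> q; rewrite lee_fin exprn_ge0// sqrtr_ge0.
- by move=> h _; apply: integral_ge0 => z _; rewrite lee_fin exprn_ge0// sqrtr_ge0.
- by apply: integral_ge0 => B _; exact: lsq_cost_ge0.
transitivity (\int[gauss R (1 + s) 1]_h \int[gauss R (1 + s) (1 + k)]_B
     lsq_cost (row_mx h (rsubmx B)) (lsubmx B)).
  apply: eq_integral => h _; rewrite gauss_row_mx; last 2 first.
  - exact: (measurable_fun_pair2 h mcol).
  - by move=> B; exact: lsq_cost_ge0.
  by apply: eq_integral => g _; apply: eq_integral => A _; rewrite row_mxKl row_mxKr.
apply: ge0_ae_eq_integral.
- by [].
- apply: (measurable_fun_fubini_tonelli_F _ mcol) => q; exact: lsq_cost_ge0.
- apply: emeasurable_funM => //.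
  apply: (measurable_fun_fubini_tonelli_F (fun q : 'M[R]_(s.+1, 1) * RR =>
    ((Num.sqrt (1 + q.2 ^+ 2 / sqn q.1)) ^+ p)%:E)).
    apply/measurable_EFinP; apply: measurable_funX; apply: (measurableT_comp (@measurable_sqrt R)).
    apply: measurable_funD => //; apply: measurable_funM; first by apply: measurable_funX; exact: measurable_snd.
    apply: (measurableT_comp (@measurable_invr R)).
    exact: (measurableT_comp (@measurable_sqn R _ _) measurable_fst).
  by move=> q; rewrite lee_fin exprn_ge0// sqrtr_ge0.
- by move=> h _; apply: integral_ge0 => B _; exact: lsq_cost_ge0.
- move=> h _; apply: mule_ge0; last by apply: integral_ge0 => B _; exact: lsq_cost_ge0.
  by apply: integral_ge0 => z _; rewrite lee_fin exprn_ge0// sqrtr_ge0.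
- exists [set h | sqn h = 0%R]; split.
  + rewrite -[X in measurable X]setTI.
    exact: (@measurable_sqn R s.+1 1 measurableT [set 0%R] (measurable_set1 0%R)).
  + exact: gauss_sqn_eq0.
  + move=> h /= /not_implyP[_]; apply: contra_notP => /eqP h0.
    by rewrite lsq_col// muleC.
Qed.

Lemma lsq_mean0 s : lsq_mean s 0 = 1.
Proof.
rewrite /lsq_mean -[RHS](integral_cst_gauss s (1 + 0)).
apply: eq_integral => B _; rewrite /lsq_cost det_mx00 oner_eq0.
rewrite (_ : sqn _ = 0%R); last by rewrite /sqn big_ord0.
by rewrite addr0 sqrtr1 expr1n.
Qed.

Lemma lsq_meanE q k : (p <= q)%N ->
  lsq_mean (q + k) k = (\prod_(i < k) (jwr R (q + i.+1 - p) / jwr R (q + i.+1)))%:E.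
Proof.
move=> pq; elim: k => [|k IH]; first by rewrite addn0 lsq_mean0 big_ord0.
rewrite addnS -[(q + k).+1]/(1 + (q + k))%N lsq_meanS; last by rewrite (leq_trans pq)// leqW// leq_addr.
rewrite IH big_ord_recr /= EFinM; congr (_ * _).
have [] := @kapE R p (q + k).+1; first by rewrite ltnS (leq_trans pq)// leq_addr.
by rewrite addnS.
Qed.

End least_squares.

(** * Numerical estimates *)

Section jwr_ratio.
Context (R : realType).
Hypothesis jwr_gt0 : forall m, (0 < m)%N -> 0 < jwr R m.
Local Notation J := (jwr R).

(** An invariant of the recursion; with monotonicity it gives the size of J_m without the Gamma
    function. *)
Let JJ m : (0 < m)%N -> m%:R * (J m * J m.+1) = J 1 * J 2.
Proof.
elim: m => // -[|m] IH _; first by rewrite mul1r.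
by rewrite [J m.+2 * _]mulrC mulrA jwr_rec// -mulrA IH.
Qed.

(** Use J_(i+1)^2 <= J_i J_(i+1) in the numerator and J_(r+i+1)^2 >= J_(r+i+1) J_(r+i+2) in the
    denominator; [JJ] evaluates both products. *)
Let sqr_ratio_le i r : (0 < i)%N ->
  (J i.+1 / J (r + i.+1)) ^+ 2 <= (r + i.+1)%:R / i%:R.
Proof.
move=> i0; have r0 : (0 < r + i.+1)%N by rewrite addnS.
rewrite expr_div_n ler_pdivrMr ?exprn_gt0 ?jwr_gt0//.
apply: (@le_trans _ _ (J i * J i.+1)).
  by rewrite expr2 ler_wpM2r ?jwr_ge0// jwr_le.
have -> : J i * J i.+1 = (J 1 * J 2) / i%:R.
  by rewrite -(JJ i0) mulrAC divff ?mul1r// pnatr_eq0 -lt0n.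
rewrite [leRHS]mulrAC ler_wpM2r ?invr_ge0// -(JJ r0) ler_wpM2l// expr2 ler_wpM2l ?jwr_ge0//.
exact: jwr_le.
Qed.

(** Replaces the comparison with J_0 for the ratio that starts at J_1; it is the origin of the
    factor 2 in [jwr_prod_sqr_le]. *)
Let J1_le : J 1 <= 2 * J 2.
Proof. by have := @jwr_rec R 1 isT; have := @jwr_le R 2 isT; lra. Qed.

Let sqr_ratio1_le r : (J 1 / J (r + 1)) ^+ 2 <= 2 * (r + 1)%:R.
Proof.
have r0 : (0 < r + 1)%N by rewrite addn1.
rewrite expr_div_n ler_pdivrMr ?exprn_gt0 ?jwr_gt0//.
apply: (@le_trans _ _ (2 * (J 1 * J 2))).
  by rewrite expr2 mulrCA ler_wpM2l ?jwr_ge0.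
rewrite -(JJ r0) -mulrA ler_wpM2l// ler_wpM2l ?ler0n// expr2 ler_wpM2l ?jwr_ge0//.
exact: jwr_le.
Qed.

(** The ratio bounds multiply to 2 (r+1) ... (r+p) / (p-1)!. *)
Lemma jwr_prod_sqr_le r p : (0 < p)%N ->
  (\prod_(i < p) (J i.+1 / J (r + i.+1))) ^+ 2 <= 2 * p%:R * 'C(r + p, p)%:R.
Proof.
case: p => // p _; elim: p => [|p IH].
  by rewrite big_ord1 bin1 mulr1 sqr_ratio1_le.
rewrite big_ord_recr exprMn.
apply: (@le_trans _ _ (2 * p.+1%:R * 'C(r + p.+1, p.+1)%:R * ((r + p.+2)%:R / p.+1%:R))).
  by apply: ler_pM => //; rewrite ?exprn_even_ge0//; exact: sqr_ratio_le.
rewrite le_eqVlt; apply/orP; left; apply/eqP.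
have := mul_bin_diag (r + p.+2) p.+1; rewrite [(r + p.+2).-1](_ : _ = (r + p.+1)%N); last by rewrite addnS.
move=> /(congr1 (fun n : nat => n%:R : R)); rewrite !natrM => E.
have p0 : p.+1%:R != 0 :> R by rewrite pnatr_eq0.
rewrite -[2 * p.+2%:R * _]mulrA -E.
by field.
Qed.

(** Both sides are the product of the first r and the first p values of J over the product of the
    first r + p. The moment comes with r factors, while the estimate above handles p. *)
Lemma jwr_prod_sym r p :
  \prod_(i < r) (J i.+1 / J (p + i.+1)) = \prod_(i < p) (J i.+1 / J (r + i.+1)).
Proof.
have cat a b : \prod_(i < a + b) J i.+1 = \prod_(i < a) J i.+1 * \prod_(i < b) J (a + i.+1).
  rewrite -!(big_mkord xpredT (fun i => J i.+1)) -(big_mkord xpredT (fun i => J (a + i.+1))).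
  rewrite (@big_cat_nat _ _ _ a 0 (a + b))//= ?leq_addr//; congr (_ * _).
  rewrite -{1}[a]add0n big_addn addnC addnK; apply: eq_bigr => i _.
  by rewrite addnC addnS.
have gt0 a b : 0 < \prod_(i < b) J (a + i.+1).
  by apply: prodr_gt0 => i _; apply: jwr_gt0; rewrite addnS.
rewrite !prodf_div; apply/eqP; rewrite eqr_div; last 2 first.
- by rewrite gt_eqF.
- by rewrite gt_eqF.
apply/eqP; transitivity (\prod_(i < r + p) J i.+1); first exact: (esym (cat r p)).
by rewrite addnC; exact: (cat p r).
Qed.

Lemma jwr_ratio_ge1 i p : 1 <= J i.+1 / J (p + i.+1).
Proof.
rewrite ler_pdivlMr ?mul1r ?jwr_gt0 ?addnS//.
elim: p => // p IH; apply: le_trans IH; rewrite addSn.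
by apply: jwr_le.
Qed.

(** Every ratio is at least 1, so a competitor of rank k < r only drops factors. *)
Lemma jwr_prod_mono p k r : (k <= r)%N ->
  \prod_(i < k) (J (r - k + i.+1) / J (p + (r - k + i.+1))) <=
  \prod_(i < r) (J i.+1 / J (p + i.+1)).
Proof.
move=> kr; set f := fun i => J i.+1 / J (p + i.+1).
have f0 i : 0 <= f i by apply: le_trans (jwr_ratio_ge1 i p).
rewrite -(big_mkord xpredT f) (@big_cat_nat _ _ _ (r - k) 0 r)//= ?leq_subr//.
rewrite -[leLHS]mul1r ler_pM//.
- by apply: prodr_ge0 => i _; rewrite addnS; exact: f0.
- elim: (r - k)%N => [|m IH]; first by rewrite big_geq.
  by rewrite big_nat_recr//= -[leLHS]mulr1 ler_pM// jwr_ratio_ge1.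
- have -> : \prod_(r - k <= i < r) f i = \prod_(0 + (r - k) <= i < r) f i by rewrite add0n.
  rewrite big_addn subKn// big_mkord le_eqVlt; apply/orP; left.
  by apply/eqP; apply: eq_bigr => i _; rewrite /f [(i + _)%N]addnC addnS.
Qed.

End jwr_ratio.

(** * Elementary bounds on the exponential *)

Section tail_numeric.
Context (R : realType).
Implicit Types x y : R.

Lemma expR1_ge : 5 / 2 <= expR 1 :> R.
Proof.
have e8 : 9 / 8 <= expR (8^-1) :> R by have := expR_ge1Dx (8^-1 : R); lra.
have -> : expR 1 = expR (8^-1) ^+ 8 :> R by rewrite -expRM_natl; congr expR; field.
apply: (@le_trans _ _ ((9 / 8) ^+ 8)); last by apply: lerXn2r; rewrite ?nnegrE ?expR_ge0//; lra.
lra.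
Qed.

(** 36 / 13 is 3 divided by 13 / 12, the margin needed in [tail_large]. The 32nd power is reached by
    repeated squaring, rounded up to a small fraction each time. *)
Lemma expR1_le : expR 1 <= 36 / 13 :> R.
Proof.
have e32 : expR (32^-1) <= 32 / 31 :> R.
  have := expR_ge1Dx (- 32^-1 : R); rewrite expRN => H.
  have e0 := expR_gt0 (32^-1 : R).
  have H2 : 31 / 32 * expR (32^-1) <= 1 :> R.
    by rewrite -ler_pdivlMr// div1r; lra.
  lra.
have -> : expR 1 = expR (32^-1) ^+ 32 :> R by rewrite -expRM_natl; congr expR; field.
apply: (@le_trans _ _ ((32 / 31) ^+ 32)); first by apply: lerXn2r; rewrite ?nnegrE ?expR_ge0//; lra.
have sq (a b : R) n : 0 <= a -> a ^+ n <= b -> a ^+ (n * 2) <= b ^+ 2.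
  by move=> a0 ab; rewrite exprM lerXn2r ?nnegrE ?exprn_ge0//; exact: le_trans (exprn_ge0 n a0) ab.
have a0 : (0 : R) <= 32 / 31 by lra.
have {a0} s1 : (32 / 31) ^+ 2 <= 65 / 61 :> R by lra.
have a0 : (0 : R) <= 32 / 31 by lra.
have s2 : (32 / 31) ^+ 4 <= 67 / 59 :> R by apply: le_trans (sq _ _ 2%N a0 s1) _; lra.
have s3 : (32 / 31) ^+ 8 <= 89 / 69 :> R by apply: le_trans (sq _ _ 4%N a0 s2) _; lra.
have s4 : (32 / 31) ^+ 16 <= 203 / 122 :> R by apply: le_trans (sq _ _ 8%N a0 s3) _; lra.
by apply: le_trans (sq _ _ 16%N a0 s4) _; lra.
Qed.

(** Bound exp y below by (1 + y / 8)^8, keep the cubic part b of the fourth power and square it. The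
    surplus over 1 + y^2 is governed by 1 - 9 y / 16 + 7 y^2 / 64, whose minimum, at y = 18 / 7, is
    positive. *)
Lemma expR_ge1Dsqr y : 0 <= y -> 1 + y ^+ 2 <= expR y.
Proof.
move=> y0; pose a := 1 + y / 8.
have a1 : 0 <= a by rewrite /a; lra.
have ea : a <= expR (y / 8) by exact: expR_ge1Dx.
have -> : expR y = expR (y / 8) ^+ 8 by rewrite -expRM_natl; congr expR; field.
apply: (@le_trans _ _ (a ^+ 8)); last by apply: lerXn2r; rewrite ?nnegrE ?expR_ge0.
have y2 : 0 <= y ^+ 2 by exact: sqr_ge0.
have y3 : 0 <= y ^+ 3 by exact: exprn_ge0.
have y4 : 0 <= y ^+ 4 by exact: exprn_ge0.
pose b := 1 + y / 2 + 3 / 32 * y ^+ 2 + y ^+ 3 / 128.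
have b0 : 0 <= b by rewrite /b; lra.
have ab : b <= a ^+ 4.
  have -> : a ^+ 4 = b + y ^+ 4 / 4096 by rewrite /a /b; field.
  by lra.
have -> : a ^+ 8 = (a ^+ 4) ^+ 2 by rewrite -exprM.
apply: (@le_trans _ _ (b ^+ 2)); last by apply: lerXn2r; rewrite ?nnegrE// exprn_ge0.
have y5 : 0 <= y ^+ 5 by exact: exprn_ge0.
have y6 : 0 <= y ^+ 6 by exact: exprn_ge0.
have -> : b ^+ 2 = 1 + y + 7 / 16 * y ^+ 2 + 7 / 64 * y ^+ 3 +
   (9 / 1024 + 1 / 128) * y ^+ 4 + 3 / 2048 * y ^+ 5 + y ^+ 6 / 16384.
  by rewrite /b; field.
have q0 : 0 <= y - 9 / 16 * y ^+ 2 + 7 / 64 * y ^+ 3.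
  have -> : y - 9 / 16 * y ^+ 2 + 7 / 64 * y ^+ 3 = y * (1 - 9 / 16 * y + 7 / 64 * y ^+ 2) by ring.
  by rewrite mulr_ge0//; have := sqr_ge0 (y - 18 / 7); rewrite sqrrB; lra.
by lra.
Qed.

Lemma expR_ge_fact n : n%:R ^+ n / n`!%:R <= expR n%:R :> R.
Proof.
case: n => [|n]; first by rewrite expr0 fact0 divr1 expR0.
by apply: le_trans (expR_ge1Dxn n (ler0n R n.+1)); rewrite lerDr.
Qed.

End tail_numeric.

(** * From the moment to the failure probability *)

Section tail_bound.
Context (R : realType).
Implicit Types (x y c t u C : R) (r p : nat).

Lemma le_of_sqr x y : 0 <= y -> x ^+ 2 <= y ^+ 2 -> x <= y :> R.
Proof.
move=> y0; have [//|yx] := leP x y.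
by rewrite leNgt => /negP[]; rewrite ltrXn2r ?nnegrE ?(le_trans y0 (ltW yx))//; exact/andP.
Qed.

(** The binomial is at most (r + p)^p / p!, and p! >= (p / e)^p. *)
Lemma binR_le r p : (0 < p)%N ->
  'C(r + p, p)%:R <= (expR 1 * (r + p)%:R / p%:R) ^+ p :> R.
Proof.
move=> p0; have p0' : 0 < p%:R :> R by rewrite ltr0n.
have f0 : 0 < p`!%:R :> R by rewrite ltr0n fact_gt0.
have H : ('C(r + p, p) * p`! <= (r + p) ^ p)%N.
  rewrite bin_ffact; elim: p {p0 p0' f0} (r + p)%N => [//|p IH] m.
  case: m => [|m]; first by rewrite ffact0n.
  rewrite ffactSS expnS leq_mul2l/=; apply: leq_trans (IH m) _.
  by case: p {IH} => // p; rewrite leq_exp2r.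
have {}H : 'C(r + p, p)%:R * p`!%:R <= (r + p)%:R ^+ p :> R.
  by rewrite -natrM -natrX ler_nat.
have e := expR_ge_fact R p.
rewrite -ler_pdivlMr// in H; apply: le_trans H _.
have -> : (r + p)%:R ^+ p / p`!%:R = (p%:R ^+ p / p`!%:R) * ((r + p)%:R / p%:R) ^+ p :> R.
  rewrite expr_div_n; field.
  by rewrite expf_neq0 gt_eqF.
rewrite -[X in _ <= X ^+ _]mulrA [X in _ <= X]exprMn ler_wpM2r ?exprn_ge0 ?divr_ge0//.
by rewrite -expRM_natl mulr1.
Qed.

(** Mixing c^2 >= 4 and c^2 >= 12 r / p with weights 3/4 and 1/4 gives c^2 >= 3 (r + p) / p. As 3 =
    (13/12)(36/13) and e <= 36/13, a factor (13/12)^p remains to absorb 2 p: by Bernoulli 25 (1 + p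
    / 12) >= 2 p, and 25 is the square of the constant 5. *)
Lemma tail_large r p c C : (0 < p)%N -> 2 <= c -> 12 * r%:R / p%:R <= c ^+ 2 ->
  0 <= C -> C ^+ 2 <= 2 * p%:R * 'C(r + p, p)%:R -> C <= 5 * c ^+ p.
Proof.
move=> p0 c2 kc C0 CC; have p0' : 0 < p%:R :> R by rewrite ltr0n.
have c0 : 0 <= c by lra.
apply: le_of_sqr; first by rewrite mulr_ge0 ?exprn_ge0.
apply: le_trans CC _; rewrite exprMn -exprM mulnC exprM.
have [e1 e2] := (expR_gt0 (1 : R), expR1_le R).
set k := (r + p)%:R / p%:R : R.
have kE : k = r%:R / p%:R + 1 by rewrite /k natrD mulrDl divff ?gt_eqF.
have k0 : 0 <= k by rewrite divr_ge0.
have c3 : 3 * k <= c ^+ 2.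
  rewrite kE; have : 2 ^+ 2 <= c ^+ 2 by rewrite lerXn2r ?nnegrE//; lra.
  by move: kc; rewrite -mulrA; lra.
apply: (@le_trans _ _ (5 ^+ 2 * (3 * k) ^+ p)); last first.
  by rewrite ler_wpM2l// lerXn2r ?nnegrE ?sqr_ge0// mulr_ge0//; lra.
apply: (@le_trans _ _ (2 * p%:R * (36 / 13 * k) ^+ p)).
  rewrite ler_wpM2l ?mulr_ge0//; apply: le_trans (binR_le r p0) _.
  rewrite -mulrA lerXn2r ?nnegrE ?mulr_ge0 ?(ltW e1)//.
  by rewrite ler_wpM2r.
have -> : 3 * k = (1 + 12^-1) * (36 / 13 * k) by field.
set v := 36 / 13 * k; have v0 : 0 <= v by rewrite mulr_ge0.
rewrite [X in _ <= _ * X]exprMn [leRHS]mulrA ler_wpM2r ?exprn_ge0//.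
have bern m : 1 + m%:R / 12 <= (1 + 12^-1) ^+ m :> R.
  elim: m => [|m IH]; first by rewrite expr0 mul0r addr0.
  rewrite exprS -natr1; have : 0 <= m%:R :> R by []; nra.
have := bern p; lra.
Qed.

(** Chord of the exponential on [0, 1], whose slope e - 1 is at most 2. *)
Lemma expR_half_le c : 0 <= c -> c <= 2 -> expR (c / 2) <= 1 + c.
Proof.
move=> c0 c2.
have h0 : 0 <= c / 2 by lra.
have h1 : c / 2 <= 1 by lra.
have := @convex_expR R (Itv01 h0 h1) 1 0; rewrite !convRE/= mulr1 mulr0 addr0 expR0 mulr1.
by rewrite /unstable.onem; have := expR1_le R; nra.
Qed.

(** After squaring, the goal is 2 P binom <= 4 exp(- u^2) (1 + c)^(2p), with P = p and Q = r. Since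
    (1 + c)^(2p) >= exp(c P), there is a budget of c P in the exponent. It is spent in the shares
    2/5 on u^2, 1/6 on Q, 13/45 on Q y and 1/7 on the factor 2 P, whose sum is just below 1. Here
    y^2 = P / Q and binom <= (e (1 + y^2))^r <= exp(Q + Q y). *)
Lemma tail_small r p c u C : (0 < r)%N -> (4 <= p)%N -> 1 <= u -> c <= 2 -> 0 <= C ->
  Num.sqrt (12 * r%:R / p%:R) + u * (expR 1 * Num.sqrt (r + p)%:R / p.+1%:R) = c ->
  C ^+ 2 <= 2 * p%:R * 'C(r + p, p)%:R ->
  C <= 2 * expR (- u ^+ 2 / 2) * (1 + c) ^+ p.
Proof.
move=> r0 p4 u1 c2 C0; set a := Num.sqrt (12 * _ / _).
set b := u * _ => cE CC.
set P : R := p%:R; set Q : R := r%:R.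
have P4 : 4 <= P by rewrite /P (ler_nat R 4 p).
have Q1 : 1 <= Q by rewrite /Q (ler_nat R 1 r).
have a0 : 0 <= a by exact: sqrtr_ge0.
have aa : P * a ^+ 2 = 12 * Q.
  by rewrite sqr_sqrtr ?divr_ge0 ?mulr_ge0 ?ler0n// mulrC divfK// gt_eqF; lra.
have e1 := expR1_ge R.
set S := Num.sqrt (r + p)%:R in b cE *; have S0 : 0 <= S by exact: sqrtr_ge0.
have SS : S ^+ 2 = Q + P by rewrite sqr_sqrtr ?ler0n// natrD.
have b0 : 0 <= b by rewrite !mulr_ge0 ?invr_ge0 ?expR_ge0//; lra.
have bE : b * (P + 1) = u * (expR 1 * S).
  by rewrite /b -natr1 !mulrA divfK// gt_eqF; lra.
have c0 : 0 <= c by lra.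
set z := Num.sqrt P.
have zz : z ^+ 2 = P by rewrite sqr_sqrtr//; lra.
have z0 : 0 <= z by exact: sqrtr_ge0.
have z2 : 2 <= z by apply: le_of_sqr => //; rewrite zz; lra.
have Pa : 3 * z <= P * a.
  have P0 : 0 <= P by lra.
  apply: le_of_sqr; first by rewrite mulr_ge0.
  have -> : (P * a) ^+ 2 = P * (12 * Q) by rewrite -aa; ring.
  rewrite exprMn zz; nra.
have zS : z <= S by apply: le_of_sqr => //; rewrite zz SS; lra.
have Pb : 2 * z <= P * b.
  have H1 : 5 / 2 * z <= b * (P + 1).
    rewrite bE; apply: (@le_trans _ _ (1 * (5 / 2 * z))); first by rewrite mul1r.
    by rewrite ler_pM// ?mulr_ge0// ler_pM//.
  have : b * (P + 1) <= 5 / 4 * (P * b) by nra.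
  lra.
(* Serves 2 P <= 4 exp(c P / 7) through [expR_ge1Dsqr], as 4 (5 / 7)^2 > 2. *)
have cP : 5 * z <= c * P by rewrite -cE mulrDl ![_ * P]mulrC; lra.
have uu : u ^+ 2 <= 4 / 10 * (c * P).
  have bc : b ^+ 2 <= 2 * c.
    apply: (@le_trans _ _ (c ^+ 2)); first by rewrite lerXn2r ?nnegrE//; lra.
    by rewrite expr2 ler_wpM2r.
  have H : u ^+ 2 * (5 / 2) ^+ 2 * (P + 1) <= 2 * c * (P + 1) * (P + 1).
    apply: (@le_trans _ _ ((b * (P + 1)) ^+ 2)); last first.
      by rewrite exprMn -mulrA -expr2 ler_wpM2r ?sqr_ge0.
    rewrite bE !exprMn SS mulrA; apply: ler_pM; [by rewrite mulr_ge0 ?sqr_ge0|lra| |lra].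
    by rewrite -exprMn ler_wpM2l ?sqr_ge0// lerXn2r ?nnegrE ?expR_ge0.
  have {}H : u ^+ 2 * (5 / 2) ^+ 2 <= 2 * c * (P + 1).
    by move: H; rewrite ler_pM2r//; lra.
  have : c * (P + 1) <= 5 / 4 * (c * P) by nra.
  lra.
have QP : Q <= c * P / 6.
  have : a ^+ 2 <= 2 * c.
    apply: (@le_trans _ _ (c ^+ 2)); first by rewrite lerXn2r ?nnegrE//; lra.
    by rewrite expr2 ler_wpM2r.
  nra.
pose y := Num.sqrt (P / Q).
have y0 : 0 <= y by exact: sqrtr_ge0.
have yy : Q * y ^+ 2 = P.
  by rewrite sqr_sqrtr ?divr_ge0 ?ler0n// mulrC divfK// gt_eqF; lra.
(* Q y equals P a / sqrt 12, and 13 / 45 is just above 1 / sqrt 12. *)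
have Qy : Q * y <= 13 / 45 * (c * P).
  apply: (@le_trans _ _ (13 / 45 * (P * a))); last first.
    have Pac : P * a <= c * P by rewrite [c * P]mulrC ler_wpM2l//; lra.
    lra.
  have P0 : 0 <= P by lra.
  have Q0 : 0 <= Q by lra.
  apply: le_of_sqr; first by apply: mulr_ge0 (mulr_ge0 P0 a0); lra.
  have -> : (Q * y) ^+ 2 = Q * P by rewrite -yy; ring.
  have -> : (13 / 45 * (P * a)) ^+ 2 = (13 / 45) ^+ 2 * (P * (12 * Q)) by rewrite -aa; ring.
  have : 0 <= Q * P by exact: mulr_ge0.
  lra.
have bin : 'C(r + p, p)%:R <= expR (Q + Q * y).
  rewrite -[in X in 'C(_, X)](addKn r p) bin_sub ?leq_addr// addnC.
  have HB := binR_le p r0; apply: le_trans HB _.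
  have -> : expR 1 * (p + r)%:R / r%:R = expR 1 * (1 + y ^+ 2).
    rewrite -mulrA natrD mulrDl divff ?gt_eqF ?ltr0n//.
    by rewrite [_ + 1]addrC /y sqr_sqrtr// divr_ge0.
  rewrite exprMn expRD -expRM_natl mulr1 ler_wpM2l ?expR_ge0//.
  rewrite expRM_natl lerXn2r ?nnegrE ?expR_ge0 ?addr_ge0 ?sqr_ge0//.
  exact: expR_ge1Dsqr.
have Pe : 2 * P <= 4 * expR (7^-1 * (c * P)).
  have := @expR_ge1Dsqr R (7^-1 * (5 * z)).
  have : expR (7^-1 * (5 * z)) <= expR (7^-1 * (c * P)).
    by rewrite ler_expR; lra.
  rewrite !exprMn zz => H1 H2; have {}H2 := H2 ltac:(lra); lra.
have C1 : expR (c * P) <= (1 + c) ^+ p ^+ 2.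
  rewrite -exprM.
  have -> : c * P = (p * 2)%:R * (c / 2) by rewrite natrM /P; field.
  by rewrite expRM_natl lerXn2r ?nnegrE ?expR_ge0 ?expR_half_le//; lra.
apply: le_of_sqr; first by rewrite !mulr_ge0 ?exprn_ge0 ?expR_ge0 ?addr_ge0.
apply: (le_trans CC); rewrite !exprMn -expRM_natl.
apply: (@le_trans _ _ (2 * P * expR (Q + Q * y))); first by rewrite ler_wpM2l// mulr_ge0//; lra.
apply: (@le_trans _ _ (4 * expR (7^-1 * (c * P)) * expR (Q + Q * y))).
  by rewrite ler_wpM2r// expR_ge0.
apply: (@le_trans _ _ (2 ^+ 2 * expR (2%:R * (- u ^+ 2 / 2)) * expR (c * P))); last first.
  by rewrite ler_wpM2l// mulr_ge0 ?expR_ge0.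
have : expR (7^-1 * (c * P)) * expR (Q + Q * y) <=
       expR (2%:R * (- u ^+ 2 / 2)) * expR (c * P).
  by rewrite -!expRD ler_expR; lra.
set A := expR (7^-1 * _); set B := expR (Q + _); set D := expR (2%:R * _); set E := expR (c * P).
by lra.
Qed.

(** Split at c = 2. For larger c, 1 + t c >= t c pays for t^-p; for smaller c, 1 + t c >= 1 + c.
    Each case uses one of the two failure terms. *)
Lemma tail_bound r p t u C : (0 < r)%N -> (4 <= p)%N -> 1 <= u -> 1 <= t -> 0 <= C ->
  C ^+ 2 <= 2 * p%:R * 'C(r + p, p)%:R ->
  C <= (1 + t * Num.sqrt (12 * r%:R / p%:R)
    + u * t * (expR 1 * Num.sqrt (r + p)%:R / p.+1%:R)) ^+ p *
    (5 * t ^- p + 2 * expR (- (u ^+ 2) / 2)).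
Proof.
move=> r0 p4 u1 t1 C0 CC.
set a := Num.sqrt (12 * _ / _); set b := expR 1 * _ / _.
pose c := a + u * b.
have a0 : 0 <= a by exact: sqrtr_ge0.
have b0 : 0 <= u * b by rewrite !mulr_ge0 ?invr_ge0 ?expR_ge0 ?sqrtr_ge0//; lra.
have c0 : 0 <= c by exact: addr_ge0.
have t0 : 0 < t by lra.
have -> : 1 + t * a + u * t * b = 1 + t * c by rewrite /c; ring.
have tc : c <= t * c by rewrite ler_peMl.
have T0 : 0 <= 5 * t ^- p by rewrite mulr_ge0// invr_ge0 exprn_ge0// ltW.
have U0 : 0 <= 2 * expR (- (u ^+ 2) / 2) by rewrite mulr_ge0 ?expR_ge0.
have V0 : 0 <= (1 + t * c) ^+ p by apply: exprn_ge0; lra.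
have [c2|/ltW c2] := leP 2 c.
  rewrite mulrDr; apply: (@le_trans _ _ ((1 + t * c) ^+ p * (5 * t ^- p))); last first.
    by rewrite lerDl mulr_ge0.
  rewrite mulrA ler_pdivlMr ?exprn_gt0//.
  apply: (@le_trans _ _ (5 * c ^+ p * t ^+ p)).
    rewrite ler_wpM2r ?exprn_ge0//; first by lra.
    have p0 : (0 < p)%N by exact: leq_trans p4.
    apply: (tail_large p0 c2 _ C0 CC).
    apply: (@le_trans _ _ (a ^+ 2)).
      by rewrite sqr_sqrtr// divr_ge0// mulr_ge0.
    by rewrite lerXn2r ?nnegrE//; rewrite /c; lra.
  rewrite -mulrA -exprMn [X in _ <= X]mulrC ler_wpM2l// lerXn2r ?nnegrE//; nra.
rewrite mulrDr; apply: (@le_trans _ _ ((1 + t * c) ^+ p * (2 * expR (- (u ^+ 2) / 2)))); last first.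
  by rewrite lerDr mulr_ge0.
apply: le_trans (tail_small r0 p4 u1 c2 C0 erefl CC) _.
rewrite mulrC ler_wpM2r// lerXn2r ?nnegrE//; lra.
Qed.

End tail_bound.

(** * One step of the algorithm *)

Section nystrom.
Context (R : realType).

(** Gram-Schmidt, one row at a time: the residual v of the new row is either zero or normalised and
    put in front of Q. *)
Lemma orth_basis s m (B : 'M[R]_(s, m)) :
  exists q (Q : 'M[R]_(q, m)), Q *m Q^T = 1%:M /\ (Q == B)%MS.
Proof.
elim: s B => [|s IH] B.
  exists 0%N, 0; split; first by rewrite [LHS]flatmx0 [RHS]flatmx0.
  by rewrite [B]flatmx0 submx_refl.
rewrite -[s.+1]/(1 + s)%N in B *.
rewrite -[B]vsubmxK; set b := usubmx B; set B' := dsubmx B.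
have [q [Q [QQ /andP[QB BQ]]]] := IH B'.
pose v := b - b *m Q^T *m Q.
have vQ : v *m Q^T = 0 by rewrite mulmxBl -!mulmxA QQ mulmx1 subrr.
have bE : b = v + b *m Q^T *m Q by rewrite subrK.
have vB : (v <= col_mx b B')%MS.
  rewrite -addsmxE /v -mulNmx addmx_sub_adds// mulmx_sub//.
have [v0|v0] := eqVneq v 0.
  exists q, Q; split=> //; apply/andP; split.
    by rewrite -addsmxE (submx_trans QB)// addsmxSr.
  by rewrite -addsmxE addsmx_sub BQ andbT bE v0 add0r submxMl.
pose n := Num.sqrt (sqn v).
have n0 : n != 0 by rewrite gt_eqF// sqrtr_gt0 lt_neqAle sqn_ge0 eq_sym sqn_eq0 v0.
have nn : n * n = sqn v by rewrite -expr2 sqr_sqrtr ?sqn_ge0.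
exists (1 + q)%N, (col_mx (n^-1 *: v) Q); split.
  rewrite tr_col_mx mul_col_row QQ linearZ/= -!scalemxAl -!scalemxAr vQ.
  rewrite -[Q *m v^T]trmxK trmx_mul trmxK vQ trmx0 !scaler0 scalar_mx_block; congr block_mx.
  have -> : v *m v^T = (sqn v)%:M by rewrite [LHS]mx11_scalar sqn_trmul [\tr _]big_ord1.
  by rewrite -nn !scale_scalar_mx mulKf// mulVf.
have vv : (n^-1 *: v == v)%MS by apply/eqmxP; exact: eqmx_scale (invr_neq0 n0).
move/andP: vv => [v1 v2].
apply/andP; split; rewrite -!addsmxE addsmx_sub; apply/andP; split.
- by rewrite addsmxE (submx_trans v1).
- by rewrite (submx_trans QB)// addsmxSr.
- rewrite {1}bE addmx_sub//; first by rewrite (submx_trans v2)// addsmxSl.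
  by rewrite (submx_trans (submxMl _ _))// addsmxSr.
- by rewrite (submx_trans BQ)// addsmxSr.
Qed.

(** Write B = D Q with C a left inverse of D; cancelling D on both sides of the hypothesis gives D^T
    X D = 1. Any generalised inverse X will do, so [pinvmx] suffices in [nys] although it need not
    be the Moore-Penrose inverse. *)
Lemma gram_ginv s m q (B : 'M[R]_(s, m)) (Q : 'M[R]_(q, m)) (X : 'M[R]_s) :
  Q *m Q^T = 1%:M -> (Q == B)%MS -> B *m B^T *m X *m (B *m B^T) = B *m B^T ->
  B^T *m X *m B = Q^T *m Q.
Proof.
move=> QQ /andP[/submxP[C QE] /submxP[D BE]].
have CD : C *m D = 1%:M.
  by rewrite -[LHS]mulmx1 -{1}QQ mulmxA -(mulmxA C) -BE -QE QQ.
have DC : D^T *m C^T = 1%:M by rewrite -trmx_mul CD trmx1.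
have -> : B *m B^T = D *m D^T by rewrite BE trmx_mul mulmxA -(mulmxA D) QQ mulmx1.
move=> H.
have {}H : D^T *m X *m D = 1%:M.
  transitivity (C *m (D *m D^T *m X *m (D *m D^T)) *m C^T).
    by rewrite -!mulmxA DC mulmx1 !mulmxA CD mul1mx.
  by rewrite H -!mulmxA DC mulmx1 CD.
by rewrite BE trmx_mul -!mulmxA (mulmxA X) (mulmxA D^T) (mulmxA D^T) H mul1mx.
Qed.

(* If [K = M M^T] this is [M Q^T Q M^T], whatever the choice of [Q]. *)
Definition nys s N (K : 'M[R]_N) (G : 'M[R]_(s, N)) : 'M[R]_N :=
  K *m G^T *m pinvmx (G *m K *m G^T) *m G *m K.

Lemma nysE s N m q (M : 'M[R]_(N, m)) (G : 'M[R]_(s, N)) (Q : 'M[R]_(q, m)) :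
  Q *m Q^T = 1%:M -> (Q == G *m M)%MS ->
  nys (M *m M^T) G = M *m Q^T *m Q *m M^T.
Proof.
move=> QQ QB; rewrite /nys.
have -> : G *m (M *m M^T) *m G^T = G *m M *m (G *m M)^T by rewrite trmx_mul !mulmxA.
set S := _ *m _^T.
have SX : S *m pinvmx S *m S = S by rewrite mulmxKpV.
have := gram_ginv QQ QB SX; rewrite trmx_mul => H.
by transitivity (M *m (Q^T *m Q) *m M^T); [rewrite -H|]; rewrite !mulmxA.
Qed.

Lemma gram_defect N m q (M : 'M[R]_(N, m)) (Q : 'M[R]_(q, m)) : Q *m Q^T = 1%:M ->
  \tr (M *m M^T) - \tr (M *m Q^T *m Q *m M^T) = sqn (M - M *m Q^T *m Q).
Proof.
move=> QQ; rewrite -raddfB/= sqn_trmul; congr (\tr _).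
set A := M *m Q^T; have QM : Q *m M^T = A^T by rewrite trmx_mul trmxK.
rewrite linearB/= mulmxBl !mulmxBr trmx_mul mulmxA -/A -!(mulmxA A Q) (mulmxA Q) QQ QM mul1mx.
by rewrite subrr subr0.
Qed.

Lemma sqn_proj_le N m q (M : 'M[R]_(N, m)) (Q : 'M[R]_(q, m)) (Z : 'M[R]_(N, q)) :
  Q *m Q^T = 1%:M -> sqn (M - M *m Q^T *m Q) <= sqn (M - Z *m Q).
Proof.
move=> QQ; set E := M - M *m Q^T *m Q; set F := (M *m Q^T - Z) *m Q.
have EQ : E *m F^T = 0.
  rewrite /F trmx_mul mulmxA /E [(_ - _) *m Q^T]mulmxBl.
  by rewrite -(mulmxA _ Q) QQ mulmx1 subrr mul0mx.
have FE : F *m E^T = 0 by rewrite -[LHS]trmxK trmx_mul trmxK EQ trmx0.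
have -> : M - Z *m Q = E + F by rewrite /E /F mulmxBl addrA subrK.
rewrite [leRHS]sqn_trmul linearD/= mulmxDl !mulmxDr EQ FE addr0 add0r linearD/= -!sqn_trmul.
by rewrite lerDl sqn_ge0.
Qed.

(* A rational function of its arguments, converging to [nys]: this is how [nys] is
   shown to be measurable. *)
Definition ridge (e : R) s N (K : 'M[R]_N) (G : 'M[R]_(s, N)) : 'M[R]_N :=
  let S := G *m K *m G^T + e%:M in
  (\det S)^-1 *: (K *m G^T *m \adj S *m G *m K).

Lemma det_gram_ridge s q (D : 'M[R]_(s, q)) e : 0 < e -> \det (D *m D^T + e%:M) != 0.
Proof.
move=> e0; apply/negP => /det0P[v v0 vD].
have : sqn (v *m D) + e * sqn v = 0.
  rewrite !sqn_trmul trmx_mul mulmxA -(mulmxA v) -[e * _]linearZ/= -linearD/=.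
  rewrite scalemxAl -mulmxDl -mul_mx_scalar -mulmxDr vD mul0mx.
  by rewrite linear0.
move/eqP; rewrite paddr_eq0 ?sqn_ge0 ?mulr_ge0 ?sqn_ge0 ?(ltW e0)//.
by rewrite mulf_eq0 (gt_eqF e0)//= !sqn_eq0 (negbTE v0) andbF.
Qed.

(** Moves the inverse from D D^T, possibly singular as e tends to 0, to D^T D, which is invertible
    when D has full column rank; there e times the inverse tends to 0. *)
Lemma ridge_push s q (D : 'M[R]_(s, q)) e : 0 < e ->
  D^T *m invmx (D *m D^T + e%:M) *m D = 1%:M - e *: invmx (D^T *m D + e%:M).
Proof.
move=> e0; set S := _ + _; pose W := D^T *m D + e%:M; rewrite -/W.
have Su : S \in unitmx by rewrite unitmxE unitfE det_gram_ridge.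
have Wu : W \in unitmx by have := @det_gram_ridge _ _ D^T e e0; rewrite trmxK unitmxE unitfE.
have H : W *m D^T = D^T *m S by rewrite mulmxDl mulmxDr mul_scalar_mx mul_mx_scalar mulmxA.
have -> : D^T *m invmx S = invmx W *m D^T.
  by rewrite -[LHS]mul1mx -(mulVmx Wu) -!mulmxA (mulmxA W) H -!mulmxA mulmxV// mulmx1.
have -> : invmx W *m D^T *m D = invmx W *m (W - e%:M) by rewrite /W addrK mulmxA.
by rewrite mulmxBr mulVmx// mul_mx_scalar.
Qed.

(** The determinant and the adjugate of W + e are polynomials in e, and the determinant has a
    nonzero limit. *)
Lemma cvg_ridge_inv n (W : 'M[R]_n) i j : \det W != 0 ->
  (harmonic k : R) * invmx (W + (harmonic k)%:M) i j @[k --> \oo] --> (0 : R).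
Proof.
move=> W0.
pose P : 'M[{poly R}]_n := map_mx polyC W + 'X%:M.
have PE e : map_mx (horner_eval e) P = W + e%:M.
  apply/matrixP => a b; rewrite !mxE horner_evalE hornerD hornerC.
  by rewrite hornerMn hornerX.
have dE e : \det (W + e%:M) = (\det P).[e] by rewrite -PE det_map_mx.
have aE e : \adj (W + e%:M) i j = (\adj P i j).[e] by rewrite -PE -map_mx_adj mxE.
have d0 : (\det P).[0] != 0 by rewrite -dE raddf0 addr0.
have hc (p : {poly R}) : p.[harmonic k] @[k --> \oo] --> p.[0].
  exact: (cvg_comp _ _ (@cvg_harmonic R) (@continuous_horner R p 0)).
have H : (harmonic k : R) * (((\det P).[harmonic k])^-1 * (\adj P i j).[harmonic k])
    @[k --> \oo] --> (0 * (((\det P).[0])^-1 * (\adj P i j).[0]) : R).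
  apply: cvgM; first exact: cvg_harmonic.
  apply: cvgM; last exact: hc.
  by apply: cvgV; [exact: d0|exact: hc].
rewrite mul0r in H; apply: cvg_trans H; apply: near_eq_cvg.
have : \forall k \near \oo, (\det P).[harmonic k] != 0.
  by have := hc (\det P) => /cvgr_neq0; apply.
apply: filterS => k dk; congr (_ * _).
by rewrite /invmx unitmxE unitfE dE dk [in RHS]mxE aE.
Qed.

Lemma cvg_ridge s N m (M : 'M[R]_(N, m)) (G : 'M[R]_(s, N)) i j :
  ridge (harmonic k) (M *m M^T) G i j @[k --> \oo] --> nys (M *m M^T) G i j.
Proof.
have [q [Q [QQ QB]]] := orth_basis (G *m M).
rewrite (nysE QQ QB); have /andP[/submxP[C QE] /submxP[D BE]] := QB.
have CD : C *m D = 1%:M by rewrite -[LHS]mulmx1 -{1}QQ mulmxA -(mulmxA C) -BE -QE QQ.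
have DC : D^T *m C^T = 1%:M by rewrite -trmx_mul CD trmx1.
set W := D^T *m D.
have W0 : \det W != 0.
  apply/negP => /det0P[v v0 vW].
  have /eqP : sqn (D *m v^T) = 0.
    by rewrite sqn_mulTmx trmx_mul trmxK mulmxA -(mulmxA v) vW mul0mx linear0.
  rewrite sqn_eq0 => /eqP Dv; move/eqP: v0; apply.
  by rewrite -[v]trmxK -[v^T]mul1mx -CD -mulmxA Dv mulmx0 trmx0.
pose A := M *m Q^T.
have rE k : ridge (harmonic k) (M *m M^T) G =
    A *m A^T - harmonic k *: (A *m invmx (W + (harmonic k)%:M) *m A^T).
  have k0 : 0 < harmonic k :> R by rewrite invr_gt0.
  rewrite /ridge; set S := _ + _.
  have SE : S = D *m D^T + (harmonic k)%:M.
    rewrite /S; congr (_ + _).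
    by rewrite mulmxA BE -(mulmxA _ M^T) -trmx_mul BE trmx_mul mulmxA -(mulmxA D) QQ mulmx1.
  have dS : \det S != 0 by rewrite SE det_gram_ridge.
  have -> : A *m A^T - harmonic k *: (A *m invmx (W + (harmonic k)%:M) *m A^T) =
      A *m (D^T *m invmx S *m D) *m A^T.
    by rewrite SE ridge_push// mulmxBr mulmx1 mulmxBl -scalemxAr -scalemxAl.
  have MB : M *m M^T *m G^T = A *m D^T.
    by rewrite -mulmxA -trmx_mul BE trmx_mul mulmxA.
  have BM : G *m (M *m M^T) = D *m A^T.
    by rewrite -[LHS]trmxK trmx_mul [(M *m _)^T]trmx_mul trmxK MB trmx_mul trmxK.
  rewrite MB -(mulmxA _ G) BM /invmx unitmxE unitfE dS.
  by rewrite -!scalemxAr -!scalemxAl -!scalemxAr -!scalemxAl !mulmxA.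
have -> : M *m Q^T *m Q *m M^T = A *m A^T by rewrite /A trmx_mul trmxK mulmxA.
have -> : (fun k => ridge (harmonic k) (M *m M^T) G i j) = (fun k => (A *m A^T) i j -
    \sum_b \sum_a A i a * A j b * ((harmonic k : R) * invmx (W + (harmonic k)%:M) a b)).
  apply/funext => k; rewrite rE [LHS]mxE; congr (_ + _); rewrite !mxE; congr (- _).
  rewrite mulr_sumr; apply: eq_bigr => b _; rewrite !mxE mulr_suml mulr_sumr.
  by apply: eq_bigr => a _; ring.
rewrite -[X in _ --> X]subr0; apply: cvgB; first exact: cvg_cst.
rewrite [X in _ --> X](_ : 0 = \sum_b \sum_a A i a * A j b * 0); last first.
  by rewrite big1// => b _; rewrite big1// => a _; rewrite mulr0.
apply: (cvg_big (@add_continuous R)) => b _; apply: (cvg_big (@add_continuous R)) => a _.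
by apply: cvgM; [exact: cvg_cst|exact: cvg_ridge_inv].
Qed.

Lemma measurable_nys d (T : measurableType d) s N (K : T -> 'M[R]_N) (G : T -> 'M[R]_(s, N)) :
  (forall t, exists m (M : 'M[R]_(N, m)), K t = M *m M^T) ->
  measurable_fun setT K -> measurable_fun setT G ->
  measurable_fun setT (fun t => nys (K t) (G t)).
Proof.
move=> gK mK mG; apply: measurable_fun_mxP => i j.
apply: (@measurable_fun_cvg _ _ R setT (fun k t => ridge (harmonic k) (K t) (G t) i j)).
  move=> k.
  have mS : measurable_fun setT (fun t => G t *m K t *m (G t)^T + (harmonic k)%:M).
    apply: measurable_fun_mxP => a b.
    rewrite (_ : (fun t => _) = (fun t => (G t *m K t *m (G t)^T) a b + (harmonic k *+ (a == b)))); last first.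
      by apply/funext => t; rewrite mxE [X in _ + X]mxE.
    apply: measurable_funD => //; apply: (measurableT_comp (measurable_coef a b)).
    apply: measurable_mulmx; first exact: measurable_mulmx.
    exact: (measurableT_comp (@measurable_trmx _ _ _) mG).
  apply: (measurableT_comp (measurable_coef i j)).
  apply: measurable_scale.
    apply: (measurableT_comp (@measurable_invr R)); exact: measurable_det.
  apply: measurable_mulmx => //; apply: measurable_mulmx => //.
  apply: measurable_mulmx; last exact: measurable_adj.
  apply: measurable_mulmx => //.
  exact: (measurableT_comp (@measurable_trmx _ _ _) mG).
move=> t _; have [m [M ->]] := gK t; exact: cvg_ridge.
Qed.

End nystrom.

(** * Error of one step for a fixed draw *)

Section single_step.
Context (R : realType).

(* The tangent line of [z |-> z^(p/2)] at [z = b^2], evaluated at [z = a^2]. *)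
Lemma tangent_pow (a b : R) p : (2 <= p)%N -> 0 <= a -> 0 <= b ->
  p%:R * (a ^+ 2 * b ^+ (p - 2)) <= 2 * a ^+ p + (p - 2)%:R * b ^+ p.
Proof.
move=> p2 a0 b0; rewrite -(subnK p2); move: (p - 2)%N => {p2}p; rewrite addnK.
elim: p => [|p IH]; first by rewrite expr0 mul0r addr0 mulr1.
rewrite addSn -!natr1 natrD !exprS.
move: IH; rewrite !exprD natrD => IH.
have := ler_wpM2r b0 IH.
(* What the induction step adds to b times the hypothesis factors as (a - b) times a term of the
   sign of a - b. *)
have : 0 <= (a - b) * (2 * (a ^+ p * a ^+ 2) - b ^+ p * b * (a + b)).
  have ap := exprn_ge0 p a0; have bp := exprn_ge0 p b0.
  have [ab|/ltW ba] := leP a b.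
    rewrite -mulrNN mulr_ge0//; first by rewrite oppr_ge0 subr_le0.
    rewrite oppr_ge0 subr_le0.
    have xy : a ^+ p <= b ^+ p by rewrite lerXn2r ?nnegrE.
    have H1 : a ^+ p * a ^+ 2 <= b ^+ p * (b * a).
      by rewrite ler_pM ?sqr_ge0// expr2 ler_wpM2r.
    have H2 : a ^+ p * a ^+ 2 <= b ^+ p * (b * b).
      by rewrite ler_pM ?sqr_ge0// expr2 ler_pM.
    lra.
  rewrite mulr_ge0//; first by rewrite subr_ge0.
  rewrite subr_ge0.
  have xy : b ^+ p <= a ^+ p by rewrite lerXn2r ?nnegrE.
  have H1 : b ^+ p * (b * a) <= a ^+ p * a ^+ 2.
    by rewrite ler_pM ?mulr_ge0// expr2 ler_wpM2r.
  have H2 : b ^+ p * (b * b) <= a ^+ p * a ^+ 2.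
    by rewrite ler_pM ?mulr_ge0// expr2 ler_pM.
  lra.
lra.
Qed.

(** Jensen: average the tangent inequality taken at the mean b^2 = S. *)
Lemma power_mean (I : finType) (mu z : I -> R) p : (2 <= p)%N ->
  (forall i, 0 <= mu i) -> (forall i, 0 <= z i) -> \sum_i mu i = 1 ->
  Num.sqrt (\sum_i mu i * z i ^+ 2) ^+ p <= \sum_i mu i * z i ^+ p.
Proof.
move=> p2 mu0 z0 mu1; set S := \sum_i mu i * _ ^+ 2.
have S0 : 0 <= S by apply: sumr_ge0 => i _; rewrite mulr_ge0// sqr_ge0.
set b := Num.sqrt S; have b0 : 0 <= b by exact: sqrtr_ge0.
have bb : b ^+ 2 = S by rewrite sqr_sqrtr.
have : \sum_i mu i * (p%:R * (z i ^+ 2 * b ^+ (p - 2))) <=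
       \sum_i mu i * (2 * z i ^+ p + (p - 2)%:R * b ^+ p).
  by apply: ler_sum => i _; rewrite ler_wpM2l// tangent_pow.
have -> : \sum_i mu i * (p%:R * (z i ^+ 2 * b ^+ (p - 2))) = p%:R * b ^+ p.
  have -> : b ^+ p = b ^+ (p - 2) * S by rewrite -bb -exprD subnK.
  rewrite /S !mulr_sumr.
  by apply: eq_bigr => i _; ring.
have -> : \sum_i mu i * (2 * z i ^+ p + (p - 2)%:R * b ^+ p) =
    2 * \sum_i mu i * z i ^+ p + (p - 2)%:R * b ^+ p.
  rewrite -[X in _ + X]mul1r -mu1 mulr_sumr mulr_suml -big_split/=.
  by apply: eq_bigr => i _; ring.
rewrite natrB// => H.
by rewrite -(@ler_pM2l _ 2)//; lra.
Qed.

Lemma defect_le_lsq s N m k (M : 'M[R]_(N, m)) (G : 'M[R]_(s, N)) (U : 'M[R]_(N, k)) :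
  U^T *m U = 1%:M -> \det (gram (G *m U)) != 0 ->
  let E := M - U *m U^T *m M in
  \tr (M *m M^T) - \tr (nys (M *m M^T) G) <= sqn E + sqn (lsq (G *m U) *m G *m E).
Proof.
move=> UU dG /=; set E := M - U *m U^T *m M.
have [q [Q [QQ QB]]] := orth_basis (G *m M).
rewrite (nysE QQ QB) (gram_defect M QQ).
have /andP[_ /submxP[D BE]] := QB.
(* As G M = D Q, the admissible approximation U L D Q is U L G M; since L G U = 1 it reproduces the
   part of M in the span of U. *)
set L := lsq (G *m U); apply: le_trans (sqn_proj_le M (U *m L *m D) QQ) _.
have LU : L *m G *m U = 1%:M by rewrite -mulmxA lsqK.
have -> : M - U *m L *m D *m Q = E - U *m (L *m G *m E).
  rewrite -(mulmxA _ D) -BE /E !(mulmxBr, mulmxBl) !mulmxA.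
  rewrite -(mulmxA (U *m L) G U) -(mulmxA U L) (mulmxA L) LU mulmx1.
  by rewrite opprB addrA subrK.
have UE : U^T *m E = 0 by rewrite /E mulmxBr !mulmxA UU mul1mx subrr.
have EU : E^T *m U = 0 by rewrite -[LHS]trmxK trmx_mul trmxK UE trmx0.
set Z := L *m G *m E.
clearbody Z E.
rewrite [leLHS]sqn_mulTmx [(_ - _)^T]linearB/= trmx_mul mulmxBl !mulmxBr.
rewrite (mulmxA E^T) EU mul0mx subr0 -(mulmxA Z^T) UE mulmx0 sub0r opprK.
by rewrite mulmxA -(mulmxA Z^T) UU mulmx1 linearD/= -!sqn_mulTmx.
Qed.

Lemma sqn_cols N m (A : 'M[R]_(N, m)) : sqn A = \sum_l sqn (col l A).
Proof.
rewrite /sqn exchange_big/=; apply: eq_bigr => l _; apply: eq_bigr => i _.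
by rewrite big_ord1 mxE.
Qed.

Lemma col_mulmx a b c (A : 'M[R]_(a, b)) (B : 'M[R]_(b, c)) l : col l (A *m B) = A *m col l B.
Proof. by apply/matrixP => i j; rewrite !mxE; apply: eq_bigr => h _; rewrite mxE. Qed.

Lemma sqnZ N m a (A : 'M[R]_(N, m)) : sqn (a *: A) = a ^+ 2 * sqn A.
Proof.
rewrite /sqn mulr_sumr; apply: eq_bigr => i _; rewrite mulr_sumr.
by apply: eq_bigr => j _; rewrite mxE exprMn.
Qed.

Lemma step_pointwise s N m k (p : nat) (M : 'M[R]_(N, m)) (G : 'M[R]_(s, N)) (U : 'M[R]_(N, k)) (eta : R) :
  (2 <= p)%N -> U^T *m U = 1%:M -> 0 <= eta ->
  let E := M - U *m U^T *m M in 0 < sqn E ->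
  eta ^+ 2 * sqn E < \tr (M *m M^T) - \tr (nys (M *m M^T) G) ->
  ((eta ^+ p)%:E <= \sum_(l < m) (sqn (col l E) / sqn E)%:E *
     lsq_cost p (G *m U) (G *m ((Num.sqrt (sqn (col l E)))^-1 *: col l E)))%E.
Proof.
move=> p2 UU eta0 /=; set E := M - U *m U^T *m M => E0 bad.
have mu0 l : 0 <= sqn (col l E) / sqn E by rewrite divr_ge0 ?sqn_ge0.
have [dG|dG] := eqVneq (\det (gram (G *m U))) 0.
  (* Singular case: the cost is +oo and some column of E has positive weight, so the right side is
     +oo. *)
  have [l l0] : exists l, 0 < sqn (col l E).
    apply/existsP; apply: contraTT E0; rewrite negb_exists => /forallP H.
    rewrite sqn_cols big1 ?ltxx// => l _.
    by apply/eqP; rewrite eq_le sqn_ge0 andbT leNgt H.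
  rewrite (bigD1 l)//= {1}/lsq_cost dG eqxx.
  rewrite gt0_muley ?lte_fin ?divr_gt0// addye ?leey//.
  rewrite gt_eqF// (lt_le_trans (ltNyr 0))// sume_ge0// => i _.
  by rewrite mule_ge0 ?lsq_cost_ge0 ?lee_fin.
pose L := lsq (G *m U) *m G.
pose z l : R := Num.sqrt (1 + sqn (L *m ((Num.sqrt (sqn (col l E)))^-1 *: col l E))).
have -> : (\sum_(l < m) (sqn (col l E) / sqn E)%:E *
     lsq_cost p (G *m U) (G *m ((Num.sqrt (sqn (col l E)))^-1 *: col l E)) =
     (\sum_(l < m) (sqn (col l E) / sqn E) * z l ^+ p)%:E)%E.
  rewrite -sumEFin; apply: eq_bigr => l _.
  by rewrite /lsq_cost (negbTE dG) EFinM /z /L mulmxA.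
rewrite lee_fin.
have mu1 : \sum_l sqn (col l E) / sqn E = 1.
  by rewrite -mulr_suml -sqn_cols divff// gt_eqF.
have z0 l : 0 <= z l by exact: sqrtr_ge0.
apply: le_trans (power_mean p2 mu0 z0 mu1).
rewrite lerXn2r ?nnegrE ?sqrtr_ge0//.
have -> : \sum_l sqn (col l E) / sqn E * z l ^+ 2 = (sqn E + sqn (L *m E)) / sqn E.
  rewrite [X in _ = (X + _) / _]sqn_cols (sqn_cols (L *m E)) -big_split/= mulr_suml; apply: eq_bigr => l _.
  rewrite /z sqr_sqrtr ?addr_ge0 ?sqn_ge0// -scalemxAr sqnZ -col_mulmx exprVn sqr_sqrtr ?sqn_ge0//.
  (* A zero column stays 0 under the convention on inverses and has weight 0, so both sides
     vanish. *)
  have [l0|l0] := eqVneq (sqn (col l E)) 0.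
    have /eqP := l0; rewrite sqn_eq0 => /eqP c0.
    by rewrite col_mulmx c0 mulmx0 !sqn0 !mul0r addr0 mul0r.
  by field; rewrite l0 gt_eqF.
apply: le_of_sqr; first exact: sqrtr_ge0.
rewrite sqr_sqrtr ?divr_ge0 ?addr_ge0 ?sqn_ge0//.
rewrite ler_pdivlMr//; apply: le_trans (ltW bad) _.
exact: (defect_le_lsq M UU dG).
Qed.

End single_step.

Section markov_set.
Local Open Scope ereal_scope.

Lemma ge0_markov d (T : measurableType d) (R : realType) (mu : measure T R)
    (D : set T) (f : T -> \bar R) (c : \bar R) :
  measurable D -> measurable_fun setT f -> (forall x, 0 <= f x) -> 0 <= c ->
  (forall x, D x -> c <= f x) -> c * mu D <= \int[mu]_x f x.
Proof.
move=> mD mf f0 c0 cf; rewrite -integral_cst//.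
apply: (@le_trans _ _ (\int[mu]_(x in D) f x)).
  apply: ge0_le_integral => //.
  exact: measurable_funS mf.
exact: ge0_subset_integral.
Qed.

End markov_set.

(** * Probability of a small error in one step *)

Section step_probability.
Context (R : realType) (p s N k : nat) (U : 'M[R]_(N, k)).
Hypothesis UU : U^T *m U = 1%:M.
Local Open Scope ereal_scope.

Let mfull : measurable_fun setT (fun B : 'M[R]_(s, 1 + k) => lsq_cost p (rsubmx B) (lsubmx B)).
Proof.
have [ml mr] := @measurable_submx _ _ _ s 1 k _ (@measurable_id _ 'M[R]_(s, 1 + k) setT).
by apply: measurable_lsq_cost; [exact: mr|exact: ml].
Qed.

Lemma step_mean (w : 'cV[R]_N) : w^T *m w = 1%:M -> U^T *m w = 0%R ->
  \int[gauss R s N]_G lsq_cost p (G *m U) (G *m w) = lsq_mean R p s k.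
Proof.
move=> ww Uw; have wU : w^T *m U = 0%R by rewrite -[LHS]trmxK trmx_mul trmxK Uw trmx0.
have VV : (row_mx w U)^T *m row_mx w U = 1%:M.
  by rewrite tr_row_mx mul_col_row ww Uw wU UU -scalar_mx_block.
rewrite /lsq_mean -(gauss_orth VV mfull) => [|B]; last exact: lsq_cost_ge0.
by apply: eq_integral => G _; rewrite mul_mx_row row_mxKl row_mxKr.
Qed.

Let mdet : measurable_fun setT (fun A : 'M[R]_(s, k) => \det (gram A) : measurableTypeR R).
Proof.
apply: measurable_det; apply: measurable_mulmx; last exact: measurable_id.
exact: measurable_trmx.
Qed.

Let mdet0 : measurable [set G : 'M[R]_(s, N) | \det (gram (G *m U)) = 0%R].
Proof.
have := measurableT_comp mdet (@measurable_mulmxr R s N k U).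
by move=> /(_ measurableT [set 0%R] (measurable_set1 _)); rewrite setTI; exact.
Qed.

(** The cost is +oo on this event and has finite mean. This settles the case E = 0 of [step_prob],
    where no column of E can be normalised. *)
Lemma det_gram_null : lsq_mean R p s k < +oo ->
  gauss R s N [set G | \det (gram (G *m U)) = 0%R] = 0.
Proof.
move=> Coo.
pose f (A : 'M[R]_(s, k)) : \bar R := if \det (gram A) == 0%R then +oo else 0.
have md := mdet.
have f0 A : 0 <= f A by rewrite /f; case: ifP.
have mf : measurable_fun setT f.
  apply: measurable_fun_ifT => //.
  by apply: measurable_fun_eqr.
have H : \int[gauss R s N]_G f (G *m U) <= lsq_mean R p s k.
  rewrite (gauss_orth UU mf f0) /lsq_mean.
  have mr := (@measurable_submx _ _ _ s 1 k _ (@measurable_id _ 'M[R]_(s, 1 + k) setT)).2.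
  have -> : \int[gauss R s k]_A f A = \int[gauss R s (1 + k)]_B f (rsubmx B).
    rewrite gauss_row_mx; [|exact: (measurableT_comp mf mr)|by move=> B; exact: f0].
    rewrite -[LHS](integral_cst_gauss s 1); apply: eq_integral => g _.
    by apply: eq_integral => A _; rewrite row_mxKr.
  apply: ge0_le_integral; [by []|by move=> B _; exact: f0|exact: (measurableT_comp mf mr)|exact: mfull|].
  by move=> B _; rewrite /f /lsq_cost; case: ifP => // _; rewrite lee_fin exprn_ge0// sqrtr_ge0.
have mD := mdet0.
have : +oo * gauss R s N [set G | \det (gram (G *m U)) = 0%R] <= lsq_mean R p s k.
  apply: le_trans _ H; apply: ge0_markov => //.
    exact: (measurableT_comp mf (@measurable_mulmxr R s N k U)).
  by move=> G /= d0; rewrite /f d0 eqxx.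
have := measure_ge0 (gauss R s N) [set G | \det (gram (G *m U)) = 0%R].
rewrite le_eqVlt => /orP[/eqP <-//|g0].
by rewrite gt0_mulye// leye_eq => /eqP Ce; rewrite Ce ltxx in Coo.
Qed.

Lemma step_prob m (M : 'M[R]_(N, m)) (C eta rho : R) : (2 <= p)%N ->
  lsq_mean R p s k <= C%:E -> (0 < eta)%R -> (sqn (M - U *m U^T *m M) <= rho)%R ->
  (1 - C / eta ^+ p)%:E <=
  gauss R s N [set G | \tr (M *m M^T) - \tr (nys (M *m M^T) G) <= eta ^+ 2 * rho]%R.
Proof.
move=> p2 CC eta0 Erho.
set E := (M - U *m U^T *m M)%R in Erho *.
have mdef : measurable_fun setT (fun G : 'M[R]_(s, N) =>
    (\tr (M *m M^T) - \tr (nys (M *m M^T) G))%R : measurableTypeR R).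
  apply: measurable_funB => //; apply: measurable_sum => i.
  apply: (measurableT_comp (measurable_coef i i)).
  by apply: measurable_nys => // _; exists m, M.
have mset c : measurable [set G : 'M[R]_(s, N) | \tr (M *m M^T) - \tr (nys (M *m M^T) G) <= c]%R.
  rewrite [X in measurable X](_ : _ = setT `&` (fun G : 'M[R]_(s, N) =>
    (\tr (M *m M^T) - \tr (nys (M *m M^T) G))%R : measurableTypeR R) @^-1` `]-oo, c]%classic).
    by apply: mdef => //; exact: measurable_itv.
  by rewrite setTI; apply/seteqP; split => G /=; rewrite in_itv.
have C0 : (0 <= C)%R.
  have H : 0 <= lsq_mean R p s k by apply: integral_ge0 => B _; exact: lsq_cost_ge0.
  by rewrite -lee_fin (le_trans H).
apply: (@le_trans _ _ (gauss R s N
  [set G | \tr (M *m M^T) - \tr (nys (M *m M^T) G) <= eta ^+ 2 * sqn E]%R)); last first.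
  apply: le_measure; rewrite ?inE//.
  by move=> G /= H; apply: le_trans H _; rewrite ler_wpM2l ?sqr_ge0.
set A := [set G | _].
have mA : measurable A by exact: mset.
suff H : gauss R s N (~` A) <= (C / eta ^+ p)%:E.
  rewrite -[A]setCK probability_setC; last exact: measurableC.
  by rewrite EFinB leeB.
have [E0|E0] := eqVneq (sqn E) 0%R.
  apply: (@le_trans _ _ 0); last by rewrite lee_fin divr_ge0// exprn_ge0// ltW.
  rewrite -(det_gram_null (le_lt_trans CC (ltry _))).
  apply: le_measure; rewrite ?inE//; first exact: measurableC.
  move=> G /=; apply: contra_notP => dG; have {}dG : \det (gram (G *m U)) != 0%R by apply/eqP.
  apply: le_trans (defect_le_lsq M UU dG) _; rewrite -/E E0 mulr0 add0r.
  by move/eqP: E0; rewrite sqn_eq0 => /eqP ->; rewrite mulmx0 sqn0.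
have {}E0 : (0 < sqn E)%R by rewrite lt_neqAle eq_sym E0 sqn_ge0.
pose w l : 'cV[R]_N := ((Num.sqrt (sqn (col l E)))^-1 *: col l E)%R.
have mcost l : measurable_fun setT (fun G : 'M[R]_(s, N) => lsq_cost p (G *m U) (G *m w l)).
  by apply: measurable_lsq_cost; exact: measurable_mulmxr.
have etap : (0 < eta ^+ p)%R by rewrite exprn_gt0.
have UE : U^T *m E = 0%R by rewrite /E mulmxBr !mulmxA UU mul1mx subrr.
suff : (eta ^+ p)%:E * gauss R s N (~` A) <= C%:E.
  by rewrite -lee_pdivlMl// mulrC EFinM.
apply: (@le_trans _ _ (\int[gauss R s N]_G
   \sum_(l < m) (sqn (col l E) / sqn E)%:E * lsq_cost p (G *m U) (G *m w l))).
  apply: ge0_markov.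
  - exact: measurableC.
  - by apply: emeasurable_sum => l; apply: emeasurable_funM.
  - by move=> G; apply: sume_ge0 => l _; rewrite mule_ge0 ?lsq_cost_ge0// lee_fin divr_ge0 ?sqn_ge0.
  - by rewrite lee_fin ltW.
  - move=> G /= /negP; rewrite -ltNge => bad.
    exact: (step_pointwise p2 UU (ltW eta0) E0 bad).
rewrite ge0_integral_sum; last 3 first.
- by [].
- by move=> l; apply: emeasurable_funM.
- by move=> l G _; rewrite mule_ge0 ?lsq_cost_ge0// lee_fin divr_ge0 ?sqn_ge0.
have mu1 : (\sum_l sqn (col l E) / sqn E)%R = 1%R.
  by rewrite -mulr_suml -sqn_cols divff// gt_eqF.
rewrite -[C%:E]mul1e -mu1 -sumEFin ge0_sume_distrl; last first.
  by move=> l _; rewrite lee_fin divr_ge0 ?sqn_ge0.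
apply: lee_sum => l _.
(* A zero column gives no unit vector for [step_mean], but its weight is 0. *)
have [l0|l0] := eqVneq (sqn (col l E)) 0%R.
  rewrite l0 mul0r mul0e; under eq_integral do rewrite mul0e.
  by rewrite integral0.
rewrite ge0_integralZl; last 4 first.
- by [].
- exact: mcost.
- by move=> G _; exact: lsq_cost_ge0.
- by rewrite lee_fin divr_ge0 ?sqn_ge0.
rewrite lee_wpmul2l ?lee_fin ?divr_ge0 ?sqn_ge0// step_mean//.
  rewrite /w [(_ *: _)^T]linearZ/= -scalemxAl -scalemxAr scalerA -invfM -expr2 sqr_sqrtr ?sqn_ge0//.
  have -> : ((col l E)^T *m col l E)%R = (sqn (col l E))%:M%R.
    by rewrite [LHS]mx11_scalar sqn_mulTmx [\tr _]big_ord1.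
  by rewrite scale_scalar_mx mulVf.
by rewrite /w -scalemxAr -col_mulmx UE col0 scaler0.
Qed.

End step_probability.

Section step_numeric.
Context (R : realType).

Lemma jwr_gt0 m : (0 < m)%N -> 0 < jwr R m.
Proof. by move=> m0; have [] := @kapE R 0 m m0. Qed.

Lemma tail_step r p (t u : R) N m (M : 'M[R]_(N, m)) k (U : 'M[R]_(N, k)) eta rho :
  (0 < r)%N -> (4 <= p)%N -> 1 <= u -> 1 <= t -> (k <= r)%N ->
  U^T *m U = 1%:M -> sqn (M - U *m U^T *m M) <= rho ->
  eta = 1 + t * Num.sqrt (12 * r%:R / p%:R)
             + u * t * (expR 1 * Num.sqrt (r + p)%:R / (p.+1)%:R) ->
  ((1 - (5 * t ^- p + 2 * expR (- (u ^+ 2) / 2)))%:E <=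
  gauss R (r + p) N [set G | \tr (M *m M^T) - \tr (nys (M *m M^T) G) <= eta ^+ 2 * rho]%R)%E.
Proof.
move=> r0 p4 u1 t1 kr UU Mrho etaE.
pose C : R := \prod_(i < r) (jwr R i.+1 / jwr R (p + i.+1)).
have C0 : 0 <= C by apply: prodr_ge0 => i _; rewrite divr_ge0// jwr_ge0.
have p0 : (0 < p)%N by exact: leq_trans p4.
have CC : C ^+ 2 <= 2 * p%:R * 'C(r + p, p)%:R.
  by rewrite /C (jwr_prod_sym jwr_gt0) (jwr_prod_sqr_le jwr_gt0).
have Ceta := tail_bound r0 p4 u1 t1 C0 CC; rewrite -etaE in Ceta.
have eta0 : 0 < eta.
  rewrite etaE -addrA ltr_pwDl//.
  by rewrite addr_ge0// !mulr_ge0 ?invr_ge0 ?expR_ge0 ?sqrtr_ge0//; lra.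
have lC : (lsq_mean R p (r + p) k <= C%:E)%E.
  (* Stripping the k columns leaves p + (r - k) rows, at least p. *)
  have -> : (r + p = p + (r - k) + k)%N by rewrite -addnA subnK// addnC.
  rewrite lsq_meanE ?leq_addr// lee_fin; apply: le_trans (jwr_prod_mono jwr_gt0 p kr).
  rewrite le_eqVlt; apply/orP; left; apply/eqP; apply: eq_bigr => i _.
  by rewrite -!addnA addKn.
have p2 : (2 <= p)%N by exact: leq_trans p4.
apply: le_trans (step_prob UU p2 lC eta0 Mrho).
by rewrite lee_fin lerB// ler_pdivrMr ?exprn_gt0// mulrC.
Qed.

End step_numeric.

(** * The chain of Gram matrices *)

Section chain.
Context (R : realType) (s : nat) (N : nat -> nat) (K0 : 'M[R]_(N 0)).
Variable pt : forall e, 'M[R]_(N e) -> 'M[R]_(N e.+1).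

Fixpoint glen e : nat := if e is e'.+1 then (glen e' + s * N e')%N else 0%N.

(* The draws of all steps are stored in one row vector, so that conditioning on
   the past is Fubini for a block row. *)
Fixpoint chainK e : 'rV[R]_(glen e) -> 'M[R]_(N e) :=
  match e with
  | 0 => fun=> K0
  | e'.+1 => fun v => pt (nys (chainK (lsubmx v)) (vec_mx (rsubmx v) : 'M[R]_(s, N e')))
  end.

Definition defect e (K : 'M[R]_(N e)) (G : 'M[R]_(s, N e)) : R := \tr K - \tr (nys K G).

Fixpoint good (c : R) e : set 'rV[R]_(glen e) :=
  match e with
  | 0 => setT
  | e'.+1 => [set v | good c (lsubmx v) /\
      defect (chainK (lsubmx v)) (vec_mx (rsubmx v) : 'M[R]_(s, N e')) <= c]
  end.

Definition is_gram n (K : 'M[R]_n) := exists m (M : 'M[R]_(n, m)), K = M *m M^T.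

Definition loewner_le n (K L : 'M[R]_n) :=
  forall v : 'rV[R]_n, \tr (v *m K *m v^T) <= \tr (v *m L *m v^T).

Lemma loewner_tr n q (K L : 'M[R]_n) (A : 'M[R]_(q, n)) : loewner_le K L ->
  \tr (A *m K *m A^T) <= \tr (A *m L *m A^T).
Proof.
move=> KL; have H (X : 'M[R]_n) : \tr (A *m X *m A^T) = \sum_i \tr (row i A *m X *m (row i A)^T).
  apply: eq_bigr => i _; rewrite [RHS]big_ord1 !mxE.
  by apply: eq_bigr => j _; rewrite -row_mul !mxE.
by rewrite !H; apply: ler_sum => i _; exact: KL.
Qed.

Lemma nys_gram n (K : 'M[R]_n) (G : 'M[R]_(s, n)) : is_gram K -> is_gram (nys K G).
Proof.
move=> [m [M ->]]; have [q [Q [QQ QB]]] := orth_basis (G *m M).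
exists q, (M *m Q^T); rewrite (nysE QQ QB) trmx_mul trmxK.
by rewrite !mulmxA.
Qed.

Lemma nys_loewner n (K : 'M[R]_n) (G : 'M[R]_(s, n)) : is_gram K -> loewner_le (nys K G) K.
Proof.
move=> [m [M ->]] v; have [q [Q [QQ QB]]] := orth_basis (G *m M).
rewrite (nysE QQ QB) -subr_ge0.
have -> : v *m (M *m Q^T *m Q *m M^T) *m v^T = (v *m M) *m Q^T *m Q *m (v *m M)^T.
  by rewrite trmx_mul !mulmxA.
have -> : v *m (M *m M^T) *m v^T = (v *m M) *m (v *m M)^T by rewrite trmx_mul !mulmxA.
by rewrite (gram_defect _ QQ) sqn_ge0.
Qed.

Lemma loewner_trans n (K L M : 'M[R]_n) : loewner_le K L -> loewner_le L M -> loewner_le K M.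
Proof. by move=> KL LM v; exact: le_trans (KL v) (LM v). Qed.

Hypothesis K0_gram : is_gram K0.
Hypothesis pt_gram : forall e (K : 'M[R]_(N e)), is_gram K -> is_gram (pt K).
Hypothesis pt_mono : forall e (K L : 'M[R]_(N e)), loewner_le K L -> loewner_le (pt K) (pt L).
Hypothesis pt_meas : forall e, measurable_fun setT (@pt e).

Lemma chainK_gram e (v : 'rV[R]_(glen e)) : is_gram (chainK v).
Proof. by elim: e v => [//|e IH] v; apply: pt_gram; apply: nys_gram; exact: IH. Qed.

Lemma measurable_chainK e : measurable_fun setT (@chainK e).
Proof.
elim: e => [|e IH]; first exact: measurable_cst.
have [ml mr] := @measurable_submx _ _ _ 1 (glen e) (s * N e) _ (@measurable_id _ 'rV[R]_(glen e + s * N e) setT).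
apply: (measurableT_comp (@pt_meas e)); apply: measurable_nys.
- by move=> v; exact: chainK_gram.
- exact: (measurableT_comp IH ml).
- exact: (measurableT_comp (@measurable_vec_mx _ _ _) mr).
Qed.

Lemma measurable_defect d (T : measurableType d) e (K : T -> 'M[R]_(N e)) (G : T -> 'M[R]_(s, N e)) :
  (forall t, is_gram (K t)) -> measurable_fun setT K -> measurable_fun setT G ->
  measurable_fun setT (fun t => defect (K t) (G t) : measurableTypeR R).
Proof.
move=> gK mK mG; apply: measurable_funB; apply: measurable_sum => i;
  apply: (measurableT_comp (measurable_coef i i)) => //.
exact: measurable_nys.
Qed.

Lemma measurable_le d (T : measurableType d) (f : T -> measurableTypeR R) (c : R) :
  measurable_fun setT f -> measurable [set t | f t <= c].
Proof.
move=> mf; rewrite (_ : [set _ | _] = setT `&` f @^-1` `]-oo, c]%classic).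
  by apply: mf => //; exact: measurable_itv.
by rewrite setTI; apply/seteqP; split => t /=; rewrite in_itv.
Qed.

Lemma measurable_good c e : measurable (@good c e).
Proof.
elim: e => [|e IH]; first exact: measurableT.
have [ml mr] := @measurable_submx _ _ _ 1 (glen e) (s * N e) _ (@measurable_id _ 'rV[R]_(glen e + s * N e) setT).
apply: measurableI; first by rewrite -[X in measurable X]setTI; exact: ml.
apply: measurable_le; apply: measurable_defect.
- by move=> v; exact: chainK_gram.
- exact: (measurableT_comp (@measurable_chainK e) ml).
- exact: (measurableT_comp (@measurable_vec_mx _ _ _) mr).
Qed.

Section probability.
Variables (c del : R) (Lref : forall e, 'M[R]_(N e)) (n : nat).
Hypothesis del1 : 0 <= del.
Hypothesis Lref0 : loewner_le K0 (Lref 0).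
Hypothesis LrefS : forall e, Lref e.+1 = pt (Lref e).
Hypothesis step : forall e, (e < n)%N -> forall m (M : 'M[R]_(N e, m)),
  loewner_le (M *m M^T) (Lref e) ->
  (del%:E <= gauss R s (N e) [set G | defect (M *m M^T) G <= c]%R)%E.

Lemma chainK_loewner e (v : 'rV[R]_(glen e)) : loewner_le (chainK v) (Lref e).
Proof.
elim: e v => [//|e IH] v; rewrite LrefS; apply: pt_mono.
by apply: loewner_trans (IH _); apply: nys_loewner; exact: chainK_gram.
Qed.

(** Fubini over the last block. On a good past l the inner integral is the probability of one step
    at [chainK l], a matrix of which only the domination by [Lref] is known; this is why [step] is
    uniform over such matrices. *)
Lemma good_prob e : (e <= n)%N -> ((del ^+ e)%:E <= gauss R 1 (glen e) (@good c e))%E.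
Proof.
elim: e => [|e IH] en.
  by rewrite expr0 /= probability_setT.
have mg := @measurable_good c e.+1; have mge := @measurable_good c e.
have -> : (gauss R 1 (glen e.+1) (@good c e.+1) =
    \int[gauss R 1 (glen e + s * N e)]_v (\1_(@good c e.+1) v)%:E)%E.
  by rewrite integral_indic// setIT.
have m1 : measurable_fun setT (fun v => (\1_(@good c e.+1) v)%:E : \bar R).
  by apply/measurable_EFinP; exact: measurable_indic.
rewrite gauss_row_mx; [|exact: m1|by move=> v; rewrite lee_fin].
apply: (@le_trans _ _ (\int[gauss R 1 (glen e)]_l (del%:E * (\1_(@good c e) l)%:E))%E).
  rewrite ge0_integralZl; last 4 first.
  - by [].
  - by apply/measurable_EFinP; exact: measurable_indic.
  - by move=> l _; rewrite lee_fin.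
  - by rewrite lee_fin.
  rewrite integral_indic// setIT exprS EFinM lee_wpmul2l ?lee_fin//.
  by apply: IH; exact: ltnW.
apply: ge0_le_integral.
- by [].
- by move=> l _; rewrite mule_ge0// lee_fin.
- by apply: emeasurable_funM => //; apply/measurable_EFinP; exact: measurable_indic.
- apply: (measurable_fun_fubini_tonelli_F (fun q : 'rV[R]_(glen e) * 'rV[R]_(s * N e) =>
    (\1_(@good c e.+1) (row_mx q.1 q.2))%:E)).
  + exact: (measurableT_comp m1 (measurable_row_mx measurable_fst measurable_snd)).
  + by move=> q; rewrite lee_fin.
move=> l _.
have [gl|gl] := pselect (good c l); last first.
  rewrite [X in (_ * X)%E](_ : _ = 0%E); last by rewrite indicE memNset.
  by rewrite mule0; apply: integral_ge0 => r _; rewrite lee_fin.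
rewrite indicE mem_set// mule1.
set D := [set G : 'M[R]_(s, N e) | defect (chainK l) G <= c].
have mD : measurable D.
  apply: measurable_le; apply: measurable_defect => //.
  by move=> _; exact: chainK_gram.
have -> : (\int[gauss R 1 (s * N e)]_r (\1_(@good c e.+1) (row_mx l r))%:E =
    gauss R s (N e) D)%E.
  rewrite -gauss_vec//.
  have mV : measurable (@vec_mx R s (N e) @^-1` D).
    by rewrite -[X in measurable X]setTI; exact: measurable_vec_mx.
  have -> : (gauss R 1 (s * N e) (@vec_mx R s (N e) @^-1` D) =
      \int[gauss R 1 (s * N e)]_r (\1_(@vec_mx R s (N e) @^-1` D) r)%:E)%E.
    by rewrite integral_indic// setIT.
  apply: eq_integral => r _.
  rewrite !indicE; congr ((nat_of_bool _)%:R%:E); apply/idP/idP; rewrite !inE/= row_mxKl row_mxKr.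
    by move=> [].
  by move=> H; split.
have [m [M KM]] := chainK_gram l; rewrite /D KM; apply: step => //.
by rewrite -KM; exact: chainK_loewner.
Qed.



End probability.
End chain.

(** * Tensors and runs of the algorithm *)

Section index_sums.
Context (R : realType).

Lemma indices_cons_sum m sh (F : seq nat -> R) :
  \sum_(i <- indices (m :: sh)) F i = \sum_(a < m) \sum_(t <- indices sh) F ((a : nat) :: t).
Proof.
rewrite [indices _]/= big_allpairs_dep -[in iota 0 m](subn0 m).
by rewrite -/(index_iota 0 m) big_mkord.
Qed.

Lemma indices_cat_sum sh1 sh2 (F : seq nat -> R) :
  \sum_(i <- indices (sh1 ++ sh2)) F i =
  \sum_(a <- indices sh1) \sum_(b <- indices sh2) F (a ++ b).
Proof.
elim: sh1 F => [|m sh IH] F; first by rewrite big_seq1.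
rewrite cat_cons !indices_cons_sum; apply: eq_bigr => a _.
by rewrite (IH (fun i => F ((a : nat) :: i))).
Qed.

Lemma indices_rcons_sum sh m (F : seq nat -> R) :
  \sum_(i <- indices (rcons sh m)) F i = \sum_(a <- indices sh) \sum_(b < m) F (rcons a b).
Proof.
rewrite -cats1 indices_cat_sum; apply: eq_bigr => a _.
rewrite indices_cons_sum; apply: eq_bigr => b _.
by rewrite big_seq1 cats1.
Qed.

Lemma sum_indices_ord (I : seq (seq nat)) (F : seq nat -> R) :
  \sum_(a <- I) F a = \sum_(a < size I) F (nth [::] I a).
Proof. by rewrite (big_nth [::]) big_mkord. Qed.

Lemma sum_divmod m q (F : nat -> nat -> R) :
  \sum_(c < m * q) F (c %/ q)%N (c %% q)%N = \sum_(i < m) \sum_(c < q) F i c.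
Proof.
elim: m => [|m IH]; first by rewrite big_ord0 big_ord0.
rewrite mulSnr big_split_ord/= big_ord_recr/= IH; congr (_ + _).
apply: eq_bigr => c _; have q0 : (0 < q)%N by exact: leq_ltn_trans (ltn_ord c).
by rewrite divnMDl// divn_small// addn0 modnMDl modn_small.
Qed.

Lemma mem_indices_rcons sh m a (i : 'I_m) : a \in indices sh -> rcons a i \in indices (rcons sh m).
Proof.
elim: sh a => [|k sh IH] a.
  rewrite inE => /eqP ->; apply: (@allpairs_f _ _ _ cons); last by rewrite inE.
  by rewrite mem_iota/=.
case/allpairsP => -[j t]/= [jk tsh ->]; rewrite rcons_cons.
by apply: (@allpairs_f _ _ _ cons) => //; exact: IH.
Qed.

Lemma indices_uniq sh : uniq (indices sh).
Proof.
elim: sh => //= m sh IH; apply: allpairs_uniq => //; first exact: iota_uniq.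
by move=> [a b] [a' b'] _ _ /= [-> ->].
Qed.

End index_sums.

(** * Moving a mode from the rows to the columns *)

Section partial_trace.
Context (R : realType).
Variables (I J : seq (seq nat)) (m : nat).

(* Selects the rows of [I] ending in [i]. *)
Definition selmx (i : nat) : 'M[R]_(size J, size I) :=
  \matrix_(a, b) (index (rcons (nth [::] J a) i) I == b)%:R.

(** A sum of congruences S K S^T, a form that visibly preserves Gram matrices and the Loewner
    order. *)
Definition ptrace (K : 'M[R]_(size I)) : 'M[R]_(size J) :=
  \sum_(i < m) selmx i *m K *m (selmx i)^T.

Lemma is_gramD n (K L : 'M[R]_n) : is_gram K -> is_gram L -> is_gram (K + L).
Proof.
move=> [k [A ->]] [l [B ->]]; exists (k + l)%N, (row_mx A B).
by rewrite tr_row_mx mul_row_col.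
Qed.

Lemma ptrace_gram K : is_gram K -> is_gram (ptrace K).
Proof.
move=> [k [A ->]]; rewrite /ptrace; apply: (big_ind (@is_gram R (size J))).
- by exists 0%N, 0; rewrite mul0mx.
- exact: is_gramD.
- by move=> i _; exists k, (selmx i *m A); rewrite trmx_mul !mulmxA.
Qed.

Lemma ptrace_mono K L : loewner_le K L -> loewner_le (ptrace K) (ptrace L).
Proof.
move=> KL v; have H X : \tr (v *m ptrace X *m v^T) =
    \sum_(i < m) \tr (v *m selmx i *m X *m (v *m selmx i)^T).
  rewrite /ptrace mulmx_sumr mulmx_suml raddf_sum/=; apply: eq_bigr => i _.
  by rewrite trmx_mul !mulmxA.
by rewrite !H; apply: ler_sum => i _; exact: KL.
Qed.

Lemma measurable_ptrace : measurable_fun setT ptrace.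
Proof.
apply: measurable_fun_mxP => a b.
rewrite (_ : (fun K => _) = (fun K => \sum_(i < m) (selmx i *m K *m (selmx i)^T) a b)); last first.
  by apply/funext => K; rewrite /ptrace summxE.
apply: measurable_sum => i; apply: (measurableT_comp (measurable_coef a b)).
apply: measurable_mulmx => //; apply: measurable_mulmx => //; exact: measurable_id.
Qed.

Definition tabmx c (h : seq nat -> nat -> R) (I : seq (seq nat)) : 'M[R]_(size I, c) :=
  \matrix_(a, l) h (nth [::] I a) l.

Hypothesis IJ : forall b i, b \in J -> (i < m)%N -> rcons b i \in I.

Lemma selmx_tabmx c (h : seq nat -> nat -> R) (i : 'I_m) :
  selmx i *m tabmx c h I = tabmx c (fun b l => h (rcons b i) l) J.
Proof.
apply/matrixP => a l; rewrite !mxE.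
have bI : rcons (nth [::] J a) i \in I by apply: IJ => //; exact: mem_nth.
have iI := bI; rewrite -index_mem in iI.
rewrite (bigD1 (Ordinal iI))//= big1 ?addr0 => [|b bi]; last first.
  rewrite mxE (_ : (_ == _) = false) ?mul0r//; apply: contraNF bi => /eqP ib.
  by apply/eqP/val_inj; rewrite /= ib.
by rewrite !mxE eqxx mul1r nth_index.
Qed.

(** The mode taken out of the row index becomes the leading digit of the column index, as in
    [Mhat1]. *)
Lemma ptrace_tabmx c (h : seq nat -> nat -> R) :
  ptrace (tabmx c h I *m (tabmx c h I)^T) =
  let A := tabmx (m * c) (fun b l => h (rcons b (l %/ c)%N) (l %% c)%N) J in A *m A^T.
Proof.
rewrite /ptrace /=; apply/matrixP => a b.
rewrite summxE [RHS]mxE.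
under [RHS]eq_bigr do rewrite !mxE.
rewrite (sum_divmod m c (fun i l => h (rcons (nth [::] J a) i) l * h (rcons (nth [::] J b) i) l)).
apply: eq_bigr => i _.
rewrite mulmxA -mulmxA -trmx_mul selmx_tabmx mxE.
by apply: eq_bigr => l _; rewrite !mxE.
Qed.

Lemma tr_tabmx c (h : seq nat -> nat -> R) K :
  \tr (tabmx c h K *m (tabmx c h K)^T) = \sum_(a <- K) \sum_(l < c) h a l ^+ 2.
Proof.
rewrite -sqn_trmul sum_indices_ord; apply: eq_bigr => a _.
by apply: eq_bigr => l _; rewrite mxE.
Qed.

End partial_trace.

(** * The error formula for a valid run *)

Section tails.
Context (R : realType) (n : nat -> nat) (D s : nat) (x : seq nat -> R).
Variables (g : nat -> nat -> seq nat -> R) (q : nat -> nat).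
Variable Q : forall j : nat, 'M[R]_(q j.-1, n j * q j).
Let d := D.+2.
Hypothesis run : valid_run d s x g Q.

Let qd : q d = 1%N. Proof. by have [] := run. Qed.

Let QQ e : (e <= D)%N -> Q (d - e) *m (Q (d - e))^T = 1%:M.
Proof.
move=> eD; have [_ H] := run; have [] // := H (d - e)%N.
  by rewrite ltn_subRL addn1 !ltnS.
exact: leq_subr.
Qed.

Lemma mxgetE m k (A : 'M[R]_(m, k)) i j : mxget A (val i) (val j) = A i j.
Proof. by rewrite /mxget !valK. Qed.

(* With [j = d - e]: the entries of [W_(j+1) o ... o W_d]. *)
Fixpoint tail (e a : nat) (tau : seq nat) : R :=
  if e is e'.+1 then
    \sum_(c < q (d - e')) Wcore Q (d - e') a (head 0%N tau) c * tail e' c (behead tau)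
  else (a == 0%N)%:R.

Lemma dims_cons (f : nat -> nat) a k : dims f a k.+1 = f a :: dims f a.+1 k.
Proof. by []. Qed.

Lemma orthonormal_expand (T : seq (seq nat)) m (f : nat -> seq nat -> R) (u v : 'I_m -> R) :
  (forall a b : 'I_m, \sum_(t <- T) f a t * f b t = (a == b)%:R) ->
  \sum_(t <- T) (\sum_c u c * f c t) * (\sum_c v c * f c t) = \sum_c u c * v c.
Proof.
move=> fO; under eq_bigr do rewrite big_distrlr/=.
rewrite exchange_big/=; apply: eq_bigr => a _; rewrite exchange_big/=.
rewrite (bigD1 a)//= [X in _ + X]big1 ?addr0 => [|b ba].
  transitivity (u a * v a * \sum_(t <- T) f a t * f a t).
    by rewrite mulr_sumr; apply: eq_bigr => t _; ring.
  by rewrite fO eqxx mulr1.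
transitivity (u a * v b * \sum_(t <- T) f a t * f b t).
  by rewrite mulr_sumr; apply: eq_bigr => t _; ring.
by rewrite fO eq_sym (negbTE ba) mulr0.
Qed.

Lemma Wcore_orth e (a b : 'I_(q (d - e).-1)) : (e <= D)%N ->
  \sum_(i < n (d - e)) \sum_(c < q (d - e))
     Wcore Q (d - e) a i c * Wcore Q (d - e) b i c = (a == b)%:R.
Proof.
move=> eD; have /matrixP/(_ a b) := QQ eD; rewrite !mxE => <-.
rewrite -(sum_divmod _ _ (fun i c => Wcore Q (d - e) a i c * Wcore Q (d - e) b i c)).
apply: eq_bigr => c _; rewrite mxE /Wcore -divn_eq.
by rewrite -[nat_of_ord a]/(val a) -[nat_of_ord b]/(val b) -[nat_of_ord c]/(val c) !mxgetE.
Qed.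

(** Parseval for the shorter tail, then orthonormality of the next core. At e = 0 the convention q d
    = 1 leaves a single index. *)
Lemma tail_orth e : (e <= D.+1)%N -> forall a b : 'I_(q (d - e)),
  \sum_(t <- indices (dims n (d - e).+1 e)) tail e a t * tail e b t = (a == b)%:R.
Proof.
elim: e => [|e IH] eD a b.
  rewrite big_seq1 /= ; case: a b => a ha [b hb] /=; rewrite -val_eqE/=.
  by move: ha hb; rewrite subn0 qd !ltnS !leqn0 => /eqP -> /eqP ->; rewrite mulr1.
have ed : (e < d)%N by rewrite ltnS ltnW.
rewrite subnSK// dims_cons indices_cons_sum.
transitivity (\sum_(i < n (d - e)) \sum_(c < q (d - e))
     Wcore Q (d - e) a i c * Wcore Q (d - e) b i c).
  apply: eq_bigr => i _ /=.
  by apply: orthonormal_expand; apply: IH; exact: ltnW.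
move: a b; rewrite subnS => a b; exact: Wcore_orth.
Qed.

(** So the entries of b_j are the coefficients of the slices of x on the system [tail]. *)
Lemma bt_tail e (al : seq nat) (a : nat) : (e <= d)%N ->
  bt d x Q e al a = \sum_(t <- indices (dims n (d - e).+1 e)) x (al ++ t) * tail e a t.
Proof.
elim: e al a => [|e IH] al a ed.
  by rewrite big_seq1 cats0 /=; case: (a == 0%N); rewrite ?mulr1 ?mulr0.
rewrite subnSK// dims_cons indices_cons_sum.
rewrite -[LHS]/(\sum_(i < n (d - e)) \sum_(c < q (d - e))
  bt d x Q e (rcons al i) c * Wcore Q (d - e) a i c).
apply: eq_bigr => i _.
under eq_bigr do rewrite IH ?(ltnW ed)// mulr_suml.
rewrite exchange_big/=; apply: eq_bigr => t _.
rewrite mulr_sumr; apply: eq_bigr => c _.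
by rewrite cat_rcons; ring.
Qed.

Lemma tail_prod e a t : (e.+1 <= d)%N ->
  tail e.+1 a t = \sum_(c <- indices (dims q (d - e.+1).+1 e))
    \prod_(l < e.+1) Wcore Q (d - e.+1 + 1 + l) (nth 0%N (a :: c) l) (nth 0%N t l) (nth 0%N (a :: c) l.+1).
Proof.
elim: e a t => [|e IH] a t ed.
  rewrite big_seq1 big_ord_recl big_ord0 mulr1 addn0 subnK//= subn0 nth0.
  by rewrite qd big_ord_recl big_ord0 addr0 eqxx mulr1.
rewrite subnSK// dims_cons indices_cons_sum -[LHS]/(\sum_(c < q (d - e.+1))
   Wcore Q (d - e.+1) a (head 0%N t) c * tail e.+1 c (behead t)).
apply: eq_bigr => c _; rewrite IH ?(ltnW ed)// mulr_sumr; apply: eq_bigr => c' _.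
rewrite [RHS]big_ord_recl; congr (_ * _).
  by rewrite /= addn0 addn1 subnSK// nth0.
apply: eq_bigr => l _; rewrite nth_behead; congr (Wcore Q _ _ _ _).
by rewrite lift0 -(subnSK ed) !addn1 !addSn addnS.
Qed.

Lemma ttsvd_outE i t : ttsvd_out d x Q (i :: t) =
  \sum_(a < q 1) bten d x Q 2 [:: i] a * tail D.+1 a t.
Proof.
rewrite /ttsvd_out dims_cons indices_cons_sum; apply: eq_bigr => a _.
rewrite tail_prod// mulr_sumr.
have -> : (d - D.+1 = 1)%N by rewrite /d subSS subSnn.
apply: eq_bigr => c _; congr (_ * _).
rewrite -[iota 2 _]/(iota (2 + 0) D.+1) iotaDl big_map -[iota 0 _]/(index_iota 0 D.+1) big_mkord.
by apply: eq_bigr => l _; rewrite addKn.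
Qed.

Lemma sum_sqr_expand (T : seq (seq nat)) m (f : seq nat -> R) (h : nat -> seq nat -> R) :
  (forall a b : 'I_m, \sum_(t <- T) h a t * h b t = (a == b)%:R) ->
  let c a := \sum_(t <- T) f t * h a t in
  \sum_(t <- T) (f t - \sum_(a < m) c a * h a t) ^+ 2 =
  \sum_(t <- T) f t ^+ 2 - \sum_(a < m) c a ^+ 2.
Proof.
move=> hO c; have cE a : c a = \sum_(t <- T) f t * h a t by [].
clearbody c.
transitivity (\sum_(t <- T) (f t ^+ 2 - 2 * (f t * \sum_(a < m) c a * h a t)
    + (\sum_(a < m) c a * h a t) * (\sum_(a < m) c a * h a t))).
  by apply: eq_bigr => t _; ring.
rewrite big_split/= (orthonormal_expand _ _ hO) big_split/= -addrA; congr (_ + _).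
rewrite sumrN -mulr_sumr.
have -> : \sum_(t <- T) f t * (\sum_(a < m) c a * h a t) = \sum_(a < m) c a ^+ 2.
  under eq_bigr do rewrite mulr_sumr.
  rewrite exchange_big/=; apply: eq_bigr => a _; rewrite expr2 {3}cE mulr_sumr.
  by apply: eq_bigr => t _; ring.
under [X in _ + X]eq_bigr do rewrite -expr2.
by ring.
Qed.

(** For each value of the first index the output is the orthogonal projection of that slice of x
    onto the span of [tail D.+1]; the squared distances are Bessel defects. *)
Lemma ttsvd_error :
  tnorm (dims n 1 d) (fun i => x i - ttsvd_out d x Q i) ^+ 2 =
  \sum_(i <- indices (dims n 1 d)) x i ^+ 2 -
  \sum_(i <- indices (dims n 1 1)) \sum_(a < q 1) bt d x Q D.+1 i a ^+ 2.
Proof.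
rewrite /tnorm sqr_sqrtr; last by rewrite sumr_ge0// => i _; exact: sqr_ge0.
rewrite -[X in dims n 1 X]/(D.+1.+1) !dims_cons !indices_cons_sum -sumrB; apply: eq_bigr => i _.
rewrite big_seq1.
under eq_bigr do rewrite ttsvd_outE.
have d1 : (d - D.+1 = 1)%N by rewrite /d subSS subSnn.
have := @tail_orth D.+1 (leqnn _); rewrite d1 => tO.
have bE a : bt d x Q D.+1 [:: (i : nat)] a =
    \sum_(t <- indices (dims n 2 D.+1)) x ((i : nat) :: t) * tail D.+1 a t.
  by rewrite bt_tail// d1.
have bE2 : bten d x Q 2 = bt d x Q D.+1 by rewrite /bten /d !subSS subn0.
rewrite bE2; under eq_bigr do under eq_bigr do rewrite bE.
under [X in _ = _ - X]eq_bigr do rewrite bE.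
exact: (sum_sqr_expand (fun t => x ((i : nat) :: t)) tO).
Qed.

End tails.

Lemma dims_rcons (f : nat -> nat) a k : dims f a k.+1 = rcons (dims f a k) (f (a + k)%N).
Proof. by rewrite /dims -addn1 iotaD map_cat cats1. Qed.

(** * The chain attached to a run *)

Section tt_chain.
Context (R : realType) (n : nat -> nat) (D s : nat) (x : seq nat -> R).
Let d := D.+2.

(* Step [e] of the chain is step [j = d - e] of the algorithm. *)
Definition rowidx e : seq (seq nat) := indices (dims n 1 (d - e).-1).

Definition ttN e := size (rowidx e).

(** Built from x alone, without the trailing mode of size 1 that [bt] carries; [ttchain_run]
    reconciles the two through q d = 1. *)
Definition ttK0 : 'M[R]_(ttN 0) :=
  let A := tabmx (n d) (fun a i => x (rcons a i)) (rowidx 0) in A *m A^T.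

Definition ttpt e : 'M[R]_(ttN e) -> 'M[R]_(ttN e.+1) :=
  @ptrace R (rowidx e) (rowidx e.+1) (n (d - e.+1)).

Definition ttG (g : nat -> nat -> seq nat -> R) e : 'M[R]_(s, ttN e) :=
  \matrix_(k, a) g (d - e)%N k (nth [::] (rowidx e) a).

Fixpoint ttvec (g : nat -> nat -> seq nat -> R) e : 'rV[R]_(glen s ttN e) :=
  if e is e'.+1 then row_mx (ttvec g e') (mxvec (ttG g e')) else 0.

Definition ttchain e := @chainK R s ttN ttK0 ttpt e.

Lemma ttchain_gvecS g e :
  @ttchain e.+1 (ttvec g e.+1) = ttpt (nys (ttchain (ttvec g e)) (ttG g e)).
Proof. by rewrite /ttchain /= row_mxKl row_mxKr mxvecK. Qed.

Lemma rowidx_rcons e : (e < D.+1)%N ->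
  dims n 1 (d - e).-1 = rcons (dims n 1 (d - e.+1).-1) (n (d - e.+1)).
Proof.
move=> eD; have k0 : (0 < d - e.+1)%N by rewrite subn_gt0.
by rewrite -subnS -[in LHS](prednK k0) dims_rcons add1n prednK.
Qed.

Lemma rowidx_mem e b i : (e < D.+1)%N ->
  b \in rowidx e.+1 -> (i < n (d - e.+1))%N -> rcons b i \in rowidx e.
Proof.
move=> eD bI iN; rewrite /rowidx rowidx_rcons//.
exact: (@mem_indices_rcons _ _ b (Ordinal iN)).
Qed.

Section run.
Variables (g : nat -> nat -> seq nat -> R) (q : nat -> nat).
Variable Q : forall j : nat, 'M[R]_(q j.-1, n j * q j).
Hypothesis run : valid_run d s x g Q.

Let qd : q d = 1%N. Proof. by have [] := run. Qed.

Let QQ e : (e <= D)%N -> Q (d - e) *m (Q (d - e))^T = 1%:M /\ (Q (d - e) == Mhat1 d s x g Q (d - e))%MS.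
Proof.
move=> eD; have [_ H] := run; apply: H; last exact: leq_subr.
by rewrite ltn_subRL addn1 !ltnS.
Qed.

Definition runM e : 'M[R]_(ttN e, n (d - e) * q (d - e)) :=
  tabmx _ (fun a l => bt d x Q e (rcons a (l %/ q (d - e))%N) (l %% q (d - e))%N) (rowidx e).

Lemma Mhat1E e : (e <= D)%N -> Mhat1 d s x g Q (d - e) = ttG g e *m runM e.
Proof.
move=> eD; apply/matrixP => k l; rewrite !mxE /aten -/(rowidx e) sum_indices_ord.
apply: eq_bigr => a _; rewrite !mxE /bten subSS subKn//.
by rewrite leqW// leqW.
Qed.

Lemma runMQ e : (e <= D)%N ->
  runM e *m (Q (d - e))^T = tabmx (q (d - e).-1) (bt d x Q e.+1) (rowidx e).
Proof.
move=> eD; apply/matrixP => a b; rewrite !mxE.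
rewrite -[RHS]/(\sum_(i < n (d - e)) \sum_(c < q (d - e))
  bt d x Q e (rcons (nth [::] (rowidx e) a) i) c * Wcore Q (d - e) b i c).
rewrite -(sum_divmod _ _ (fun i c => bt d x Q e (rcons (nth [::] (rowidx e) a) i) c * Wcore Q (d - e) b i c)).
apply: eq_bigr => l _; rewrite !mxE /Wcore -divn_eq.
by rewrite -[nat_of_ord b]/(val b) -[X in mxget _ _ X]/(val l) mxgetE.
Qed.

Lemma nys_run e : (e <= D)%N ->
  nys (runM e *m (runM e)^T) (ttG g e) =
  let A := tabmx (q (d - e).-1) (bt d x Q e.+1) (rowidx e) in A *m A^T.
Proof.
move=> eD; have [oQ QM] := QQ eD; rewrite Mhat1E// in QM.
by rewrite (nysE oQ QM) /= -runMQ// trmx_mul trmxK !mulmxA.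
Qed.

(** The left side involves neither q nor Q, so all valid runs on the same draws share these Gram
    matrices. *)
Lemma ttchain_run e : (e <= D)%N -> ttchain (ttvec g e) = runM e *m (runM e)^T.
Proof.
elim: e => [|e IH] eD.
  apply/matrixP => a b; rewrite !mxE.
  under [RHS]eq_bigr do rewrite !mxE.
  rewrite (sum_divmod _ _ (fun i c => bt d x Q 0 (rcons (nth [::] (rowidx 0) a) i) c *
     bt d x Q 0 (rcons (nth [::] (rowidx 0) b) i) c)).
  apply: eq_bigr => i _; rewrite !mxE (_ : q (d - 0) = 1%N)//.
  by rewrite big_ord_recl big_ord0 addr0.
rewrite ttchain_gvecS IH ?(ltnW eD)// nys_run ?(ltnW eD)// /ttpt ptrace_tabmx; last first.
  by move=> b i; apply: rowidx_mem; exact: ltnW.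
by rewrite /runM -subnS.
Qed.

Lemma tr_ttchain0 : \tr ttK0 = \sum_(i <- indices (dims n 1 d)) x i ^+ 2.
Proof.
rewrite /ttK0; cbv zeta; rewrite tr_tabmx /rowidx subn0.
have -> : dims n 1 d = rcons (dims n 1 D.+1) (n d) by rewrite /d dims_rcons add1n.
by rewrite indices_rcons_sum.
Qed.

Lemma ttsvd_error_tr :
  tnorm (dims n 1 d) (fun i => x i - ttsvd_out d x Q i) ^+ 2 =
  \tr ttK0 - \tr (nys (ttchain (ttvec g D)) (ttG g D)).
Proof.
rewrite (ttsvd_error run) tr_ttchain0 ttchain_run// nys_run//; cbv zeta; congr (_ - _).
rewrite tr_tabmx /rowidx.
have -> : (d - D = 2)%N by rewrite /d subSn ?leqW// subSn// subnn.
by [].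
Qed.

End run.
End tt_chain.

(** * The law of the stored draws *)

Section iid_law.
Context (R : realType) (dT : measure_display) (T : measurableType dT) (P : probability T R).

(** Indices outside the image of [idx] receive the whole line, of probability 1; injectivity makes
    the box well defined on the others. *)
Lemma iid_gauss_law (I : eqType) (S : seq I) (X : I -> T -> R) L (idx : 'I_L -> I) :
  iid_std_gaussian P S X -> injective idx -> (forall k, idx k \in S) ->
  let V w := \row_k X (idx k) w in
  measurable_fun setT V /\
  forall A, measurable A -> P (V @^-1` A) = gauss R 1 L A.
Proof.
move=> [uS [mX XB]] idxI idxS V.
have mV : measurable_fun setT V.
  apply: measurable_fun_mxP => i j; rewrite (_ : (fun w => _) = X (idx j)); first exact: mX.
  by apply/funext => w; rewrite mxE.
split=> //; apply: gauss_law => // B mB.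
pose B' i : set R := if [pick k | idx k == i] is Some k then B ord0 k else setT.
have mB' i : measurable (B' i) by rewrite /B'; case: pickP => [k _|_]; [exact: mB|exact: measurableT].
have B'E k : B' (idx k) = B ord0 k.
  by rewrite /B'; case: pickP => [l /eqP/idxI ->//|/(_ k)]; rewrite eqxx.
rewrite big_ord1 (_ : _ @^-1` _ = \bigcap_(i in [set i | i \in S]) (X i @^-1` B' i)); last first.
  apply/seteqP; split => w /=.
    move=> H i /= iS; rewrite /B'; case: pickP => [k /eqP <-|//].
    by have := H ord0 k; rewrite mxE.
  by move=> H i k; rewrite (ord1 i) mxE -B'E; apply: H => /=; exact: idxS.
rewrite XB//; congr EFin.
rewrite (bigID (mem (codom idx)))/= [X in _ * X]big1 ?mulr1; last first.
  move=> i ic; rewrite /B'; case: pickP => [k /eqP ki|_]; first by rewrite -ki codom_f in ic.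
  by rewrite probability_setT.
rewrite -big_filter (perm_big (codom idx)).
  by rewrite big_image/=; apply: eq_bigr => k _; rewrite B'E.
apply: uniq_perm; [exact: filter_uniq|by rewrite map_inj_uniq// enum_uniq|].
move=> i; rewrite mem_filter /=; apply: andb_idr => /codomP[k ->]; exact: idxS.
Qed.

End iid_law.

Section tt_index.
Context (R : realType) (n : nat -> nat) (D s : nat).
Let d := D.+2.
Local Notation N := (ttN n D).

(* Position in the row vector to index of the Gaussian entry; the value for [e = 0]
   is junk on an empty type. *)
Fixpoint ttidx e : 'I_(glen s N e) -> nat * nat * seq nat :=
  match e with
  | 0 => fun=> (0%N, 0%N, [::])
  | e'.+1 => fun i =>
    match fintype.split i with
    | inl l => ttidx l
    | inr k => let p := enum_val (cast_ord (esym (mxvec_cast s (N e'))) k) in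
               ((d - e')%N, val p.1, nth [::] (rowidx n D e') p.2)
    end
  end.

Lemma ttvecE (g : nat * nat * seq nat -> R) e :
  ttvec n D s (fun j k al => g (j, k, al)) e = \row_k g (ttidx k).
Proof.
elim: e => [|e IH]; first by apply/rowP => -[].
rewrite [LHS]/= IH; apply/rowP => i; rewrite !mxE/=.
case: fintype.splitP => k _; rewrite ?mxE//.
by case/mxvec_indexP: k => a b; rewrite mxvecE mxE /mxvec_index cast_ordK enum_rankK.
Qed.

(** The first component is the step number j, and the next block has j = d - e; hence blocks do not
    collide in [ttidx_inj]. *)
Lemma ttidx_gt e (i : 'I_(glen s N e)) : (e <= d)%N -> (d - e < (ttidx i).1.1)%N.
Proof.
elim: e i => [[]//|e IH] i ed /=; case: fintype.splitP => k _ /=; last first.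
  by rewrite ltn_sub2l.
by apply: leq_ltn_trans (IH k (ltnW ed)); rewrite leq_sub2l.
Qed.

Lemma ttidx_inj e : (e <= d)%N -> injective (@ttidx e).
Proof.
elim: e => [|e IH] ed; first by move=> [].
move=> i j; rewrite /=.
case: (fintype.splitP i) => a ia; case: (fintype.splitP j) => b jb.
- by move/(IH (ltnW ed)) => ab; apply: val_inj; rewrite /= ia jb ab.
- by move=> ab; have := ttidx_gt a (ltnW ed); rewrite ab /= ltnn.
- by move=> ab; have := ttidx_gt b (ltnW ed); rewrite -ab /= ltnn.
case=> ab1 /eqP; rewrite nth_uniq//; last exact: indices_uniq.
move=> /eqP/val_inj ab2.
apply: val_inj; rewrite /= ia jb; congr (_ + _)%N.
have : enum_val (cast_ord (esym (mxvec_cast s (N e))) a) = enum_val (cast_ord (esym (mxvec_cast s (N e))) b).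
  by rewrite [LHS]surjective_pairing [RHS]surjective_pairing ab2 (val_inj ab1).
by move/enum_val_inj/cast_ord_inj => ->.
Qed.

Lemma ttidx_mem e (i : 'I_(glen s N e)) : (e <= D.+1)%N -> ttidx i \in gauss_index n d s.
Proof.
elim: e i => [[]//|e IH] i ed /=; case: fintype.splitP => k _; first exact: IH (ltnW ed).
apply/flattenP; exists [seq ((d - e)%N, k, alpha) | k <- iota 0 s, alpha <- indices (dims n 1 (d - e).-1)].
  apply/mapP; exists (d - e)%N => //.
  rewrite mem_iota; apply/andP; split; first by rewrite ltn_subRL addn1.
  by rewrite -[(2 + _)%N]/(d.+1) ltnS leq_subr.
apply: (@allpairs_f _ _ _ (fun k alpha => ((d - e)%N, k, alpha))); first by rewrite mem_iota /=.
exact: mem_nth.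
Qed.

End tt_index.

(** * Comparison with a competitor *)

Section projection.
Context (R : realType).

Lemma sqn_proj_contract N k m (U : 'M[R]_(N, k)) (Z : 'M[R]_(N, m)) : U^T *m U = 1%:M ->
  sqn ((1%:M - U *m U^T) *m Z) <= sqn Z.
Proof.
move=> UU; have QQ : U^T *m (U^T)^T = 1%:M by rewrite trmxK.
have := sqn_proj_le Z^T 0 QQ; rewrite mul0mx subr0 trmxK sqn_tr; apply: le_trans.
by rewrite -sqn_tr mulmxBl mul1mx linearB/= !trmx_mul trmxK mulmxA.
Qed.

Lemma column_basis N m (Y : 'M[R]_(N, m)) :
  exists k (U : 'M[R]_(N, k)), [/\ U^T *m U = 1%:M, (k <= \rank Y)%N & U *m U^T *m Y = Y].
Proof.
have [k [Q [QQ /andP[QY /submxP[C YE]]]]] := orth_basis Y^T.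
exists k, Q^T; rewrite trmxK; split=> //.
  rewrite -mxrank_tr; apply: leq_trans (mxrankS QY).
  rewrite -[leqLHS](@mxrank1 R) -QQ; exact: mxrankM_maxl.
by rewrite -[Y]trmxK YE trmx_mul -mulmxA (mulmxA Q) QQ mul1mx.
Qed.

(** The projector A off the span of U kills Y, so A X = A (X - Y). The left side involves M only
    through its Gram matrix, so domination is enough even though M and X may differ in their number
    of columns. *)
Lemma best_rank_defect N k m1 m2 (M : 'M[R]_(N, m1)) (X Y : 'M[R]_(N, m2)) (U : 'M[R]_(N, k)) :
  U^T *m U = 1%:M -> U *m U^T *m Y = Y -> loewner_le (M *m M^T) (X *m X^T) ->
  sqn (M - U *m U^T *m M) <= sqn (X - Y).
Proof.
move=> UU UY MX; set A := 1%:M - U *m U^T.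
have AE m (Z : 'M[R]_(N, m)) : Z - U *m U^T *m Z = A *m Z by rewrite mulmxBl mul1mx.
have sE m (Z : 'M[R]_(N, m)) : sqn (A *m Z) = \tr (A *m (Z *m Z^T) *m A^T).
  by rewrite sqn_trmul trmx_mul !mulmxA.
rewrite AE sE; apply: le_trans (loewner_tr A MX) _; rewrite -sE.
have -> : A *m X = A *m (X - Y) by rewrite mulmxBr -(AE _ Y) UY subrr subr0.
exact: sqn_proj_contract.
Qed.

Lemma tr_ptrace I J m (K : 'M[R]_(size I)) :
  uniq I -> (forall b i, b \in J -> (i < m)%N -> rcons b i \in I) ->
  (forall F : seq nat -> R, \sum_(i <- I) F i = \sum_(a <- J) \sum_(b < m) F (rcons a b)) ->
  is_gram K -> \tr (@ptrace R I J m K) = \tr K.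
Proof.
move=> uI IJ sI [c [M ->]].
(* As I has no repetitions, every matrix with rows indexed by I is the table of a function of
   multi-indices. *)
pose h (al : seq nat) (l : nat) : R := mxget M (index al I) l.
have -> : M = tabmx c h I.
  apply/matrixP => a l; rewrite mxE /h index_uniq//.
  by rewrite -[nat_of_ord a]/(val a) -[nat_of_ord l]/(val l) mxgetE.
rewrite ptrace_tabmx//; cbv zeta; rewrite !tr_tabmx sI; apply: eq_bigr => a _.
by rewrite (sum_divmod _ _ (fun i l => h (rcons a i) l ^+ 2)).
Qed.

End projection.

Section tt_final.
Context (R : realType) (n : nat -> nat) (D s : nat) (x : seq nat -> R).
Let d := D.+2.
Local Notation N := (ttN n D).
Local Notation K0 := (ttK0 n D x).

Lemma ttpt_gram e (K : 'M[R]_(N e)) : is_gram K -> is_gram (ttpt K).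
Proof. exact: ptrace_gram. Qed.

Lemma ttpt_mono e (K L : 'M[R]_(N e)) : loewner_le K L -> loewner_le (ttpt K) (ttpt L).
Proof. exact: ptrace_mono. Qed.

Lemma measurable_ttpt e : measurable_fun setT (@ttpt R n D e).
Proof. exact: measurable_ptrace. Qed.

Lemma ttK0_gram : is_gram K0.
Proof. by exists (n d), (tabmx (n d) (fun a i => x (rcons a i)) (rowidx n D 0)). Qed.

(** The chain with the sketches left out: modes are moved and nothing is lost, so it runs through
    the Gram matrices of the unfoldings of x ([ttrefE]). *)
Fixpoint ttref e : 'M[R]_(N e) := if e is e'.+1 then ttpt (ttref e') else K0.

Definition unfolding (y : seq nat -> R) e : 'M[R]_(N e, size (indices (dims n (d - e) e.+1))) :=
  matz (dims n 1 (d - e).-1) (dims n (d - e) e.+1) y.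

Lemma ttrefE e : (e <= D)%N -> ttref e = unfolding x e *m (unfolding x e)^T.
Proof.
elim: e => [|e IH] eD.
  apply/matrixP => a b; rewrite !mxE.
  under eq_bigr do rewrite !mxE; under [RHS]eq_bigr do rewrite !mxE.
  rewrite -(sum_indices_ord _ (fun t => x (nth [::] (indices (dims n 1 (d - 0).-1)) a ++ t) *
    x (nth [::] (indices (dims n 1 (d - 0).-1)) b ++ t))) dims_cons indices_cons_sum.
  by apply: eq_bigr => i _; rewrite big_seq1 !cats1.
have ed : (e < d)%N by rewrite leqW// leqW// ltnW.
have -> : ttref e.+1 = ttpt (ttref e) by [].
rewrite IH ?(ltnW eD)//.
pose T := indices (dims n (d - e) e.+1).
pose h al l := x (al ++ nth [::] T l).
have -> : unfolding x e = tabmx (size T) h (rowidx n D e) by apply/matrixP => a b; rewrite !mxE.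
rewrite /ttpt ptrace_tabmx; last by move=> b i; apply: rowidx_mem; rewrite ltnW.
apply/matrixP => a b; cbv zeta; rewrite !mxE.
under eq_bigr do rewrite !mxE; under [RHS]eq_bigr do rewrite !mxE.
rewrite -(sum_indices_ord _ (fun t => x (nth [::] (rowidx n D e.+1) a ++ t) *
    x (nth [::] (rowidx n D e.+1) b ++ t))) dims_cons indices_cons_sum.
rewrite (sum_divmod _ _ (fun i l => h (rcons (nth [::] (rowidx n D e.+1) a) i) l *
   h (rcons (nth [::] (rowidx n D e.+1) b) i) l)).
apply: eq_bigr => i _; rewrite subnSK// sum_indices_ord.
by apply: eq_bigr => t _; rewrite /h !cat_rcons.
Qed.

Lemma sqn_unfolding y e : (e <= D)%N ->
  sqn (unfolding y e) = tnorm (dims n 1 d) y ^+ 2.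
Proof.
move=> eD; rewrite /tnorm sqr_sqrtr; last by rewrite sumr_ge0// => i _; exact: sqr_ge0.
have -> : dims n 1 d = dims n 1 (d - e).-1 ++ dims n (d - e) e.+1.
  have de : (0 < d - e)%N by rewrite subn_gt0 leqW// leqW.
  rewrite /dims -map_cat -[in iota (d - e) _](prednK de) -add1n -iotaD.
  congr (map n (iota 1 _)); rewrite addnS -addSn prednK// subnK// leqW// leqW//.
rewrite indices_cat_sum sum_indices_ord; apply: eq_bigr => a _.
by rewrite sum_indices_ord; apply: eq_bigr => b _; rewrite mxE.
Qed.

Lemma unfoldingB y e : unfolding x e - unfolding y e = unfolding (fun i => x i - y i) e.
Proof. by apply/matrixP => a b; rewrite !mxE. Qed.

Definition tttotal (v : 'rV[R]_(glen s N D.+1)) : R :=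
  \tr K0 - \tr (nys (chainK K0 (@ttpt R n D) (lsubmx v)) (vec_mx (rsubmx v) : 'M[R]_(s, N D))).

Lemma tr_ttpt e (K : 'M[R]_(N e)) : (e < D.+1)%N -> is_gram K -> \tr (ttpt K) = \tr K.
Proof.
move=> eD; apply: tr_ptrace.
- exact: indices_uniq.
- by move=> b i; exact: rowidx_mem.
- by move=> F; rewrite {1}/rowidx rowidx_rcons// indices_rcons_sum.
Qed.

(** Moving a mode preserves the trace, so the losses of the steps telescope. *)
Lemma good_total c (v : 'rV[R]_(glen s N D.+1)) :
  @good R s N K0 (@ttpt R n D) c D.+1 v -> tttotal v <= D.+1%:R * c.
Proof.
suff H e (w : 'rV[R]_(glen s N e.+1)) : (e <= D)%N -> @good R s N K0 (@ttpt R n D) c e.+1 w ->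
  \tr K0 - \tr (nys (chainK K0 (@ttpt R n D) (lsubmx w)) (vec_mx (rsubmx w) : 'M[R]_(s, N e))) <= e.+1%:R * c.
  by move=> gv; exact: H.
elim: e w => [|e IH] w eD gv.
  by have := proj2 gv; rewrite /defect mul1r.
pose w' : 'rV[R]_(glen s N e.+1) := lsubmx w.
have gw : @good R s N K0 (@ttpt R n D) c e.+1 w' := proj1 gv.
have dw : defect (chainK K0 (@ttpt R n D) w') (vec_mx (rsubmx w) : 'M[R]_(s, N e.+1)) <= c := proj2 gv.
have {}IH := IH _ (ltnW eD) gw; move: dw; rewrite /defect -/w'.
have -> : \tr (chainK K0 (@ttpt R n D) w') = \tr (nys (chainK K0 (@ttpt R n D) (lsubmx w'))
   (vec_mx (rsubmx w') : 'M[R]_(s, N e))).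
  rewrite [chainK _ _ w']/= tr_ttpt//; first exact: ltnW.
  by apply: nys_gram; apply: chainK_gram; [exact: ttK0_gram|exact: ttpt_gram].
by move=> dw; rewrite -natr1 mulrDl mul1r; lra.
Qed.

Lemma measurable_tttotal : measurable_fun setT (tttotal : _ -> measurableTypeR R).
Proof.
have [ml mr] := @measurable_submx _ _ _ 1 (glen s N D) (s * N D) _ (@measurable_id _ 'rV[R]_(glen s N D + s * N D) setT).
apply: measurable_funB => //; apply: measurable_sum => i.
apply: (measurableT_comp (measurable_coef i i)); apply: measurable_nys.
- by move=> v; apply: chainK_gram; [exact: ttK0_gram|exact: ttpt_gram].
- apply: (measurableT_comp _ ml); apply: measurable_chainK; [exact: ttK0_gram|exact: ttpt_gram|exact: measurable_ttpt].
- exact: (measurableT_comp (@measurable_vec_mx _ _ _) mr).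
Qed.

Lemma tttotal_run (g : nat -> nat -> seq nat -> R) (q : nat -> nat)
    (Q : forall j : nat, 'M[R]_(q j.-1, n j * q j)) : valid_run d s x g Q ->
  tnorm (dims n 1 d) (fun i => x i - ttsvd_out d x Q i) ^+ 2 = tttotal (ttvec n D s g D.+1).
Proof.
move=> run; rewrite (ttsvd_error_tr run) /tttotal.
by rewrite [ttvec _ _ _ _ _]/= row_mxKl row_mxKr mxvecK.
Qed.

End tt_final.

(** * Conclusion: one competitor, then all of them *)

Section attained.
Context (R : realType) (n : nat -> nat) (D : nat) (x : seq nat -> R) (r p : nat) (u t eta : R).
Let d := D.+2.
Let s := (r + p)%N.
Let del : R := 1 - 5 * t ^- p - 2 * expR (- (u ^+ 2) / 2).
Hypotheses (r0 : (1 <= r)%N) (p4 : (4 <= p)%N) (u1 : 1 <= u) (t1 : 1 <= t).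
Hypothesis etaE : eta = 1 + t * Num.sqrt (12 * r%:R / p%:R)
             + u * t * (expR 1 * Num.sqrt (r + p)%:R / (p.+1)%:R).

Definition ttdist (y : seq nat -> R) : R := tnorm (dims n 1 d) (fun i => x i - y i).

Lemma total_prob y : ttrank_le n d r y -> 0 <= del ->
  ((del ^+ D.+1)%:E <= gauss R 1 (glen s (ttN n D) D.+1)
    [set v | tttotal x v <= D.+1%:R * (eta ^+ 2 * ttdist y ^+ 2)]%R)%E.
Proof.
move=> yr del0.
have mtot := @measurable_tttotal R n D s x.
have gp := @good_prob R s (ttN n D) (ttK0 n D x) (@ttpt R n D) (@ttK0_gram R n D x)
  (@ttpt_gram R n D) (@ttpt_mono R n D) (@measurable_ttpt R n D)
  (eta ^+ 2 * ttdist y ^+ 2) del (ttref n D x) D.+1 del0.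
apply: (@le_trans _ _ (gauss R 1 (glen s (ttN n D) D.+1)
  (@good R s (ttN n D) (ttK0 n D x) (@ttpt R n D) (eta ^+ 2 * ttdist y ^+ 2) D.+1))); last first.
  apply: le_measure; rewrite ?inE.
  - by apply: measurable_good; [exact: ttK0_gram|exact: ttpt_gram|exact: measurable_ttpt].
  - exact: measurable_le.
  - by move=> v; exact: good_total.
apply: gp => //.
move=> e eD m M Mref; rewrite /del -addrA -opprD.
have [k [U [UU kY UY]]] := column_basis (unfolding n D y e).
apply: (tail_step r0 p4 u1 t1 _ UU _ etaE).
  apply: leq_trans kY _.
  (* The row modes at step e are 1, ..., d - e - 1, so the rank condition on y is used at i = d - e
     - 1. *)
  have de : (0 < (d - e).-1)%N by rewrite -subnS subn_gt0.
  have de1 : (0 < d - e)%N by rewrite subn_gt0 ltnW.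
  have := yr _ de; rewrite prednK//.
  have -> : (d - (d - e).-1 = e.+1)%N.
    by rewrite -subnS subKn// ltnW.
  by apply; rewrite -subnS subSS leq_subr.
have eD' : (e <= D)%N := eD.
rewrite /ttdist -(sqn_unfolding n (fun i => x i - y i) eD') -unfoldingB.
by apply: best_rank_defect => //; rewrite -ttrefE.
Qed.

End attained.

Theorem theorem2 (R : realType) (dT : measure_display) (T : measurableType dT)
  (P : probability T R)
  (d : nat) (n : nat -> nat) (x : seq nat -> R) (r p : nat)
  (G : nat * nat * seq nat -> T -> R) (u t : R) :
  (2 <= d)%N -> (1 <= r)%N -> (4 <= p)%N ->
  iid_std_gaussian P (gauss_index n d (r + p)) G ->
  1 <= u -> 1 <= t ->
  let s := (r + p)%N in
  let eta := 1 + t * Num.sqrt (12 * r%:R / p%:R)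
             + u * t * (expR 1 * Num.sqrt (r + p)%:R / (p.+1)%:R) in
  let E : set T := fun w =>
    forall (q : nat -> nat) (Q : forall j : nat, 'M[R]_(q j.-1, n j * q j)),
      @valid_run R n d s x (fun j k alpha => G (j, k, alpha) w) q Q ->
      forall y : seq nat -> R, ttrank_le n d r y ->
        tnorm (dims n 1 d) (fun i => x i - @ttsvd_out R n d x q Q i)
        <= Num.sqrt (d.-1)%:R * eta * tnorm (dims n 1 d) (fun i => x i - y i) in
  exists F : set T, measurable F /\ (F `<=` E)%classic /\
    (((Num.max 0 (1 - 5 * t ^- p - 2 * expR (- (u ^+ 2) / 2))) ^+ d.-1)%:E
      <= P F)%E.
Proof.
move=> d2 r0 p4 iid u1 t1 s eta E.
set del := 1 - _ - _.
case: d d2 iid @E => [//|[//|D]] _ iid E.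
(* If [del] is not positive the claimed bound is 0, as d - 1 > 0, and the empty event will do. *)
have [del0|del0] := leP del 0.
  exists set0; split; first exact: measurable0.
  by split; [|rewrite expr0n/= measure0].
have eD : (D.+1 <= D.+2)%N by [].
have [mV lawV] := iid_gauss_law iid (@ttidx_inj n D s D.+1 eD)
  (fun k => @ttidx_mem n D s D.+1 k (leqnn _)).
set V := fun w => \row_k _ in mV lawV.
have VE w : V w = ttvec n D s (fun j k alpha => G (j, k, alpha) w) D.+1.
  by rewrite (ttvecE n D s (fun i => G i w)).
have eta1 : 1 <= eta.
  rewrite /eta -addrA lerDl addr_ge0// !mulr_ge0 ?invr_ge0 ?expR_ge0 ?sqrtr_ge0//; lra.
(* Distances are squared to match [tttotal]; the zero tensor shows that the set is not empty. *)
pose S := [set z : R | exists2 y, ttrank_le n D.+2 r y & z = ttdist n D x y ^+ 2].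
have Slb : lbound S 0 by move=> z [y _ ->]; exact: sqr_ge0.
have Sne : S !=set0.
  exists (ttdist n D x (fun=> 0) ^+ 2); exists (fun=> 0) => // i _ _.
  rewrite (_ : matz _ _ _ = 0) ?mxrank0//.
  by apply/matrixP => a b; rewrite !mxE.
have Sinf : has_inf S by split=> //; exists 0.
set tau := inf S.
have mtot := measurableT_comp (@measurable_tttotal R n D s x) mV.
pose F (c : R) := [set w | tttotal x (V w) <= D.+1%:R * (eta ^+ 2 * c)].
have mF c : measurable (F c) by exact: measurable_le.
(* As tau lies below the squared distance of every admissible y, a single event serves all y,
   whether or not the infimum is attained. *)
exists (F tau); split; first exact: mF.
split.
  move=> w Fw q Q run y yr.
  have H := tttotal_run run; rewrite -VE in H.
  apply: le_of_sqr; first by rewrite !mulr_ge0 ?sqrtr_ge0//; lra.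
  rewrite H; apply: le_trans Fw _.
  rewrite !exprMn sqr_sqrtr ?ler0n// -mulrA ler_wpM2l ?ler0n// ler_wpM2l ?sqr_ge0//.
  by apply: ge_inf; [exists 0|exists y].
have PF y : ttrank_le n D.+2 r y -> ((del ^+ D.+1)%:E <= P (F (ttdist n D x y ^+ 2)%R))%E.
  move=> yr; have := total_prob x r0 p4 u1 t1 (erefl eta) yr (ltW del0).
  rewrite -lawV//; exact: measurable_le (@measurable_tttotal R n D s x).
have FtauE : F tau = \bigcap_k F (tau + harmonic k).
  apply/seteqP; split=> w /=.
    move=> Fw k _; apply: le_trans Fw _.
    by rewrite ler_wpM2l ?ler0n// ler_wpM2l ?sqr_ge0// lerDl harmonic_ge0.
  move=> Fw.
  have H : D.+1%:R * (eta ^+ 2 * (tau + harmonic k)) @[k --> \oo] -->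
      (D.+1%:R * (eta ^+ 2 * (tau + 0)) : R).
    apply: cvgM; first exact: cvg_cst.
    apply: cvgM; first exact: cvg_cst.
    by apply: cvgD; [exact: cvg_cst|exact: cvg_harmonic].
  rewrite addr0 in H; apply: (cvgr_to_ge H); apply: nearW => k; exact: Fw.
have FN : nonincreasing_seq (fun k => F (tau + harmonic k)).
  move=> i j ij; apply/subsetPset => w Fw; apply: le_trans Fw _.
  rewrite ler_wpM2l ?ler0n// ler_wpM2l ?sqr_ge0// lerD2l.
  by rewrite /harmonic lef_pV2 ?posrE ?ltr0n// ler_nat.
have mbig : measurable (\bigcap_k F (tau + harmonic k)) by rewrite -FtauE.
have F0oo : (P (F (tau + harmonic 0)%R) < +oo)%E.
  by apply: le_lt_trans (probability_le1 P (mF _)) _; exact: ltry.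
have := @nonincreasing_cvg_mu _ _ _ P (fun k => F (tau + harmonic k)) F0oo (fun k => mF _) mbig FN; rewrite -FtauE => cvgF.
apply: (cvge_to_ge cvgF); apply: nearW => k /=.
have k0 : 0 < harmonic k :> R by rewrite invr_gt0 ltr0n.
(* A competitor within 1 / (k + 1) of the infimum bounds the probability of the k-th event from
   below. *)
have [z [y yr ->] zlt] := inf_adherent k0 Sinf.
apply: le_trans (PF y yr) _; apply: le_measure; rewrite ?inE; [exact: mF..|].
move=> w Fw; apply: le_trans Fw _.
by rewrite ler_wpM2l ?ler0n// ler_wpM2l ?sqr_ge0//; exact: ltW.
Qed.
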